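(* Let $[a,b]\subset\mathbf{R}\subset\mathbf{C}$ be a closed bounded interval, let $k\ge 1$ be an integer, and let $a_1,a_2,\dots,a_k\in R_0([a,b])$. Then the set $$\Gamma=\Big\{(z,w)\in [a,b]\times\mathbf{C}\colon\ w^k+a_1(z)w^{k-1}+\dots+a_k(z)=0\Big\}$$ (the graph of an algebroid function) is pluripolar in $\mathbf{C}^2$.
   Context: For a compact set $K\subset\mathbf{C}^n$, $C(K)$ denotes the continuous complex-valued functions on $K$ and $\|\cdot\|_K$ the uniform (supremum) norm on $K$. For $f\in C(K)$ and $m=1,2,\dots$, let $$\rho_m(f,K)=\inf_{r_m}\|f-r_m\|_K,$$ where the infimum is over all rational functions of the form $$r_m(z)=\frac{\sum_{|\alpha|\le m}a_\alpha z^\alpha}{\sum_{|\alpha|\le m}b_\alpha z^\alpha},$$ with complex coefficients, $\alpha=(\alpha_1,\dots,\alpha_n)$ being a multiindex (so numerator and denominator are polynomials of degree at most $m$). Define $$R_0(K)=\Big\{f\in C(K)\colon\ \limsup_{m\to\infty}\sqrt[m]{\rho_m(f,K)}<1\Big\}.$$ Here this is used with $n=1$ and $K=[a,b]$. A set $E\subset\mathbf{C}^N$ is pluripolar in $\mathbf{C}^N$ if there is a plurisubharmonic function $u$ on $\mathbf{C}^N$, $u\not\equiv-\infty$, with $E\subset\{u=-\infty\}$. *)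

(* Defs.v *)
From HB Require Import structures.
From mathcomp Require Import all_boot all_order all_algebra.
From mathcomp Require Import all_classical all_reals all_analysis.
From mathcomp Require Export complex.

Set Implicit Arguments.
Unset Strict Implicit.
Unset Printing Implicit Defensive.

Import Order.TTheory GRing.Theory Num.Theory.
Import numFieldNormedType.Exports.

Local Open Scope classical_set_scope.
Local Open Scope ring_scope.
Local Open Scope complex_scope.

(* The analysis library gives every abstract numFieldType its norm topology by
   such copies, but not the concrete type R[i]. *)
HB.instance Definition _ (R : rcfType) := GRing.ComAlgebra.copy R[i] R[i]^o.
HB.instance Definition _ (R : rcfType) := Vector.copy R[i] R[i]^o.
HB.instance Definition _ (R : rcfType) := NormedModule.copy R[i] R[i]^o.

Section RationalApproximation.
Variable R : realType.
Implicit Types (K : set R[i]) (f : R[i] -> R[i]) (m : nat).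

(* The library norm on R[i] takes its values in R[i]; normc is the same modulus
   with values in R. *)
Definition sup_norm K f : \bar R :=
  ereal_sup [set (Normc.normc (f z))%:E | z in K].

(* The restrictions to K of the quotients p / q with deg p, deg q <= m. In one
   variable a rational function may be reduced to lowest terms without raising
   these degrees, and it is then bounded on K near the zeros of its denominator
   only if there are none in K; so requiring q to have no zero in K loses no
   rational function at finite uniform distance from a continuous one. *)
Definition rational_on K m : set (R[i] -> R[i]) :=
  [set r | exists p q : {poly R[i]},
    [/\ (size p <= m.+1)%N, (size q <= m.+1)%N,
        (forall z, K z -> q.[z] != 0) &
        r = (fun z => p.[z] / q.[z])]].

Definition rho K f m : \bar R :=
  ereal_inf [set sup_norm K (fun z => f z - r z) | r in rational_on K m].

(* Elements of C(K) are represented by total functions, of which only the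
   values on K matter. *)
Definition R0 K : set (R[i] -> R[i]) :=
  [set f | {within K, continuous f} /\
    (limn_esup (fun m => rho K f m `^ (m%:R^-1)) < 1)%E].

Definition real_segment (a b : R) : set R[i] :=
  [set x%:C | x in `[a, b]].

End RationalApproximation.

Section Pluripolar.
Variable R : realType.

Definition upper_semicontinuous (X : topologicalType) (u : X -> \bar R) : Prop :=
  lower_semicontinuous (fun x => - u x)%E.

Definition circle_mean (v : R[i] -> \bar R) (c : R[i]) (r : R) : \bar R :=
  (((2 * pi)^-1)%:E *
   \int[lebesgue_measure]_(t in `[0%R, (2 * pi)%R])
     v (c + r%:C * (cos t +i* sin t))%R)%E.

(* The function identically -oo counts as subharmonic. Upper semicontinuity and
   v < +oo bound v above on circles, so circle_mean is well defined, possibly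
   -oo. *)
Definition subharmonic (v : R[i] -> \bar R) : Prop :=
  [/\ (forall z, v z < +oo)%E,
      upper_semicontinuous v &
      forall (c : R[i]) (r : R), 0 < r -> (v c <= circle_mean v c r)%E].

Definition plurisubharmonic (N : nat) (u : 'rV[R[i]]_N -> \bar R) : Prop :=
  [/\ (forall z, u z < +oo)%E,
      upper_semicontinuous u &
      forall a b : 'rV[R[i]]_N, subharmonic (fun zeta => u (a + zeta *: b))].

Definition pluripolar (N : nat) (E : set 'rV[R[i]]_N) : Prop :=
  exists u : 'rV[R[i]]_N -> \bar R,
    [/\ plurisubharmonic u,
        (exists z, u z != -oo%E) &
        E `<=` [set z | u z = -oo%E]].

End Pluripolar.

Section Algebroid.
Variable R : realType.

(* Points (z, w) of C^2 are row vectors; c i is the coefficient of w ^+ (k - i)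
   for 1 <= i <= k. *)
Definition algebroid_graph (K : set R[i]) (k : nat) (c : nat -> R[i] -> R[i]) :
    set 'rV[R[i]]_2 :=
  [set p | let z := p ord0 ord0 in let w := p ord0 ord_max in
    K z /\ w ^+ k + \sum_(1 <= i < k.+1) c i z * w ^+ (k - i) = 0].

End Algebroid.

(* Main.v *)
(** Rational approximation of the coefficients, multiplied out, gives polynomials
    [P_m(z,w)] of degree [d_m = k m] whose leading coefficient [q_m(z)] in [w] may be
    normalised to Mahler measure 1, with [|P_m| <= |q_m| exp (- c d_m)] on the graph.
    Where [(log |q_m(z)|) / d_m] tends to [-oo] after regularisation, the limsup of
    these functions is a subharmonic function of [z] equal to [-oo]. The other points
    of the graph lie in countably many pieces [S] such that, along a subsequence, the
    bound for [|P_m|] on [S] is smaller by a fixed exponential factor than values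
    taken arbitrarily close to every point of [S] (a one-variable maximum principle
    applied first in [w], then in [z]).

    Such a piece is "null": for every [A] some polynomial of degree [d] with
    coefficients of maximal modulus 1 is at most [exp (- A d)] on it. Otherwise the
    maximal Vandermonde determinants of the [r]-neighbourhoods of [S] for degree [N]
    would lose a factor [exp (- g N^3)] at each of arbitrarily many successive
    shrinkings of [r], while the total loss down to [S] itself is only
    [exp (- C N^3)]. Countably many null sets are then absorbed into one weighted sum
    of the functions [(log |P|) / d], and Jensen's inequality on the unit circle
    provides a point where the sum is finite. *)

Require Import Defs.
From mathcomp Require Import all_boot all_order all_algebra.
From mathcomp Require Import all_classical all_reals all_analysis.
From mathcomp Require Import measurable_realfun perm ring lra zify.
Set Implicit Arguments.
Unset Strict Implicit.
Unset Printing Implicit Defensive.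
Import Order.TTheory GRing.Theory Num.Theory numFieldNormedType.Exports.
Local Open Scope classical_set_scope.
Local Open Scope ring_scope.
Local Open Scope complex_scope.
Local Notation nc := Normc.normc.

(** * Circle means and Jensen's inequality *)

Section CircleMean.
Variable R : realType.
Implicit Types (f g : R -> R).
Local Notation mu := (@lebesgue_measure R).

(** The obstacle is the denominators: [|P_m|] is exponentially small on the graph only relative to
    [|q_m|]. The exceptional points lie in negligible sets, where a limsup of functions
    [(log |P|) / d] falls below its regularisation. That such sets are pluripolar is the
    Bedford-Taylor theorem, usually proved with the complex Monge-Ampere operator; the Vandermonde
    count replaces it here. In each of its [(N+1)^2] points a determinant of degree N is a
    polynomial about which nothing else is known, so the maximum principle must hold with an
    arbitrary polynomial weight [V]. Each point gains a factor [exp (g N)], which explains the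
    exponent [N^3]. To turn the gain into an inequality between neighbourhoods, one polynomial [F]
    of degree N is multiplied into the monomials of degree N; the comparison then takes place in
    degree 2N, and the determinant of degree N cancels. Mahler measure 1 is the right normalisation
    because it makes the means of the regularised logarithms over the unit circle nonnegative, which
    keeps their limit from being identically [-oo]. *)

Definition cmean g : R := (2 * pi)^-1 * \int[mu]_(t in `[0, 2 * pi]) g t.

Lemma twopi_gt0 : 0 < 2 * pi :> R.
Proof. by rewrite mulr_gt0 // pi_gt0. Qed.

Lemma continuous_itv_integrable g a b : continuous g ->
  mu.-integrable `[a, b] (EFin \o g).
Proof.
move=> cg; apply: continuous_compact_integrable; first exact: segment_compact.
exact: continuous_subspaceT.
Qed.

Lemma cmeanD f g : continuous f -> continuous g ->
  cmean (fun t => f t + g t) = cmean f + cmean g.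
Proof.
move=> cf cg; rewrite /cmean RintegralD ?mulrDr //; exact: continuous_itv_integrable.
Qed.

Lemma cmeanZ k g : continuous g -> cmean (fun t => k * g t) = k * cmean g.
Proof.
move=> cg; have ig := @continuous_itv_integrable g 0 (2 * pi) cg.
by rewrite /cmean RintegralZl //; exact: mulrCA.
Qed.

Lemma cmean_cst k : cmean (fun=> k) = k.
Proof.
rewrite /cmean Rintegral_cst //=; set m := lebesgue_measure _.
have -> : m = (2 * pi)%:E by rewrite /m lebesgue_measure_itv /= lte_fin twopi_gt0 oppr0 addr0.
rewrite /=.
by rewrite mulrCA mulVf ?mulr1 // gt_eqF // twopi_gt0.
Qed.

Lemma cmean_le f g : continuous f -> continuous g -> (forall t, f t <= g t) ->
  cmean f <= cmean g.
Proof.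
move=> cf cg fg; rewrite /cmean ler_wpM2l // ?invr_ge0 ?(ltW twopi_gt0) //.
by apply: le_Rintegral => //; exact: continuous_itv_integrable.
Qed.

Lemma cmean_sum (I : eqType) (s : seq I) (F : I -> R -> R) :
  (forall i, i \in s -> continuous (F i)) ->
  continuous (fun t => \sum_(i <- s) F i t) /\
  cmean (fun t => \sum_(i <- s) F i t) = \sum_(i <- s) cmean (F i).
Proof.
elim: s => [|i s IH] cF.
  rewrite big_nil (_ : (fun t => _) = fun=> 0) ?cmean_cst; last first.
    by apply/funext=> t; rewrite big_nil.
  by split=> // t; exact: cvg_cst.
have [|cs ms] := IH; first by move=> j js; apply: cF; rewrite inE js orbT.
have ci : continuous (F i) by apply: cF; rewrite inE eqxx.
rewrite (_ : (fun t => _) = fun t => F i t + \sum_(i <- s) F i t); last first.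
  by apply/funext => u; rewrite big_cons.
split; first by move=> t; apply: cvgD; [exact: ci | exact: cs].
by rewrite big_cons cmeanD // ms.
Qed.

Lemma cmean_attained g : continuous g ->
  exists2 t, t \in `[0, 2 * pi] & cmean g <= g t.
Proof.
move=> cg; have [|t tI Ht] := @EVT_max R g 0 (2 * pi) (ltW twopi_gt0).
  exact: continuous_subspaceT.
exists t => //; rewrite -[leRHS]cmean_cst /cmean ler_wpM2l // ?invr_ge0 ?(ltW twopi_gt0) //.
apply: le_Rintegral => //; first exact: continuous_itv_integrable.
by apply: continuous_itv_integrable => u; exact: cvg_cst.
Qed.

Lemma integral_shift g a b s : a <= b -> continuous g ->
  \int[mu]_(t in `[a + s, b + s]) g t = \int[mu]_(t in `[a, b]) g (t + s).
Proof.
move=> ab cg; rewrite /Rintegral; congr fine.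
have dF (x : R) : derivable (fun t : R => t + s) x 1.
  by apply: derivableD; [exact: derivable_id | exact: derivable_cst].
have d1 : derive1 (fun t : R => t + s) = cst 1.
  by apply/funext => x; rewrite derive1E deriveD // derive_id derive_cst addr0.
rewrite (@integration_by_substitution_increasing R (fun t => t + s) g a b) //.
- by apply: eq_integral => x _; rewrite !fctE d1 mulr1.
- by move=> x y _ _; rewrite ltrD2r.
- by rewrite d1 => x _; exact: cvg_cst.
- by rewrite d1; exact: is_cvg_cst.
- by rewrite d1; exact: is_cvg_cst.
- split => [x _ //||].
  + by apply: cvg_at_right_filter; apply: cvgD; [exact: cvg_id|exact: cvg_cst].
  + by apply: cvg_at_left_filter; apply: cvgD; [exact: cvg_id|exact: cvg_cst].
- exact: continuous_subspaceT.
Qed.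

Lemma integral_split g a b c : a <= b <= c -> continuous g ->
  \int[mu]_(t in `[a, c]) g t =
  \int[mu]_(t in `[a, b]) g t + \int[mu]_(t in `[b, c]) g t.
Proof.
move=> /andP[ab bc] cg; apply/eqP; rewrite addrC -subr_eq; apply/eqP.
rewrite Rintegral_itvB ?bnd_simp //; last exact: continuous_itv_integrable.
rewrite Rintegral_itv_obnd_cbnd //.
apply: (@integrableS _ _ _ mu `[b, c]) => //; last exact: continuous_itv_integrable.
exact: subset_itv_oc_cc.
Qed.

Lemma cmean_shift g s : 0 <= s <= 2 * pi -> continuous g ->
  (forall t, g (t + 2 * pi) = g t) -> cmean (fun t => g (t + s)) = cmean g.
Proof.
move=> /andP[s0 s2] cg per; rewrite /cmean; congr (_ * _).
rewrite -(@integral_shift g 0 (2 * pi) s (ltW twopi_gt0) cg) add0r.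
rewrite (@integral_split g s (2 * pi)) ?s2 ?lerDl //.
rewrite (@integral_split g 0 s (2 * pi)) ?s0 // addrC; congr (_ + _).
rewrite -[X in `[X, _]]add0r (addrC _ s) integral_shift //.
by apply: eq_Rintegral => t _; rewrite per.
Qed.

End CircleMean.

(** * Modulus and locally Lipschitz functions *)

Section Modulus.
Variable R : realType.
Local Notation C := R[i].
Implicit Types (x y z a c : C) (p q : {poly C}).

Lemma nc_ge0 z : 0 <= nc z.
Proof. by case: z => a b; rewrite sqrtr_ge0. Qed.

Lemma nc_eq0 z : (nc z == 0) = (z == 0).
Proof.
by apply/eqP/eqP => [/Normc.eq0_normc //|->]; exact: Normc.normc0.
Qed.

Lemma nc_gt0 z : (0 < nc z) = (z != 0).
Proof. by rewrite lt_neqAle nc_ge0 andbT eq_sym nc_eq0. Qed.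

Lemma ncM x y : nc (x * y) = nc x * nc y. Proof. exact: Normc.normcM. Qed.
Lemma ncD x y : nc (x + y) <= nc x + nc y. Proof. exact: le_normcD. Qed.
Lemma ncN x : nc (- x) = nc x. Proof. exact: normcN. Qed.
Lemma ncB x y : nc (x - y) <= nc x + nc y.
Proof. by rewrite -(ncN y); exact: ncD. Qed.
Lemma nc_distC x y : nc (x - y) = nc (y - x).
Proof. by rewrite -ncN opprB. Qed.

Lemma nc0 : nc (0 : C) = 0. Proof. exact: Normc.normc0. Qed.
Lemma nc1 : nc (1 : C) = 1. Proof. exact: Normc.normc1. Qed.

Lemma ncX x n : nc (x ^+ n) = nc x ^+ n.
Proof. by elim: n => [|n IH]; rewrite ?nc1 // !exprS ncM IH. Qed.

Lemma nc_prod (I : Type) (s : seq I) (F : I -> C) :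
  nc (\prod_(i <- s) F i) = \prod_(i <- s) nc (F i).
Proof. by elim: s => [|i s IH]; rewrite ?big_nil ?nc1 // !big_cons ncM IH. Qed.

Lemma nc_sum (I : Type) (s : seq I) (P : pred I) (F : I -> C) :
  nc (\sum_(i <- s | P i) F i) <= \sum_(i <- s | P i) nc (F i).
Proof.
elim: s => [|i s IH]; first by rewrite !big_nil nc0.
rewrite !big_cons; case: ifP => // _; apply: le_trans (ncD _ _) _.
by rewrite lerD2l.
Qed.

Lemma nc_real (r : R) : nc r%:C = `|r|.
Proof. by rewrite /Normc.normc /= expr0n addr0 sqrtr_sqr. Qed.

Lemma nc_realM (r : R) z : 0 <= r -> nc (r%:C * z) = r * nc z.
Proof. by move=> r0; rewrite ncM nc_real ger0_norm. Qed.

Lemma nc_norm z : `|z| = (nc z)%:C.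
Proof. by case: z => a b; rewrite normc_def. Qed.

Lemma nc_conj z : nc (conjc z) = nc z.
Proof. by case: z => a b; rewrite /= sqrrN. Qed.

Lemma nc_dist x y : `|nc x - nc y| <= nc (x - y).
Proof.
rewrite ler_norml; apply/andP; split.
  rewrite lerNl opprB lerBlDr nc_distC; apply: le_trans (ncD _ _).
  by rewrite subrK.
by rewrite lerBlDr; apply: le_trans (ncD _ _); rewrite subrK.
Qed.

Lemma nc_Re z : `|complex.Re z| <= nc z.
Proof.
case: z => a b /=; rewrite -sqrtr_sqr ler_sqrt ?addr_ge0 ?sqr_ge0 //.
by rewrite lerDl sqr_ge0.
Qed.

Lemma nc_Im z : `|complex.Im z| <= nc z.
Proof.
case: z => a b /=; rewrite -sqrtr_sqr ler_sqrt ?addr_ge0 ?sqr_ge0 //.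
by rewrite lerDr sqr_ge0.
Qed.

Lemma nc_le z : nc z <= `|complex.Re z| + `|complex.Im z|.
Proof.
have -> : z = (complex.Re z)%:C + 'i%C * (complex.Im z)%:C by exact: complexE.
apply: le_trans (ncD _ _) _; rewrite ncM !nc_real.
have -> : nc 'i%C = 1 :> R by rewrite /Normc.normc /= expr0n expr1n add0r sqrtr1.
by rewrite mul1r; case: z => a b /=; rewrite !(mul0r, mul1r, mulr0, subr0, addr0, add0r).
Qed.

Lemma conjcM x y : conjc (x * y) = conjc x * conjc y.
Proof. exact: rmorphM. Qed.

Lemma conjcB x y : conjc (x - y) = conjc x - conjc y.
Proof. exact: rmorphB. Qed.

(** Lipschitz on each disc about 0: strong enough to compare nearby circles uniformly, as [jensen]
    does, and to give continuity along circles. *)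
Definition lipC (f : C -> R) := forall M : R, exists2 L : R, 0 <= L &
  forall x y, nc x <= M -> nc y <= M -> `|f x - f y| <= L * nc (x - y).

Lemma poly_bounded p (M : R) :
  exists2 K : R, 0 <= K & forall x, nc x <= M -> nc p.[x] <= K.
Proof.
exists (\sum_(i < size p) nc p`_i * `|M| ^+ i).
  by apply: sumr_ge0 => i _; rewrite mulr_ge0 ?nc_ge0 ?exprn_ge0.
move=> x xM; rewrite horner_coef; apply: le_trans (nc_sum _ _ _) _.
apply: ler_sum => i _; rewrite ncM ncX ler_wpM2l ?nc_ge0 //.
by rewrite lerXn2r ?nnegrE ?nc_ge0 // (le_trans xM) // ler_norm.
Qed.

Lemma lipC_poly p (M : R) : exists2 L : R, 0 <= L &
  forall x y, nc x <= M -> nc y <= M -> nc (p.[x] - p.[y]) <= L * nc (x - y).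
Proof.
elim/poly_ind: p => [|p k [L L0 IH]].
  by exists 0 => // x y _ _; rewrite !horner0 subrr nc0 mul0r.
have [K K0 HK] := poly_bounded p M.
exists (L * `|M| + K) => [|x y xM yM]; first by rewrite addr_ge0 ?mulr_ge0.
rewrite !hornerMXaddC (_ : _ - _ = (p.[x] - p.[y]) * x + p.[y] * (x - y)); last by ring.
apply: le_trans (ncD _ _) _; rewrite !ncM mulrDl lerD //.
  rewrite -mulrA (mulrC `|M|) mulrA ler_pM ?nc_ge0 ?IH //.
  by rewrite (le_trans xM) // ler_norm.
by rewrite ler_wpM2r ?nc_ge0 // HK.
Qed.

(** Truncation at [e] confines the logarithm to the region where its slope is at most [e^-1], so the
    zeros of a polynomial cause no singularity. *)
Lemma ln_max_lip (e u v : R) : 0 < e ->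
  `|ln (Num.max e u) - ln (Num.max e v)| <= e^-1 * `|u - v|.
Proof.
move=> e0; wlog uv : u v / u <= v.
  by move=> H; case: (leP u v) => [/H //|/ltW /H]; rewrite distrC (distrC v).
have mu : 0 < Num.max e u by rewrite lt_max e0.
have mv : 0 < Num.max e v by rewrite lt_max e0.
have muv : Num.max e u <= Num.max e v by rewrite le_max2 //.
rewrite distrC ger0_norm ?subr_ge0 ?ler_ln // -ln_div //.
rewrite distrC ger0_norm ?subr_ge0 //.
have -> : Num.max e v / Num.max e u = 1 + (Num.max e v - Num.max e u) / Num.max e u.
  by field; rewrite gt_eqF.
apply: le_trans (le_ln1Dx _) _.
  by rewrite (lt_le_trans (ltrN10 _)) // divr_ge0 ?subr_ge0 // ltW.
rewrite mulrC ler_pM ?invr_ge0 ?subr_ge0 ?(ltW mu) //.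
  by rewrite lef_pV2 ?posrE // le_max lexx.
by rewrite /Num.max; do 2 case: ifP => //; lra.
Qed.

Lemma lipC_lnmax p (e : R) : 0 < e -> lipC (fun z => ln (Num.max e (nc p.[z]))).
Proof.
move=> e0 M; have [L L0 H] := lipC_poly p M.
exists (e^-1 * L) => [|x y xM yM]; first by rewrite mulr_ge0 ?invr_ge0 ?(ltW e0).
apply: le_trans (ln_max_lip _ _ e0) _; rewrite -mulrA ler_wpM2l ?invr_ge0 ?(ltW e0) //.
exact: le_trans (nc_dist _ _) (H _ _ xM yM).
Qed.

Definition E (t : R) : C := cos t +i* sin t.

Lemma nc_E t : nc (E t) = 1.
Proof. by rewrite /Normc.normc /= cos2Dsin2 sqrtr1. Qed.

Lemma ED s t : E (s + t) = E s * E t.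
Proof. by rewrite /E cosD sinD; apply/eqP; rewrite eq_complex /= eqxx /= addrC. Qed.

Lemma E_pi : E pi = -1.
Proof. by rewrite /E cospi sinpi; apply/eqP; rewrite eq_complex /= oppr0 !eqxx. Qed.

Lemma E_2pi : E (2 * pi) = 1.
Proof. by rewrite mulr2n mulrDl mul1r ED E_pi mulrNN mulr1. Qed.

Lemma EX t n : E t ^+ n = E (t *+ n).
Proof.
elim: n => [|n IH]; last by rewrite exprS mulrS ED IH.
by rewrite mulr0n expr0 /E cos0 sin0.
Qed.

Lemma conj_E t : E t * conjc (E t) = 1.
Proof.
rewrite /E; apply/eqP; rewrite eq_complex /=; apply/andP; split; apply/eqP.
  by rewrite mulrN opprK -!expr2 cos2Dsin2.
by ring.
Qed.

Lemma circ_le c (r t : R) : nc (c + r%:C * E t) <= nc c + `|r|.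
Proof. by apply: le_trans (ncD _ _) _; rewrite ncM nc_real nc_E mulr1. Qed.

Lemma lipC_circ f c (r : R) : lipC f -> continuous (fun t => f (c + r%:C * E t)).
Proof.
move=> lf t; have [L L0 H] := lf (nc c + `|r|).
apply/cvgrPdist_lt => e e0.
have K0 : 0 < L * `|r| + 1 by rewrite ltr_wpDl // mulr_ge0.
have e2 : 0 < e / (L * `|r| + 1) / 2 by rewrite !divr_gt0.
have /cvgrPdist_lt /(_ _ e2) Hc := @continuous_cos R t.
have /cvgrPdist_lt /(_ _ e2) Hs := @continuous_sin R t.
near=> s; apply: le_lt_trans (H _ _ (circ_le _ _ _) (circ_le _ _ _)) _.
rewrite opprD addrACA subrr add0r -mulrBr ncM nc_real.
have : nc (E t - E s) < e / (L * `|r| + 1).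
  apply: le_lt_trans (nc_le _) _; rewrite /E /=.
  rewrite [ltRHS](_ : _ = e / (L * `|r| + 1) / 2 + e / (L * `|r| + 1) / 2).
    by apply: ltrD; near: s.
  by rewrite -splitr.
rewrite ltr_pdivlMr // => H1; apply: le_lt_trans H1.
by rewrite mulrA mulrC ler_wpM2l ?nc_ge0 // lerDl.
Unshelve. all: by end_near.
Qed.

End Modulus.

(** * Mean values of [log |z - a|] on circles *)

Section Jensen.
Variable R : realType.
Local Notation C := R[i].
Implicit Types (x y z a c : C) (p q : {poly C}) (r e : R).

Lemma lnmax_poly_continuous p c r e : 0 < e ->
  continuous (fun t => ln (Num.max e (nc p.[c + r%:C * E t]))).
Proof. by move=> e0; exact: lipC_circ (lipC_lnmax p e0). Qed.

Lemma nc_1B_ge a z : nc z = 1 -> 1 - nc a <= nc (1 - a * z).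
Proof.
move=> z1; rewrite lerBlDr -[X in X <= _](nc1 R).
have -> : nc a = nc (a * z) by rewrite ncM z1 mulr1.
by apply: le_trans (ncD _ _); rewrite subrK.
Qed.

(* [1 - a^2 E^(2k) = (1 - a E^k) (1 + a E^k)] and the second factor is a rotation of the
   first, so squaring [a] and doubling [k] doubles the mean of [psi a k]; as the means
   stay bounded, they vanish. *)
Let psi a k t : R := ln (nc (1 - a * E t ^+ k)).

Let psiE a k : nc a < 1 -> psi a k =
  fun t => ln (Num.max (1 - nc a) (nc (1 - a%:P * 'X^k).[0 + 1%:C * E t])).
Proof.
move=> a1; apply/funext => t; rewrite /psi add0r mul1r !hornerE.
rewrite max_r // nc_1B_ge //; by rewrite ncX nc_E expr1n.
Qed.

Let psi_continuous a k : nc a < 1 -> continuous (psi a k).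
Proof.
by move=> a1; rewrite (psiE _ a1); apply: lnmax_poly_continuous; rewrite subr_gt0.
Qed.

Let psi_pos a k t : nc a < 1 -> 0 < nc (1 - a * E t ^+ k).
Proof.
move=> a1; apply: lt_le_trans (nc_1B_ge a _); first by rewrite subr_gt0.
by rewrite ncX nc_E expr1n.
Qed.

Let psi_double a k : (0 < k)%N -> nc a < 1 ->
  cmean (psi (a ^+ 2) (2 * k)) = 2 * cmean (psi a k).
Proof.
move=> k0 a1; have a1' : nc (- a) < 1 by rewrite ncN.
have -> : psi (a ^+ 2) (2 * k) = fun t => psi a k t + psi (- a) k t.
  apply/funext => t; rewrite /psi -lnM ?posrE ?psi_pos //.
  rewrite -ncM; congr (ln (nc _)); rewrite mulnC exprM; ring.
rewrite cmeanD; [|exact: psi_continuous|exact: psi_continuous].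
have -> : psi (- a) k = fun t => psi a k (t + pi / k%:R).
  apply/funext => t; rewrite /psi; congr (ln (nc _)).
  rewrite ED exprMn (EX (pi / k%:R)).
  have -> : (pi / k%:R) *+ k = pi :> R.
    by rewrite -(mulr_natr (pi / k%:R)) divfK // pnatr_eq0 -lt0n.
  by rewrite E_pi; ring.
rewrite cmean_shift; [by ring | | exact: psi_continuous | ].
  have pi0 := @pi_gt0 R.
  rewrite divr_ge0 ?ler0n ?(ltW pi0) //= ler_pdivrMr ?ltr0n //.
  have : 1 <= k%:R :> R by rewrite ler1n.
  by nra.
by move=> t; rewrite /psi ED E_2pi mulr1.
Qed.

(** The bound is in terms of [b], not [nc a], so that a single one serves all the powers
    [a ^+ (2 ^ n)]. *)
Let psi_bound a k b : nc a <= b -> b < 1 -> `|cmean (psi a k)| <= ln 2 - ln (1 - b).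
Proof.
move=> ab b1; have a1 := le_lt_trans ab b1.
have b0 : 0 <= b by apply: le_trans (nc_ge0 a) ab.
have p2 t : psi a k t <= ln 2.
  rewrite /psi ler_ln ?posrE ?psi_pos //; apply: le_trans (ncB _ _) _.
  by rewrite nc1 ncM ncX nc_E expr1n mulr1; lra.
have p1 t : ln (1 - b) <= psi a k t.
  rewrite /psi ler_ln ?posrE ?psi_pos ?subr_gt0 //.
  apply: le_trans (nc_1B_ge a _); first by rewrite lerB.
  by rewrite ncX nc_E expr1n.
have l1 : ln (1 - b) <= 0 by apply: ln_le0; lra.
have l2 : 0 <= ln (2 : R) by apply: ln_ge0; lra.
have cc u : continuous (fun _ : R => u : R) by move=> ?; exact: cvg_cst.
have := cmean_le (psi_continuous (k := k) a1) (cc _) p2.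
have := cmean_le (cc _) (psi_continuous (k := k) a1) p1.
by rewrite !cmean_cst ler_norml => H1 H2; apply/andP; split; lra.
Qed.

Lemma cmean_ln_1B a : nc a < 1 -> cmean (fun t => ln (nc (1 - a * E t))) = 0.
Proof.
move=> a1; have -> : (fun t => ln (nc (1 - a * E t))) = psi a 1.
  by apply/funext => t; rewrite /psi expr1.
have H n : cmean (psi (a ^+ (2 ^ n)) (2 ^ n)) = 2 ^+ n * cmean (psi a 1).
  elim: n => [|n IH]; first by rewrite !expr1 mul1r.
  rewrite expnS mulnC exprM mulnC psi_double ?expn_gt0 // ?IH ?exprS ?mulrA //.
  by rewrite ncX exprn_ilt1 ?nc_ge0 // expn_eq0.
set K := ln 2 - ln (1 - nc a).
apply/eqP; rewrite -normr_eq0 eq_le normr_ge0 andbT leNgt; apply/negP => p0.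
have [n Hn] : exists n, K / `|cmean (psi a 1)| < n%:R.
  by exists (Num.truncn (K / `|cmean (psi a 1)|)).+1; exact: truncnS_gt.
have := @psi_bound (a ^+ (2 ^ n)) (2 ^ n)%N (nc a) _ a1.
rewrite H normrM ger0_norm ?exprn_ge0 // -/K => H1.
have /H1 {H1} : nc (a ^+ (2 ^ n)) <= nc a.
  rewrite ncX -[leRHS]expr1; apply: ler_wiXn2l; rewrite ?nc_ge0 ?(ltW a1) //.
  by rewrite expn_gt0.
apply/negP; rewrite -ltNge; move: Hn; rewrite ltr_pdivrMr // => Hn.
apply: lt_le_trans Hn _; rewrite ler_wpM2r // -natrX ler_nat ltnW // ltn_expl //.
Qed.

(** Pulling out the larger of [r] and [nc (a - c)] reduces both cases to [cmean_ln_1B]; the mean is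
    the logarithm of that larger number. *)
Lemma cmean_ln_dist c a r : 0 < r -> c != a -> nc (a - c) != r ->
  ln (nc (c - a)) <= cmean (fun t => ln (nc (c + r%:C * E t - a))).
Proof.
move=> r0 ca nr; have ac0 : 0 < nc (a - c) by rewrite nc_gt0 subr_eq0 eq_sym.
have rC : r%:C != 0 :> C by rewrite -nc_eq0 nc_real normr_eq0 gt_eqF.
have acC : a - c != 0 by rewrite -nc_eq0 gt_eqF.
have aux (d : R) (b : C) : 0 < d -> nc b < 1 ->
    cmean (fun t => ln (d * nc (1 - b * E t))) = ln d.
  move=> d0 b1.
  have e1 : psi b 1 = fun t => ln (nc (1 - b * E t)).
    by apply/funext => t; rewrite /psi expr1.
  have -> : (fun t => ln (d * nc (1 - b * E t))) = fun t => ln d + psi b 1 t.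
    apply/funext => t; rewrite /psi expr1 lnM ?posrE //.
    by have := @psi_pos b 1 t b1; rewrite expr1.
  rewrite cmeanD ?cmean_cst; [|by move=> ?; exact: cvg_cst|exact: psi_continuous].
  by rewrite e1 cmean_ln_1B // addr0.
have [ltr|ltr|/eqP] := ltgtP (nc (a - c)) r; last by rewrite (negbTE nr).
- have -> : (fun t => ln (nc (c + r%:C * E t - a))) =
      fun t => ln (r * nc (1 - (conjc (a - c) / r%:C) * E t)).
    apply/funext => t; congr ln; rewrite -nc_realM ?ltW //.
    (* Conjugating and then multiplying by [E t] preserves the modulus and frees [a - c] of its
       factor [conjc (E t)]. *)
    rewrite -[RHS]nc_conj -(mulr1 (nc (conjc _))) -(nc_E t) -ncM; congr nc.
    have cj1 : conjc (1 : C) = 1 by exact: rmorph1.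
    rewrite !conjcM (conjcB 1) cj1 !conjcM conjc_inv conjcK !conjc_real.
    have := conj_E t; set e := E t; set f := conjc e => ef.
    have -> : r%:C * (1 - (a - c) / r%:C * f) * e = r%:C * e - (a - c) * (e * f).
      by field.
    by rewrite ef; ring.
  rewrite aux //; last by rewrite ncM nc_conj Normc.normcV nc_real gtr0_norm // ltr_pdivrMr ?mul1r.
  by rewrite ler_ln ?posrE // nc_distC // ltW.
- have -> : (fun t => ln (nc (c + r%:C * E t - a))) =
      fun t => ln (nc (a - c) * nc (1 - (r%:C / (a - c)) * E t)).
    apply/funext => t; congr ln; rewrite -ncM -ncN; congr nc; by field.
  rewrite aux //; first by rewrite nc_distC.
  by rewrite ncM Normc.normcV nc_real gtr0_norm // ltr_pdivrMr ?mul1r.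
Qed.

Lemma poly_roots p : {rs : seq C | p = lead_coef p *: \prod_(a <- rs) ('X - a%:P)}.
Proof. by have [rs Hrs] := closed_field_poly_normal p; exists rs. Qed.

Definition roots_of p : seq C := sval (poly_roots p).

Lemma roots_ofE p : p = lead_coef p *: \prod_(a <- roots_of p) ('X - a%:P).
Proof. exact: svalP (poly_roots p). Qed.

Lemma nc_horner p z :
  nc p.[z] = nc (lead_coef p) * \prod_(a <- roots_of p) nc (z - a).
Proof.
rewrite {1}(roots_ofE p) hornerZ ncM horner_prod nc_prod.
by congr (_ * _); apply: eq_bigr => a _; rewrite hornerXsubC.
Qed.

Lemma size_roots_of p : p != 0 -> (size (roots_of p)).+1 = size p.
Proof.
move=> p0; rewrite {2}(roots_ofE p) size_scale ?lead_coef_eq0 //.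
by rewrite size_prod_XsubC.
Qed.

Lemma ln_prod (I : Type) (s : seq I) (F : I -> R) : (forall i, 0 < F i) ->
  ln (\prod_(i <- s) F i) = \sum_(i <- s) ln (F i).
Proof.
move=> F0; elim: s => [|i s IH]; first by rewrite !big_nil ln1.
by rewrite !big_cons lnM ?IH // posrE // prodr_gt0.
Qed.

End Jensen.

(** * Mahler measures on discs *)

Section Mahler.
Variable R : realType.
Local Notation C := R[i].
Implicit Types (x y z a c : C) (p q V : {poly C}) (r e : R).

(** The induction keeps a whole open subinterval: each listed number is avoided by passing to one
    half. *)
Lemma interval_avoid (s : seq R) (u v : R) : u < v ->
  exists2 x : R, u < x < v & x \notin s.
Proof.
suff H : u < v -> exists u' v', [/\ u <= u', u' < v', v' <= v &
    forall x : R, u' < x < v' -> x \notin s].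
  move=> /H[u' [v' [uu uv vv Hx]]]; exists ((u' + v') / 2); last by apply: Hx; lra.
  by lra.
elim: s u v => [|a s IH] u v uv; first by exists u, v; split.
have [u' [v' [uu uv' vv Hx]]] := IH _ _ uv.
have [am|am] := lerP ((u' + v') / 2) a.
  exists u', ((u' + v') / 2); split; rewrite ?(le_trans _ vv) //; try lra.
  by move=> x xx; rewrite inE negb_or Hx ?andbT; lra.
exists ((u' + v') / 2), v'; split; rewrite ?(le_trans uu) //; try lra.
by move=> x xx; rewrite inE negb_or Hx ?andbT; lra.
Qed.

Lemma nc_dist_circ c a r t : 0 < r ->
  `|r - nc (c - a)| <= nc (c + r%:C * E t - a).
Proof.
move=> r0; have -> : r = nc (r%:C * E t) by rewrite ncM nc_E mulr1 nc_real gtr0_norm.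
have -> : c + (nc (r%:C * E t))%:C * E t - a = r%:C * E t - (a - c).
  by rewrite {1}ncM nc_E mulr1 nc_real gtr0_norm //; ring.
by rewrite (nc_distC c); exact: nc_dist.
Qed.

(** With no root on the circle, every [nc (z - a)] is bounded away from 0 there, so the logarithm
    splits into continuous summands to which [cmean_ln_dist] applies. *)
Lemma jensen_regular p c r e : 0 < r -> 0 < e -> p.[c] != 0 ->
  (forall a, a \in roots_of p -> nc (a - c) != r) ->
  ln (nc p.[c]) <= cmean (fun t => ln (Num.max e (nc p.[c + r%:C * E t]))).
Proof.
move=> r0 e0 pc0 Hr.
have p0 : p != 0 by apply: contraNneq pc0 => ->; rewrite horner0.
have l0 : 0 < nc (lead_coef p) by rewrite nc_gt0 lead_coef_eq0.
have d0 a t : a \in roots_of p -> 0 < nc (c + r%:C * E t - a).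
  move=> /Hr; rewrite nc_distC => H; apply: lt_le_trans (nc_dist_circ _ _ _ r0).
  by rewrite normr_gt0 subr_eq0 eq_sym.
have ca a : a \in roots_of p -> c != a.
  move=> ap; apply: contraNneq pc0 => ->.
  rewrite -nc_eq0 nc_horner (big_rem a ap) /= subrr nc0 mul0r mulr0 //.
have lnprod s (F : C -> R) : (forall a, a \in s -> 0 < F a) ->
    ln (\prod_(a <- s) F a) = \sum_(a <- s) ln (F a) /\ 0 < \prod_(a <- s) F a.
  elim: s => [|a s IH] H; first by rewrite !big_nil ln1.
  have [|H1 H2] := IH; first by move=> b bs; apply: H; rewrite inE bs orbT.
  have Fa : 0 < F a by apply: H; rewrite inE eqxx.
  by rewrite !big_cons lnM ?posrE // H1 mulr_gt0.
have cont a : a \in roots_of p -> continuous (fun t => ln (nc (c + r%:C * E t - a))).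
  move=> ap; have := Hr _ ap; rewrite nc_distC => nr.
  rewrite (_ : (fun t => _) = fun t =>
      ln (Num.max `|r - nc (c - a)| (nc ('X - a%:P).[c + r%:C * E t]))).
    by apply: lnmax_poly_continuous; rewrite normr_gt0 subr_eq0 eq_sym.
  by apply/funext => t; rewrite hornerXsubC max_r // nc_dist_circ.
have [csum msum] := cmean_sum cont.
rewrite nc_horner lnM ?posrE //; last first.
  by apply: (lnprod _ _ _).2 => a /ca; rewrite nc_gt0 subr_eq0.
rewrite (lnprod _ _ _).1; last by move=> a /ca; rewrite nc_gt0 subr_eq0.
apply: (@le_trans _ _ (cmean (fun t => ln (nc (lead_coef p)) +
    \sum_(a <- roots_of p) ln (nc (c + r%:C * E t - a))))).
  rewrite cmeanD //; last by move=> ?; exact: cvg_cst.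
  rewrite cmean_cst lerD2l msum big_seq [leRHS]big_seq; apply: ler_sum => a ap.
  by apply: cmean_ln_dist; rewrite ?ca ?Hr.
apply: cmean_le; first by move=> t; apply: cvgD; [exact: cvg_cst|exact: csum].
  exact: lnmax_poly_continuous.
move=> t; have [<- pp] := lnprod (roots_of p) (fun a => nc (c + r%:C * E t - a)) (fun a ap => d0 a t ap).
rewrite -lnM ?posrE // -nc_horner.
have pz : 0 < nc p.[c + r%:C * E t] by rewrite nc_horner mulr_gt0.
by rewrite ler_ln ?posrE // ?lt_max ?e0 // le_max lexx orbT.
Qed.

(** A slightly larger radius avoids all roots, and by the Lipschitz bound for the truncated
    logarithm this changes the mean by at most [d]. *)
Lemma jensen p c r e : 0 < r -> 0 < e -> p.[c] != 0 ->
  ln (nc p.[c]) <= cmean (fun t => ln (Num.max e (nc p.[c + r%:C * E t]))).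
Proof.
move=> r0 e0 pc0; apply/ler_addgt0Pr => d d0.
have [L L0 HL] := lipC_lnmax p e0 (nc c + (r + 1)).
have L1 : 0 < L + 1 by lra.
have m0 : r < r + Num.min 1 (d / (L + 1)) by rewrite ltrDl lt_min ltr01 divr_gt0.
have [r' /andP[r1 r2] Hr'] := interval_avoid (map (fun a => nc (a - c)) (roots_of p)) m0.
have r'0 : 0 < r' by apply: lt_trans r1.
have [r21 r22] : r' < r + 1 /\ r' < r + d / (L + 1).
  by split; apply: lt_le_trans r2 _; rewrite lerD2l ge_min lexx ?orbT.
apply: le_trans (jensen_regular r'0 e0 pc0 _) _.
  by move=> a ap; apply: contraNneq Hr' => <-; apply: map_f.
rewrite -(cmean_cst d) -cmeanD; last 2 first.
- exact: lnmax_poly_continuous.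
- by move=> t; exact: cvg_cst.
apply: cmean_le; first exact: lnmax_poly_continuous.
  by move=> t; apply: cvgD; [exact: lnmax_poly_continuous | exact: cvg_cst].
move=> t; rewrite -lerBlDl; apply: le_trans (ler_norm _) _.
apply: le_trans (HL _ _ _ _) _.
- by apply: le_trans (circ_le _ _ _) _; rewrite lerD2l gtr0_norm // ltW.
- by apply: le_trans (circ_le _ _ _) _; rewrite lerD2l gtr0_norm //; lra.
rewrite opprD addrACA subrr add0r -mulrBl -rmorphB ncM nc_E mulr1 nc_real.
rewrite ger0_norm; last by lra.
have : r' - r <= d / (L + 1) by lra.
rewrite ler_pdivlMr // => H; apply: le_trans H.
by rewrite mulrC ler_wpM2l //; lra.
Qed.

(* [mah 1 p 0] is the Mahler measure of [p]. *)
Definition mah r p c : R := nc (lead_coef p) * \prod_(a <- roots_of p) Num.max r (nc (c - a)).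

(** The factor of a root inside the disc is divided by a Blaschke factor: it stays a polynomial with
    the same modulus on the circle, but has modulus [r] at the centre. *)
Definition blaschke_factor r c a : {poly C} :=
  if r <= nc (c - a) then 'X - a%:P
  else r%:C%:P - (conjc (a - c) / r%:C) *: ('X - c%:P).

Definition reflect r p c : {poly C} :=
  lead_coef p *: \prod_(a <- roots_of p) blaschke_factor r c a.

Lemma nc_blaschke_center r c a : 0 < r ->
  nc (blaschke_factor r c a).[c] = Num.max r (nc (c - a)).
Proof.
move=> r0; rewrite /blaschke_factor; case: (leP r (nc (c - a))) => H.
  by rewrite hornerXsubC.
by rewrite !hornerE subrr mulr0 subr0 nc_real gtr0_norm.
Qed.

Lemma nc_blaschke_circ r c a t : 0 < r ->
  nc (blaschke_factor r c a).[c + r%:C * E t] = nc (c + r%:C * E t - a).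
Proof.
move=> r0; rewrite /blaschke_factor; case: ifP => _; first by rewrite hornerXsubC.
have rC : r%:C != 0 :> C by rewrite -nc_eq0 nc_real normr_eq0 gt_eqF.
rewrite !hornerE -[LHS]nc_conj -[LHS]mulr1 -(nc_E t) -ncM; congr nc.
rewrite (conjcB r%:C) !conjcM conjc_inv conjcK !conjc_real.
have -> : conjc (c + r%:C * E t - c) = r%:C * conjc (E t).
  by rewrite addrAC subrr add0r conjcM conjc_real.
have := conj_E t; set e := E t; set f := conjc e => ef.
have -> : (r%:C - (a - c) / r%:C * (r%:C * f)) * e = r%:C * e - (a - c) * (e * f).
  by field.
by rewrite ef; ring.
Qed.

Lemma nc_reflect_center r p c : 0 < r -> nc (reflect r p c).[c] = mah r p c.
Proof.
move=> r0; rewrite /reflect hornerZ ncM horner_prod nc_prod /mah; congr (_ * _).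
by apply: eq_bigr => a _; rewrite nc_blaschke_center.
Qed.

Lemma nc_reflect_circ r p c t : 0 < r ->
  nc (reflect r p c).[c + r%:C * E t] = nc p.[c + r%:C * E t].
Proof.
move=> r0; rewrite /reflect hornerZ ncM horner_prod nc_prod nc_horner; congr (_ * _).
by apply: eq_bigr => a _; rewrite nc_blaschke_circ.
Qed.

Lemma mah_gt0 r p c : 0 < r -> p != 0 -> 0 < mah r p c.
Proof.
move=> r0 p0; rewrite mulr_gt0 ?nc_gt0 ?lead_coef_eq0 // prodr_gt0 // => a _.
by rewrite lt_max r0.
Qed.

(** Jensen at [c] for [reflect r p c]; the reflection also removes a possible zero at [c]. *)
Lemma mah_jensen r p c e : 0 < r -> 0 < e -> p != 0 ->
  ln (mah r p c) <= cmean (fun t => ln (Num.max e (nc p.[c + r%:C * E t]))).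
Proof.
move=> r0 e0 p0; rewrite -nc_reflect_center //.
have -> : (fun t => ln (Num.max e (nc p.[c + r%:C * E t]))) =
    fun t => ln (Num.max e (nc (reflect r p c).[c + r%:C * E t])).
  by apply/funext => t; rewrite nc_reflect_circ.
by apply: jensen => //; rewrite -nc_eq0 nc_reflect_center // gt_eqF // mah_gt0.
Qed.

(* The reflected polynomial has the same modulus on the circle and modulus
   [mah r p c] at the centre, so this is the maximum principle for
   [V * reflect r p c ^+ n]. *)
Lemma circle_move r p c V n : 0 < r -> p != 0 ->
  exists2 z, nc (z - c) = r &
    nc V.[c] * mah r p c ^+ n <= nc V.[z] * nc p.[z] ^+ n.
Proof.
move=> r0 p0; have m0 := mah_gt0 c r0 p0.
have circ t : nc (c + r%:C * E t - c) = r.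
  by rewrite addrAC subrr add0r ncM nc_E mulr1 nc_real gtr0_norm.
have [V0|V0] := eqVneq V.[c] 0.
  by exists (c + r%:C * E 0) => //; rewrite V0 nc0 mul0r mulr_ge0 ?exprn_ge0 ?nc_ge0.
pose G := V * reflect r p c ^+ n.
have Gc : nc G.[c] = nc V.[c] * mah r p c ^+ n.
  by rewrite hornerM ncM horner_exp ncX nc_reflect_center.
have Gc0 : 0 < nc G.[c] by rewrite Gc mulr_gt0 ?exprn_gt0 // nc_gt0.
(* The truncation level is strictly below [nc G.[c]], so the point found on the circle cannot owe
   its value to the truncation. *)
have e0 : 0 < nc G.[c] / 2 by rewrite divr_gt0.
have := @jensen G c r _ r0 e0; rewrite -nc_gt0 => /(_ Gc0) HJ.
have [t _ Ht] := cmean_attained (@lnmax_poly_continuous R G c r _ e0).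
exists (c + r%:C * E t) => //.
rewrite -Gc -(nc_reflect_circ p c t r0) -ncX -horner_exp -ncM -hornerM -/G.
have := le_trans HJ Ht; rewrite ler_ln ?posrE // ?lt_max ?e0 // le_max.
by case/orP => // H; have : nc G.[c] / 2 < nc G.[c]; lra.
Qed.

End Mahler.

(** * Comparison of Mahler measures *)

Section MahlerEstimates.
Variable R : realType.
Local Notation C := R[i].
Implicit Types (x y z a c w : C) (p q : {poly C}) (r e : R).

Lemma ler_prod_seq (s : seq C) (f g : C -> R) :
  (forall a, 0 <= f a <= g a) -> \prod_(a <- s) f a <= \prod_(a <- s) g a.
Proof. by move=> H; apply: ler_prod => a _; exact: H. Qed.

Lemma prod_const_seq (s : seq C) (k : R) : \prod_(a <- s) k = k ^+ size s.
Proof. by elim: s => [|a s IH]; rewrite ?big_nil ?expr0 // big_cons IH exprS. Qed.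

Lemma mah_ge r p c : nc p.[c] <= mah r p c.
Proof.
rewrite nc_horner ler_wpM2l ?nc_ge0 // ler_prod_seq // => a.
by rewrite nc_ge0 le_max lexx orbT.
Qed.

Lemma mah_mono r r' p c : 0 < r -> r <= r' -> mah r p c <= mah r' p c.
Proof.
move=> r0 rr; rewrite ler_wpM2l ?nc_ge0 // ler_prod_seq // => a.
rewrite le_max nc_ge0 orbT /= ge_max !le_max rr lexx orbT /=.
by [].
Qed.

Lemma mah_lower r p c : 0 < r -> p != 0 ->
  nc (lead_coef p) * r ^+ (size p).-1 <= mah r p c.
Proof.
move=> r0 p0; rewrite -size_roots_of //= -prod_const_seq.
rewrite ler_wpM2l ?nc_ge0 // ler_prod_seq // => a.
by rewrite ltW //= le_max lexx.
Qed.

(** Factor by factor: [Num.max r (nc (c' - a))] grows by at most [h], which is at most [h / r] times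
    this maximum because the maximum is at least [r]. *)
Lemma mah_lip r p c c' (h : R) : 0 < r -> p != 0 -> nc (c - c') <= h ->
  mah r p c <= mah r p c' * (1 + h / r) ^+ (size p).-1.
Proof.
move=> r0 p0 ch; rewrite -size_roots_of //= -prod_const_seq -mulrA -big_split /=.
have h0 : 0 <= h by apply: le_trans ch; exact: nc_ge0.
have hr : 0 <= h / r by rewrite divr_ge0 // ltW.
rewrite ler_wpM2l ?nc_ge0 // ler_prod_seq // => a.
rewrite le_max nc_ge0 orbT /= ge_max.
set m := Num.max r (nc (c' - a)).
have rm : r <= m by rewrite le_max lexx.
have cm : nc (c' - a) <= m by rewrite le_max lexx orbT.
have hm : h <= m * (h / r).
  by rewrite mulrA ler_pdivlMr // mulrC ler_wpM2r.
have m0 : 0 <= m by apply: le_trans rm; exact: ltW.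
have mh := mulr_ge0 m0 hr.
apply/andP; split; rewrite mulrDr mulr1; first lra.
have : nc (c - a) <= nc (c - c') + nc (c' - a).
  by apply: le_trans (ncD _ _); rewrite addrA subrK.
by lra.
Qed.

Lemma mah_upper r p z : 0 < r <= 1 -> p != 0 ->
  mah r p z <= mah 1 p 0 * (1 + nc z) ^+ (size p).-1.
Proof.
move=> /andP[r0 r1] p0.
rewrite -size_roots_of //= -prod_const_seq -mulrA -big_split /=.
rewrite ler_wpM2l ?nc_ge0 // ler_prod_seq // => a.
rewrite le_max nc_ge0 orbT /= ge_max sub0r ncN.
set m := Num.max 1 (nc a).
have m1 : 1 <= m by rewrite le_max lexx.
have am : nc a <= m by rewrite le_max lexx orbT.
have z0 := nc_ge0 z; have mz : 0 <= m * nc z by rewrite mulr_ge0 // (le_trans ler01).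
apply/andP; split; rewrite mulrDr mulr1; first lra.
apply: le_trans (ncB _ _) _; have : nc z <= m * nc z by rewrite ler_peMl.
by lra.
Qed.

Definition coefsum p : R := \sum_(i < size p) nc p`_i.

Lemma coefsumE p n : (size p <= n)%N -> coefsum p = \sum_(i < n) nc p`_i.
Proof.
move=> pn; rewrite /coefsum (big_ord_widen n (fun i => nc p`_i) pn)
  [RHS](bigID (fun i : 'I_n => (i < size p)%N)) /=.
rewrite [X in _ + X]big1 ?addr0 // => i; rewrite -leqNgt => H.
by rewrite nth_default // nc0.
Qed.

Lemma coefsum_mulXsubC p a : coefsum (('X - a%:P) * p) <= (1 + nc a) * coefsum p.
Proof.
rewrite mulrBl (@coefsumE _ (size p).+1); last first.
  apply: leq_trans (size_polyD _ _) _; rewrite size_polyN geq_max mul_polyC; apply/andP; split.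
    by apply: leq_trans (size_polyMleq _ _) _; rewrite size_polyX.
  by apply: leq_trans (size_scale_leq _ _) _.
apply: (@le_trans _ _ (\sum_(i < (size p).+1) (nc ('X * p)`_i + nc a * nc p`_i))).
  apply: ler_sum => i _; rewrite coefB mul_polyC coefZ.
  by apply: le_trans (ncB _ _) _; rewrite ncM.
rewrite big_split /= -mulr_sumr mulrDl mul1r lerD //.
  rewrite big_ord_recl [X in nc X](_ : _ = 0) ?coefXM // nc0 add0r /coefsum.
  by apply: ler_sum => i _; rewrite coefXM.
by rewrite ler_wpM2l ?nc_ge0 // (@coefsumE _ (size p).+1).
Qed.

(* Expand [p] from its roots: each factor costs [1 + |a| <= 2 max 1 |a|]. *)
Lemma coefsum_mah p : p != 0 -> coefsum p <= 2 ^+ (size p).-1 * mah 1 p 0.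
Proof.
move=> p0; rewrite {1}(roots_ofE p).
have cZ k q : coefsum (k *: q) <= nc k * coefsum q.
  rewrite (@coefsumE _ (size q)) ?size_scale_leq // /coefsum mulr_sumr.
  by apply: ler_sum => i _; rewrite coefZ ncM.
apply: le_trans (cZ _ _) _; rewrite -size_roots_of //= /mah mulrCA.
rewrite ler_wpM2l ?nc_ge0 // -prod_const_seq -big_split /=.
elim: (roots_of p) => [|a s IH].
  by rewrite !big_nil /coefsum size_poly1 big_ord1 coef1 nc1.
rewrite !big_cons; apply: le_trans (coefsum_mulXsubC _ _) _.
apply: ler_pM => //; rewrite ?addr_ge0 ?nc_ge0 //.
  by apply: sumr_ge0 => i _; exact: nc_ge0.
rewrite sub0r ncN mulr2n mulrDl mul1r lerD // le_max lexx ?orbT //.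
Qed.

End MahlerEstimates.

(** * Bivariate polynomials *)

Section Bivariate.
Variable R : realType.
Local Notation C := R[i].
Implicit Types (x y z a c w : C) (p q : {poly C}) (r e : R) (P Q V : {poly {poly C}}).

(** The variable of [P] is [w] and its coefficients are polynomials in [z]; in particular
    [lead_coef P] is a polynomial in [z]. *)
Definition ev P z w : C := P.[w%:P].[z].
Definition wpoly P z : {poly C} := map_poly (horner_eval z) P.

Lemma wpolyE P z w : (wpoly P z).[w] = ev P z w.
Proof.
rewrite /wpoly /ev -[w in LHS](hornerC w z) -[(w%:P).[z]]/(horner_eval z w%:P).
by rewrite horner_map.
Qed.

(** Bounding the degree in each variable separately gives a tensor-product space, of dimension
    [d.+1 * d.+1]. *)
Definition bideg d P := (size P <= d.+1)%N /\ forall i, (size (P`_i)%R <= d.+1)%N.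

Lemma bidegM d d' P Q : bideg d P -> bideg d' Q -> bideg (d + d') (P * Q).
Proof.
move=> [P1 P2] [Q1 Q2]; split.
  apply: leq_trans (size_polyMleq _ _) _; move: P1 Q1; lia.
move=> i; rewrite coefM; apply: leq_trans (size_sum _ _ _) _.
apply/bigmax_leqP => j _; apply: leq_trans (size_polyMleq _ _) _.
by have := P2 j; have := Q2 (i - j)%N; lia.
Qed.

Lemma bidegX d P n : bideg d P -> bideg (n * d) (P ^+ n).
Proof.
move=> H; elim: n => [|n IH]; last by rewrite exprS mulSn; exact: bidegM.
rewrite expr0; split=> [|i]; first by rewrite size_poly1.
by rewrite coef1; case: (i == 0%N); rewrite ?size_poly1 ?size_poly0.
Qed.

Lemma bidegD d P Q : bideg d P -> bideg d Q -> bideg d (P + Q).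
Proof.
move=> [P1 P2] [Q1 Q2]; split.
  by apply: leq_trans (size_polyD _ _) _; rewrite geq_max P1.
by move=> i; rewrite coefD; apply: leq_trans (size_polyD _ _) _; rewrite geq_max P2 Q2.
Qed.

Lemma bidegZ d P p : (size p <= 1)%N -> bideg d P -> bideg d (p *: P).
Proof.
move=> p1 [P1 P2]; split; first exact: leq_trans (size_scale_leq _ _) _.
move=> i; rewrite coefZ; apply: leq_trans (size_polyMleq _ _) _.
by have := P2 i; lia.
Qed.

Lemma bideg0 d : bideg d 0.
Proof. by split=> [|i]; rewrite ?coef0 size_poly0. Qed.

Lemma evM P Q z w : ev (P * Q) z w = ev P z w * ev Q z w.
Proof. by rewrite /ev !hornerM. Qed.

Lemma evX P n z w : ev (P ^+ n) z w = ev P z w ^+ n.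
Proof. by rewrite /ev !horner_exp. Qed.

Lemma evD P Q z w : ev (P + Q) z w = ev P z w + ev Q z w.
Proof. by rewrite /ev !hornerD. Qed.

Lemma size_zpoly d P w : bideg d P -> (size P.[w%:P] <= d.+1)%N.
Proof.
move=> [_ H]; rewrite horner_coef; apply: leq_trans (size_sum _ _ _) _.
apply/bigmax_leqP => i _; rewrite -rmorphXn /= mulrC mul_polyC.
exact: leq_trans (size_scale_leq _ _) (H i).
Qed.

Lemma ev_sum d P z w : bideg d P ->
  ev P z w = \sum_(i < d.+1) \sum_(j < d.+1) P`_j`_i * (z ^+ i * w ^+ j).
Proof.
move=> [H1 H2]; rewrite /ev (horner_coef_wide _ H1) horner_sum exchange_big /=.
apply: eq_bigr => j _; rewrite hornerM horner_exp hornerC (horner_coef_wide _ (H2 j)).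
by rewrite mulr_suml; apply: eq_bigr => i _; rewrite mulrA.
Qed.

(** First [w] moves, with [P] specialised at [z0] but [V] at [y1]: the Mahler measure involved is at
    least [|lead| * r ^+ deg] wherever [y2] lies. Then [z] moves with [w] fixed, and [mah_lip]
    passes from [z0] to the true starting point [y1] at the cost of [(1 + h / r) ^+ d]. One value
    [z0] where the leading coefficient is large thus serves all nearby [y1]. *)
Lemma two_step_move d P V n z0 y1 y2 r (h : R) : 0 < r -> bideg d P ->
  (lead_coef P).[z0] != 0 -> nc (y1 - z0) <= h ->
  exists x1 x2, [/\ nc (x1 - y1) <= r, nc (x2 - y2) <= r &
    nc (ev V y1 y2) * (nc (lead_coef P).[z0] * r ^+ (size P).-1 / (1 + h / r) ^+ d) ^+ n
    <= nc (ev V x1 x2) * nc (ev P x1 x2) ^+ n].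
Proof.
move=> r0 dP l0 yh; have h0 : 0 <= h by apply: le_trans yh; exact: nc_ge0.
have hr : 1 <= 1 + h / r by rewrite lerDl divr_ge0 // ltW.
have hr0 : 0 < 1 + h / r by lra.
have lw : lead_coef (wpoly P z0) = (lead_coef P).[z0].
  by rewrite lead_coef_map_eq.
have w0 : wpoly P z0 != 0 by rewrite -lead_coef_eq0 lw.
have sw : size (wpoly P z0) = size P by rewrite size_map_poly_id0.
have [w' ww' Hw] := circle_move y2 (wpoly V y1) n r0 w0.
rewrite !wpolyE in Hw.
set A := nc (lead_coef P).[z0] * r ^+ (size P).-1.
have HA : A <= mah r (wpoly P z0) y2 by rewrite /A -lw -sw mah_lower.
have A0 : 0 <= A by rewrite mulr_ge0 ?nc_ge0 ?exprn_ge0 // ltW.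
have k0 : 0 <= 1 / (1 + h / r) ^+ d by rewrite divr_ge0 // exprn_ge0 // ltW.
have Hw2 : nc (ev V y1 y2) * A ^+ n <= nc (ev V y1 w') * nc (ev P z0 w') ^+ n.
  apply: le_trans Hw; rewrite ler_wpM2l ?nc_ge0 // lerXn2r ?nnegrE //.
  exact: le_trans HA.
have Hw3 : nc (ev V y1 y2) * (A / (1 + h / r) ^+ d) ^+ n <=
    nc (ev V y1 w') * (nc (ev P z0 w') / (1 + h / r) ^+ d) ^+ n.
  by rewrite !expr_div_n !mulrA ler_wpM2r // invr_ge0 exprn_ge0 // exprn_ge0 // ltW.
have [p0|p0] := eqVneq P.[w'%:P] 0.
  exists y1, w'; split; rewrite ?ww' ?subrr ?nc0 ?(ltW r0) //.
  apply: le_trans Hw3 _.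
  by rewrite /ev p0 !horner0 nc0 mul0r.
have [z' zz' Hz] := circle_move y1 V.[w'%:P] n r0 p0.
exists z', w'; split; rewrite ?zz' ?ww' //.
apply: le_trans Hw3 _; apply: le_trans Hz.
rewrite ler_wpM2l ?nc_ge0 // lerXn2r ?nnegrE ?divr_ge0 ?nc_ge0 ?exprn_ge0 ?(ltW hr0) //.
  by rewrite ltW // mah_gt0.
rewrite ler_pdivrMr ?exprn_gt0 //.
have zh : nc (z0 - y1) <= h by rewrite nc_distC.
apply: le_trans (mah_ge r _ _) _; apply: le_trans (mah_lip r0 p0 zh) _.
rewrite ler_wpM2l //; first by rewrite ltW // mah_gt0.
by rewrite ler_weXn2l //; have := size_zpoly w' dP; case: (size _).
Qed.

End Bivariate.

(** * Vandermonde determinants *)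

Section CauchyBinet.
Variable F : comNzRingType.

(** Cauchy-Binet over all maps instead of subsets of columns: each subset is counted [m!] times, and
    non-injective maps contribute 0. *)
Lemma det_mul_sum m n (A : 'M[F]_(m, n)) (B : 'M[F]_(n, m)) :
  (m`!)%:R * \det (A *m B) =
  \sum_(f : {ffun 'I_m -> 'I_n}) \det (colsub f A) * \det (rowsub f B).
Proof.
have H : \det (A *m B) =
    \sum_(f : {ffun 'I_m -> 'I_n}) (\prod_i A i (f i)) * \det (rowsub f B).
  rewrite /determinant.
  under eq_bigr => s _.
    under eq_bigr => i _ do rewrite mxE.
    rewrite bigA_distr_bigA mulr_sumr.
    under eq_bigr => f _ do rewrite big_split /= mulrCA.
    over.
  rewrite exchange_big /=; apply: eq_bigr => f _; rewrite mulr_sumr.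
  by apply: eq_bigr => s _; congr (_ * (_ * _)); apply: eq_bigr => i _; rewrite mxE.
(* Reindexing by [f] composed with [s] permutes the rows of [B], which produces the sign; the sum
   over all [s] then assembles [\det (colsub f A)]. *)
have Hs (s : 'S_m) : \det (A *m B) = \sum_(f : {ffun 'I_m -> 'I_n})
    ((-1) ^+ s * \prod_i A i (f (s i))) * \det (rowsub f B).
  rewrite H (reindex_onto (fun f : {ffun 'I_m -> 'I_n} => [ffun i => f (s i)])
     (fun f => [ffun i => f (s^-1 i)%g])) /=; last first.
    by move=> f _; apply/ffunP => i; rewrite !ffunE permK.
  rewrite (eq_bigl predT); last first.
    by move=> f; apply/eqP/ffunP => i; rewrite !ffunE permKV.
  apply: eq_bigr => f _.
  have -> : rowsub [ffun i => f (s i)] B = row_perm s (rowsub f B).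
    by apply/matrixP => i j; rewrite !mxE ffunE.
  rewrite row_permE det_mulmx det_perm mulrCA mulrA; congr (_ * _ * _).
  by apply: eq_bigr => i _; rewrite ffunE.
transitivity (\sum_(s : 'S_m) \det (A *m B)).
  by rewrite sumr_const card_Sn mulr_natl.
under eq_bigr => s _ do rewrite (Hs s).
rewrite exchange_big /=; apply: eq_bigr => f _; rewrite -mulr_suml; congr (_ * _).
rewrite [RHS]/determinant; apply: eq_bigr => s _; congr (_ * _).
by apply: eq_bigr => i _; rewrite mxE.
Qed.

(** Sylvester's identity: one block matrix factored in two ways. *)
Lemma det_1D_mul m n (U : 'M[F]_(m, n)) (V : 'M[F]_(n, m)) :
  \det (1%:M + U *m V) = \det (1%:M + V *m U).
Proof.
have e1 : block_mx 1%:M (- U) V 1%:M =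
    block_mx 1%:M 0 V 1%:M *m block_mx 1%:M (- U) 0 (1%:M + V *m U).
  rewrite mulmx_block !(mul1mx, mulmx1, mul0mx, mulmx0, addr0, add0r) mulmxN.
  by rewrite addrCA addNr addr0.
have e2 : block_mx 1%:M (- U) V 1%:M =
    block_mx (1%:M + U *m V) (- U) 0 1%:M *m block_mx 1%:M 0 V 1%:M.
  rewrite mulmx_block !(mul1mx, mulmx1, mul0mx, mulmx0, addr0, add0r) mulNmx.
  by rewrite addrK.
have := congr1 determinant e1; rewrite {1}e2 !det_mulmx !det_lblock !det_ublock !det1.
by rewrite !mulr1 !mul1r.
Qed.

End CauchyBinet.

Section Exchange.
Variable R : realType.
Local Notation C := R[i].

(** Write [X = K *m Y]. Cauchy-Binet expands [\det (K *m (Y *m B))] over maps [f], and by Cramer's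
    rule [\det Y * \det (colsub f K)] is the determinant of [Y] with its rows [f k] replaced by the
    rows of [X]. *)
Lemma det_row_exchange m n (Y : 'M[C]_n) (X : 'M[C]_(m, n)) (B : 'M[C]_(n, m))
    (b D : R) : (0 < n)%N -> 0 <= b -> 0 <= D ->
  (forall f : 'I_m -> 'I_n, nc (\det (rowsub f (Y *m B))) <= b) ->
  (forall f : 'I_m -> 'I_n, injective f ->
     nc (\det (\matrix_i (if [pick k | f k == i] is Some k then row k X else row i Y))) <= D) ->
  nc (\det Y) * nc (\det (X *m B)) <= n%:R ^+ m * (b * D).
Proof.
move=> n0 b0 D0 Hb HD.
have RHS0 : 0 <= n%:R ^+ m * (b * D) by rewrite mulr_ge0 ?exprn_ge0 ?mulr_ge0.
have [Y0|uY] := eqVneq (\det Y) 0; first by rewrite Y0 nc0 mul0r.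
have YU : Y \in unitmx by rewrite unitmxE unitfE.
have [K XK] : exists K, X = K *m Y by exists (X *m invmx Y); rewrite mulmxKV.
have key (f : {ffun 'I_m -> 'I_n}) :
    nc (\det Y) * nc (\det (colsub f K) * \det (rowsub f (Y *m B))) <= b * D.
  have [/injectiveP fi|/injectivePn[i [j ij fij]]] := boolP (injectiveb f); last first.
    rewrite (_ : \det (rowsub f _) = 0) ?mulr0 ?nc0 ?mulr0 ?mulr_ge0 //.
    by rewrite (determinant_alternate ij) // => k; rewrite !mxE fij.
  (* [P] selects the rows [f k]. The matrix with replaced rows is [(1 + P^T (K - P)) Y], and
     [det_1D_mul] turns the determinant of the first factor into [\det (K *m P^T)]. *)
  pose P : 'M[C]_(m, n) := \matrix_(k, l) (f k == l)%:R.
  have PPT : P *m P^T = 1%:M.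
    apply/matrixP => i j; rewrite !mxE (bigD1 (f i)) //= !mxE eqxx mul1r.
    rewrite big1 ?addr0; last by move=> l; rewrite !mxE eq_sym => /negbTE ->; rewrite mul0r.
    by rewrite (inj_eq fi) eq_sym.
  have KP : K *m P^T = colsub f K.
    apply/matrixP => i j; rewrite !mxE (bigD1 (f j)) //= !mxE eqxx mulr1.
    by rewrite big1 ?addr0 // => l; rewrite !mxE eq_sym => /negbTE ->; rewrite mulr0.
  have PY : P *m Y = rowsub f Y.
    apply/matrixP => i j; rewrite !mxE (bigD1 (f i)) //= !mxE eqxx mul1r.
    by rewrite big1 ?addr0 // => l; rewrite !mxE eq_sym => /negbTE ->; rewrite mul0r.
  have e : (1%:M + P^T *m (K - P)) *m Y =
      \matrix_i (if [pick k | f k == i] is Some k then row k X else row i Y).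
    rewrite mulmxDl mul1mx -mulmxA mulmxBl -XK PY; apply/matrixP => i j.
    rewrite mxE [X in _ + X]mxE mxE; case: pickP => [k /eqP fk|nk].
      rewrite (bigD1 k) //= !mxE fk eqxx mul1r big1 ?addr0; last first.
        move=> l lk; rewrite !mxE -fk (inj_eq fi) (negbTE lk) mul0r //.
      by rewrite addrCA subrr addr0.
    by rewrite big1 ?addr0 ?mxE // => l _; rewrite !mxE nk mul0r.
  have := HD f fi; rewrite -e det_mulmx det_1D_mul mulmxBl KP PPT addrC subrK ncM => HDf.
  rewrite ncM mulrA [leRHS]mulrC; apply: ler_pM; rewrite ?mulr_ge0 ?nc_ge0 //.
  by rewrite mulrC.
have mf0 : 0 < m`!%:R :> R by rewrite ltr0n fact_gt0.
rewrite -(ler_pM2l mf0).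
have -> : m`!%:R * (nc (\det Y) * nc (\det (X *m B))) =
    nc (\det Y) * nc ((m`!)%:R * \det (K *m (Y *m B))).
  rewrite ncM mulmxA -XK -(rmorph_nat (real_complex R)) nc_real ger0_norm ?ler0n //.
  by rewrite mulrCA.
rewrite det_mul_sum; apply: (@le_trans _ _ (n%:R ^+ m * (b * D))); last first.
  by rewrite ler_peMl // ler1n fact_gt0.
apply: le_trans (ler_wpM2l (nc_ge0 _) (nc_sum _ _ _)) _; rewrite mulr_sumr.
apply: le_trans (ler_sum _ (fun f _ => key f)) _.
by rewrite sumr_const card_ffun !card_ord -[leLHS]mulr_natl natrX.
Qed.

End Exchange.

Section Vandermonde.
Variable R : realType.
Local Notation C := R[i].
Local Notation C2 := (C * C)%type.
Implicit Types (P Q V F : {poly {poly C}}) (K S : set C2) (x y : C2) (r M : R).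

Definition evp P x : C := ev P x.1 x.2.

Lemma evp_bounded P M : exists2 B : R, 0 <= B &
  forall x, nc x.1 <= M -> nc x.2 <= M -> nc (evp P x) <= B.
Proof.
elim/poly_ind: P => [|P p [B B0 HB]].
  by exists 0 => // x _ _; rewrite /evp /ev !horner0 nc0.
have [B' B'0 HB'] := poly_bounded p M.
exists (B * `|M| + B') => [|x x1 x2]; first by rewrite addr_ge0 ?mulr_ge0.
rewrite /evp /ev hornerMXaddC !hornerE; apply: le_trans (ncD _ _) _.
rewrite lerD ?HB' // ncM ler_pM ?nc_ge0 ?HB //.
by rewrite (le_trans x2) // ler_norm.
Qed.

Lemma evp_lip P M : exists2 L : R, 0 <= L &
  forall x y, nc x.1 <= M -> nc x.2 <= M -> nc y.1 <= M -> nc y.2 <= M ->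
  nc (evp P x - evp P y) <= L * (nc (x.1 - y.1) + nc (x.2 - y.2)).
Proof.
elim/poly_ind: P => [|P p [L L0 HL]].
  by exists 0 => // x y *; rewrite /evp /ev !horner0 subrr nc0 mul0r.
have [L' L'0 HL'] := lipC_poly p M; have [B B0 HB] := evp_bounded P M.
exists (L * `|M| + B + L') => [|x y x1 x2 y1 y2].
  by rewrite !addr_ge0 ?mulr_ge0.
rewrite /evp /ev !hornerMXaddC !hornerE.
set u := P.[_].[_]; set v := P.[_].[_].
have -> : u * x.2 + p.[x.1] - (v * y.2 + p.[y.1]) =
    (u - v) * x.2 + (v * (x.2 - y.2) + (p.[x.1] - p.[y.1])) by ring.
have X0 := nc_ge0 (x.1 - y.1); have Y0 := nc_ge0 (x.2 - y.2).
have e1 : nc ((u - v) * x.2) <= L * `|M| * (nc (x.1 - y.1) + nc (x.2 - y.2)).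
  rewrite ncM mulrAC ler_pM ?nc_ge0 ?HL //.
  by rewrite (le_trans x2) // ler_norm.
have e2 : nc (v * (x.2 - y.2)) <= B * nc (x.2 - y.2).
  by rewrite ncM ler_wpM2r ?nc_ge0 // HB.
have e3 := HL' _ _ x1 y1.
have e4 := ncD ((u - v) * x.2) (v * (x.2 - y.2) + (p.[x.1] - p.[y.1])).
have e5 := ncD (v * (x.2 - y.2)) (p.[x.1] - p.[y.1]).
by nra.
Qed.

Definition mono N x : 'rV[C]_(N.+1 * N.+1) :=
  mxvec (\matrix_(i, j) (x.1 ^+ i * x.2 ^+ j)).

Definition polyrow N (a : 'cV[C]_(N.+1 * N.+1)) : {poly {poly C}} :=
  \poly_(j < N.+1) \poly_(i < N.+1) a (mxvec_index (inord i) (inord j)) 0.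

Lemma polyrow_bideg N a : bideg N (@polyrow N a).
Proof.
split=> [|i]; first exact: size_poly.
by rewrite coef_poly; case: ifP; rewrite ?size_poly0 // size_poly.
Qed.

Lemma polyrow_coef N a (i j : 'I_N.+1) :
  ((@polyrow N a)`_j)`_i = a (mxvec_index i j) 0.
Proof. by rewrite !coef_poly !ltn_ord coef_poly ltn_ord !inord_val. Qed.

Lemma evp_polyrow N a x : evp (@polyrow N a) x = (mono N x *m a) 0 0.
Proof.
rewrite /evp (ev_sum _ _ (polyrow_bideg a)) mxE pair_bigA /=.
rewrite [RHS](reindex _ (curry_mxvec_bij _ _)) /=.
apply: eq_bigr => -[i j] _ /=; rewrite polyrow_coef mulrC; congr (_ * _).
by rewrite /mono mxvecE mxE.
Qed.

Definition rowpoly N P : 'cV[C]_(N.+1 * N.+1) :=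
  (mxvec (\matrix_(i < N.+1, j < N.+1) (P`_j)`_i))^T.

Lemma evp_rowpoly N P x : bideg N P -> evp P x = (mono N x *m rowpoly N P) 0 0.
Proof.
move=> dP; rewrite /evp (ev_sum _ _ dP) mxE pair_bigA /=.
rewrite [RHS](reindex _ (curry_mxvec_bij _ _)) /=.
apply: eq_bigr => -[i j] _ /=; rewrite mulrC /mono /rowpoly.
by rewrite mxvecE !mxE mxvecE mxE.
Qed.

(** Multiplication by [F] is linear from degree [N] to degree [N + N]; the columns of [A] hold the
    coefficients of [F] times each monomial. *)
Lemma mono_mul N F : bideg N F -> exists A : 'M[C]_((N + N).+1 * (N + N).+1, N.+1 * N.+1),
  forall x, mono (N + N) x *m A = evp F x *: mono N x.
Proof.
move=> dF; pose mon l := polyrow (delta_mx l 0 : 'cV[C]_(N.+1 * N.+1)).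
exists (\matrix_(k, l) rowpoly (N + N) (F * mon l) k 0) => x.
apply/rowP => l; rewrite mxE [RHS]mxE.
have d2 : bideg (N + N) (F * mon l) by apply: bidegM => //; exact: polyrow_bideg.
have := evp_rowpoly x d2; rewrite /evp evM -!/(evp _ _) evp_polyrow.
rewrite -colE !mxE => ->.
by apply: eq_bigr => k _; rewrite mxE.
Qed.

Definition vdm N m (x : 'I_m -> C2) : 'M[C]_(m, N.+1 * N.+1) :=
  \matrix_(k, l) mono N (x k) 0 l.

Lemma row_vdm N m (x : 'I_m -> C2) k : row k (vdm N x) = mono N (x k).
Proof. by apply/rowP => l; rewrite !mxE. Qed.

Lemma row_diag_mul m n (d : 'rV[C]_m) (A : 'M[C]_(m, n)) k :
  row k (diag_mx d *m A) = d 0 k *: row k A.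
Proof. by apply/rowP => l; rewrite mul_diag_mx !mxE. Qed.

Lemma vdm_mul N m (x : 'I_m -> C2) F A :
  (forall x, mono (N + N) x *m A = evp F x *: mono N x) ->
  vdm (N + N) x *m A = diag_mx (\row_k evp F (x k)) *m vdm N x.
Proof.
move=> HA; apply/row_matrixP => k; rewrite row_mul row_vdm HA.
by rewrite row_diag_mul mxE row_vdm.
Qed.

Definition replace m (x : 'I_m -> C2) (i : 'I_m) (u : C2) : 'I_m -> C2 :=
  fun k => if k == i then u else x k.

(** Cofactor expansion along row [i]; this is what lets one-point estimates for polynomials act on
    determinants. *)
Lemma det_vdm_poly N (x : 'I_(N.+1 * N.+1) -> C2) i :
  exists a : 'cV[C]_(N.+1 * N.+1), forall u,
    \det (vdm N (replace x i u)) = evp (polyrow a) u.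
Proof.
exists (\col_l cofactor (vdm N x) i l) => u.
rewrite evp_polyrow (expand_det_row _ i) mxE; apply: eq_bigr => l _.
rewrite !mxE /replace eqxx; congr (_ * _); rewrite /cofactor; congr (_ * \det _).
by apply/matrixP => k j; rewrite !mxE eq_sym (negbTE (neq_lift _ _)).
Qed.

Lemma replace_id m (x : 'I_m -> C2) i : replace x i (x i) = x.
Proof. by apply/funext => k; rewrite /replace; case: eqP => [->|]. Qed.

Definition bounded2 K M := forall x, K x -> nc x.1 <= M /\ nc x.2 <= M.

(** The extremal value in the definition of Fekete points, taken as a supremum because the
    neighbourhoods [near2] need not be compact. *)
Definition maxdet N K : R :=
  sup [set nc (\det (vdm N x)) | x in [set x : 'I_(N.+1 * N.+1) -> C2 | forall k, K (x k)]].

Lemma maxdet_has_sup N K M : bounded2 K M -> K !=set0 ->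
  has_sup [set nc (\det (vdm N x)) | x in [set x : 'I_(N.+1 * N.+1) -> C2 | forall k, K (x k)]].
Proof.
move=> bK [u Ku]; split; first by exists (nc (\det (vdm N (fun=> u)))), (fun=> u).
exists (\sum_(s : 'S_(N.+1 * N.+1)) \prod_(k < N.+1 * N.+1) (Num.max 1 M) ^+ (N + N)).
move=> _ [x Kx <-]; apply: le_trans (nc_sum _ _ _) _; apply: ler_sum => s _.
rewrite ncM ncX ncN nc1 expr1n mul1r nc_prod; apply: ler_prod => k _.
rewrite nc_ge0 /= !mxE; case/mxvec_indexP: (s k) => i j; rewrite mxvecE mxE ncM !ncX.
have [k1 k2] := bK _ (Kx k).
have le1 (t : R) (e : 'I_N.+1) : 0 <= t -> t <= M -> t ^+ e <= Num.max 1 M ^+ N.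
  move=> t0 tM; have m1 : 1 <= Num.max 1 M by rewrite le_max lexx.
  have tm : t <= Num.max 1 M by rewrite le_max tM orbT.
  apply: (@le_trans _ _ (Num.max 1 M ^+ e)).
    by rewrite lerXn2r ?nnegrE // (le_trans t0).
  by rewrite ler_weXn2l // -ltnS.
by rewrite exprD ler_pM ?exprn_ge0 ?nc_ge0 // le1 ?nc_ge0.
Qed.

Lemma maxdet_ge N K M (x : 'I_(N.+1 * N.+1) -> C2) : bounded2 K M ->
  (forall k, K (x k)) -> nc (\det (vdm N x)) <= maxdet N K.
Proof.
move=> bK Kx; apply: sup_upper_bound; last by exists x.
by apply: maxdet_has_sup bK _; exists (x ord0).
Qed.

Lemma maxdet_le N K B : K !=set0 ->
  (forall x : 'I_(N.+1 * N.+1) -> C2, (forall k, K (x k)) ->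
     nc (\det (vdm N x)) <= B) -> maxdet N K <= B.
Proof.
move=> [u Ku] H; apply: ge_sup; first by exists (nc (\det (vdm N (fun=> u)))), (fun=> u).
by move=> _ [x Kx <-]; exact: H.
Qed.

Lemma maxdet_ge0 N K : 0 <= maxdet N K.
Proof.
have [H|H] := pselect (has_sup
    [set nc (\det (vdm N x)) | x in [set x : 'I_(N.+1 * N.+1) -> C2 | forall k, K (x k)]]).
  have [[_ [x Kx _]] _] := H; apply: le_trans (nc_ge0 (\det (vdm N x))) _.
  by apply: sup_upper_bound => //; exists x.
by rewrite /maxdet sup_out.
Qed.

Lemma maxdet_near N K M : bounded2 K M -> K !=set0 -> 0 < maxdet N K ->
  exists2 x : 'I_(N.+1 * N.+1) -> C2, (forall k, K (x k)) & maxdet N K <= 2 * nc (\det (vdm N x)).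
Proof.
move=> bK K0 D0; have D2 : 0 < maxdet N K / 2 by rewrite divr_gt0.
have [_ [x Kx <-]] := sup_adherent D2 (maxdet_has_sup N bK K0).
rewrite -/(maxdet N K) => H; exists x => //; lra.
Qed.

Lemma maxdet_mono N K K' M : bounded2 K M -> K' !=set0 -> K' `<=` K ->
  maxdet N K' <= maxdet N K.
Proof.
by move=> bK K'0 KK; apply: maxdet_le => // x Kx; apply: maxdet_ge bK _ => k; exact: KK.
Qed.

(* Trading the points of an optimal configuration of [K'] for the [x k]. *)
Lemma maxdet_exchange N K K' M F B (x : 'I_(N.+1 * N.+1) -> C2) :
  bounded2 K M -> K' !=set0 -> K' `<=` K -> bideg N F -> 0 <= B ->
  (forall y, K' y -> nc (evp F y) <= B) -> (forall k, K (x k)) ->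
  maxdet (N + N) K' * (nc (\det (vdm N x)) * \prod_k nc (evp F (x k))) <=
  ((N + N).+1 * (N + N).+1)%:R ^+ (N.+1 * N.+1) *
    ((B ^+ (N.+1 * N.+1) * maxdet N K') * maxdet (N + N) K).
Proof.
move=> bK K'0 KK dF B0 FB Kx; set T := (X in _ <= X).
have bK' : bounded2 K' M by move=> y /KK; exact: bK.
have T0 : 0 <= T by rewrite !mulr_ge0 ?exprn_ge0 ?maxdet_ge0.
set G := nc _ * _.
have G0 : 0 <= G by rewrite mulr_ge0 ?nc_ge0 // prodr_ge0 // => k _; exact: nc_ge0.
have [A HA] := mono_mul dF.
suff H (y : 'I_((N + N).+1 * (N + N).+1) -> C2) : (forall k, K' (y k)) -> nc (\det (vdm (N + N) y)) * G <= T.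
  have [->|Gn] := eqVneq G 0; first by rewrite mulr0.
  have Gp : 0 < G by rewrite lt_neqAle eq_sym Gn.
  rewrite -ler_pdivlMr //; apply: maxdet_le => // y K'y.
  by rewrite ler_pdivlMr //; exact: H.
move=> K'y.
(* The matrix of multiplication by [F] plays the part of [B] in [det_row_exchange]: it lowers degree
   [N + N] to [N] and brings out the values of [F]. *)
have -> : G = nc (\det (vdm (N + N) x *m A)).
  rewrite (vdm_mul _ HA) det_mulmx det_diag ncM nc_prod mulrC; congr (_ * _).
  by apply: eq_bigr => k _; rewrite mxE.
apply: det_row_exchange => //; rewrite ?mulr_ge0 ?exprn_ge0 ?maxdet_ge0 //.
  move=> f; rewrite (vdm_mul _ HA).
  have -> : rowsub f (diag_mx (\row_k evp F (y k)) *m vdm N y) =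
      diag_mx (\row_k evp F (y (f k))) *m vdm N (y \o f).
    by apply/row_matrixP => k; rewrite !row_diag_mul row_rowsub row_diag_mul !mxE !row_vdm.
  rewrite det_mulmx det_diag ncM nc_prod ler_pM ?nc_ge0 //.
  - by rewrite prodr_ge0 // => k _; exact: nc_ge0.
  - rewrite -[X in B ^+ X]card_ord -prodr_const; apply: ler_prod => k _.
    by rewrite nc_ge0 mxE FB.
  - by apply: maxdet_ge bK' _ => k; exact: K'y.
move=> f _.
pose y' i := if [pick k | f k == i] is Some k then x k else y i.
have -> : (\matrix_i (if [pick k | f k == i] is Some k then row k (vdm (N + N) x)
    else row i (vdm (N + N) y))) = vdm (N + N) y'.
  apply/row_matrixP => i; rewrite row_vdm rowK /y'.
  by case: pickP => [k _|_]; rewrite row_vdm.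
apply: maxdet_ge bK _ => k; rewrite /y'; case: pickP => // _; exact/KK/K'y.
Qed.

End Vandermonde.

(** * Null sets *)

Section MovingPoints.
Variable R : realType.
Local Notation C := R[i].
Local Notation C2 := (C * C)%type.
Implicit Types (P Q V F : {poly {poly C}}) (K S : set C2) (x y : C2) (r M A : R).
Implicit Types (I : seq ({poly {poly C}} * nat)).

Definition within2 r x y := nc (x.1 - y.1) <= r /\ nc (x.2 - y.2) <= r.

Definition near2 S r : set C2 := [set y | exists2 x, S x & within2 r y x].

(* The powers of [P] satisfy, at [y] and with room [r], a local maximum principle
   with rate [b], uniformly in the polynomial weight [V]. *)
Definition good P (d : nat) r y (b : R) := forall V (a : nat),
  exists2 x, within2 r x y &
    nc (evp V y) * expR (b * d%:R * a%:R) <= nc (evp V x) * nc (evp P x) ^+ a.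

(** The power [N %/ Pd.2] brings polynomials of different degrees to the common degree [N]. *)
Definition maxmod I N (u : C2) : R :=
  \big[Num.max/0]_(Pd <- I) nc (evp Pd.1 u) ^+ (N %/ Pd.2).

Lemma maxmod_ge I N u Pd : Pd \in I -> nc (evp Pd.1 u) ^+ (N %/ Pd.2) <= maxmod I N u.
Proof.
rewrite /maxmod; elim: I => // Qd I IH; rewrite inE big_cons le_max.
by case/predU1P => [->|/IH ->]; rewrite ?lexx ?orbT.
Qed.

Lemma maxmod_ge0 I N u : 0 <= maxmod I N u.
Proof.
rewrite /maxmod; elim: I => [|Qd I IH]; first by rewrite big_nil.
by rewrite big_cons le_max IH orbT.
Qed.

Lemma within2_refl r x : 0 <= r -> within2 r x x.
Proof. by move=> r0; rewrite /within2 !subrr nc0. Qed.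

(** The points move one at a time. In the [i]-th point the determinant is a polynomial weight, so
    [good] with exponent [N %/ d] gains [exp (b N)] against a power of [P] at the new point. *)
Lemma move_config N I K r (b : R) (z : 'I_(N.+1 * N.+1) -> C2) : 0 <= r ->
  (forall Pd, Pd \in I -> (Pd.2 %| N)%N) ->
  (forall y, K y -> exists2 Pd, Pd \in I & good Pd.1 Pd.2 r y b) ->
  (forall k, K (z k)) ->
  exists2 x : 'I_(N.+1 * N.+1) -> C2, (forall k, within2 r (x k) (z k)) &
    nc (\det (vdm N z)) * expR (b * N%:R) ^+ (N.+1 * N.+1) <=
    nc (\det (vdm N x)) * \prod_k maxmod I N (x k).
Proof.
move=> r0 dI gK Kz.
suff H (s : seq 'I_(N.+1 * N.+1)) : uniq s -> exists x : 'I_(N.+1 * N.+1) -> C2,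
    [/\ forall k, within2 r (x k) (z k), forall k, k \notin s -> x k = z k &
    nc (\det (vdm N z)) * expR (b * N%:R) ^+ size s <=
    nc (\det (vdm N x)) * \prod_(k <- s) maxmod I N (x k)].
  have [x [Hx _ Hd]] := H _ (enum_uniq 'I_(N.+1 * N.+1)).
  by exists x => //; move: Hd; rewrite size_enum_ord big_enum.
elim: s => [_|i s IH /= /andP[ni us]].
  exists z; split=> [k|//|]; first exact: within2_refl.
  by rewrite big_nil expr0.
have [x [Hx Hs Hd]] := IH us.
have [a Ha] := det_vdm_poly x i.
have [Pd PdI gP] := gK _ (Kz i).
have [u uz Hu] := gP (polyrow a) (N %/ Pd.2)%N.
exists (replace x i u); split.
- by move=> k; rewrite /replace; case: eqP => [->|_].
- by move=> k; rewrite inE negb_or /replace => /andP[/negbTE -> /Hs].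
have -> : \prod_(k <- i :: s) maxmod I N (replace x i u k) =
    maxmod I N u * \prod_(k <- s) maxmod I N (replace x i u k).
  by rewrite big_cons /replace eqxx.
rewrite (@eq_big_seq _ _ _ _ _ _ (fun k => maxmod I N (x k))); last first.
  by move=> k ks; rewrite /replace; case: eqP ni => [<-|//]; rewrite ks.
have e1 : evp (polyrow a) (z i) = \det (vdm N x).
  by rewrite -Ha -(Hs i ni) replace_id.
rewrite exprSr mulrA; apply: le_trans (ler_wpM2r (expR_ge0 _) Hd) _.
rewrite mulrAC; apply: (@le_trans _ _ (nc (evp (polyrow a) u) *
    nc (evp Pd.1 u) ^+ (N %/ Pd.2) * \prod_(k <- s) maxmod I N (x k))).
  rewrite ler_wpM2r ?prodr_ge0 // => [k _|]; first exact: maxmod_ge0.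
  move: Hu; rewrite e1 -mulrA -natrM mulnC divnK //; exact: dI.
rewrite Ha -mulrA ler_wpM2l ?nc_ge0 // ler_wpM2r ?maxmod_ge //.
by rewrite prodr_ge0 // => k _; exact: maxmod_ge0.
Qed.

(* For each [k] at most one [t] in [1 .. m+1] makes [q k + t * p k] small. *)
Lemma avoid_cancellation m (p q : 'I_m -> C) : exists2 t : nat, (0 < t <= m.+1)%N &
  forall k, Num.max (nc (q k)) (nc (p k)) <= (4 * m.+1)%:R * nc (q k + t%:R * p k).
Proof.
apply: contrapT => H.
have bad (t : 'I_m.+1) : exists k,
    (4 * m.+1)%:R * nc (q k + t.+1%:R * p k) < Num.max (nc (q k)) (nc (p k)).
  apply: contrapT => H'; apply: H; exists t.+1; first by rewrite /= ltn_ord.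
  by move=> k; rewrite leNgt; apply/negP => H2; apply: H'; exists k.
have [f Hf] := choice bad.
have /injectivePn[t [t' tt' ff]] : ~~ injectiveb f.
  by apply/negP => /injectiveP /leq_card; rewrite !card_ord ltnn.
have := Hf t'; have := Hf t; rewrite -ff; set k := f t.
set a := q k; set b := p k; set M := Num.max _ _.
set u := a + _; set v := a + _ => h1 h2.
have t1 : t.+1%:R <= m.+1%:R :> R by rewrite ler_nat ltn_ord.
have t2 : t'.+1%:R <= m.+1%:R :> R by rewrite ler_nat ltn_ord.
have d1 : 1 <= nc (t'.+1%:R - t.+1%:R : C).
  rewrite -(rmorph_nat (real_complex R)) -[X in _ - X](rmorph_nat (real_complex R)).
  rewrite -rmorphB nc_real; wlog tlt : t t' {tt' ff h1 h2 k a b M u v t1 t2} / (t < t')%N.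
    move: tt' => /negP; rewrite -val_eqE /=; case: (ltngtP t t') => // tl _ H'.
      exact: H'.
    by rewrite distrC; exact: H'.
  by rewrite ger0_norm ?subr_ge0 ?lerBrDr ?nat1r ?ler_nat // ltnW.
have nn (n : nat) : nc (n%:R : C) = n%:R.
  by rewrite -(rmorph_nat (real_complex R)) nc_real ger0_norm ?ler0n.
have hb : nc b <= nc u + nc v.
  apply: (@le_trans _ _ (nc (t'.+1%:R - t.+1%:R : C) * nc b)); first by rewrite ler_peMl ?nc_ge0.
  rewrite -ncM (_ : _ * b = v - u); last by rewrite /u /v; ring.
  by apply: le_trans (ncB _ _) _; rewrite addrC.
have ha : nc a <= m.+1%:R * (nc u + nc v).
  apply: (@le_trans _ _ (nc (t'.+1%:R - t.+1%:R : C) * nc a)); first by rewrite ler_peMl ?nc_ge0.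
  rewrite -ncM (_ : _ * a = t'.+1%:R * u - t.+1%:R * v); last by rewrite /u /v; ring.
  apply: le_trans (ncB _ _) _; rewrite !ncM !nn mulrDr.
  by rewrite lerD // ler_wpM2r ?nc_ge0.
have m1 : 1 <= m.+1%:R :> R by rewrite ler1n.
have uv : 0 <= nc u + nc v by rewrite addr_ge0 ?nc_ge0.
have hb' : nc b <= m.+1%:R * (nc u + nc v) by apply: le_trans hb _; rewrite ler_peMl.
have : M <= m.+1%:R * (nc u + nc v) by rewrite ge_max ha hb'.
move: h1 h2; rewrite natrM -!mulrA.
rewrite mulrDr; have M0 : 0 <= M by rewrite le_max nc_ge0.
lra.
Qed.

(** Different points may have been moved with different members of [I], whereas the exchange
    inequality takes a single [F]. Adding the powers successively, with the multipliers of
    [avoid_cancellation], keeps [F] large at every [x k]. *)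
Lemma select_poly N m I (x : 'I_m -> C2) :
  (forall Pd, Pd \in I -> bideg Pd.2 Pd.1 /\ (Pd.2 %| N)%N) ->
  exists F, [/\ bideg N F,
    forall k, maxmod I N (x k) <= (4 * m.+1)%:R ^+ size I * nc (evp F (x k)) &
    forall y B, (forall Pd, Pd \in I -> nc (evp Pd.1 y) ^+ (N %/ Pd.2) <= B) ->
      nc (evp F y) <= (size I * m.+1)%:R * B].
Proof.
elim: I => [_|Pd I IH dI].
  exists 0; split => [|k|y B _]; first exact: bideg0.
    by rewrite /maxmod big_nil mulr_ge0 ?nc_ge0 ?exprn_ge0.
  by rewrite /evp /ev !horner0 nc0 mul0r.
have [|F [dF HF FB]] := IH; first by move=> Qd QI; apply: dI; rewrite inE QI orbT.
have [dP dN] : bideg Pd.2 Pd.1 /\ (Pd.2 %| N)%N by apply: dI; rewrite inE eqxx.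
pose p k := evp (Pd.1 ^+ (N %/ Pd.2)) (x k).
have [t /andP[t0 tm] Ht] := avoid_cancellation p (fun k => evp F (x k)).
have evt z : evp (F + (t%:R)%:P *: Pd.1 ^+ (N %/ Pd.2)) z =
    evp F z + t%:R * evp (Pd.1 ^+ (N %/ Pd.2)) z.
  by rewrite /evp evD /ev hornerZ hornerM hornerC.
have ncX' z : nc (evp (Pd.1 ^+ (N %/ Pd.2)) z) = nc (evp Pd.1 z) ^+ (N %/ Pd.2).
  by rewrite /evp evX ncX.
have m4 : 1 <= (4 * m.+1)%:R :> R by rewrite ler1n.
exists (F + (t%:R)%:P *: Pd.1 ^+ (N %/ Pd.2)); split.
- apply: bidegD => //; apply: bidegZ; first exact: size_polyC_leq1.
  by have := bidegX (N %/ Pd.2) dP; rewrite divnK.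
- move=> k; rewrite evt /maxmod big_cons -/(maxmod I N (x k)).
  have := Ht k; rewrite /p ncX' ge_max => /andP[h1 h2] /=.
  set c := (4 * m.+1)%:R in m4 h1 h2 *; set e := nc (_ + _) in h1 h2 *.
  have e0 : 0 <= e by exact: nc_ge0.
  have ce : 0 <= c * e by rewrite mulr_ge0 // (le_trans ler01).
  rewrite exprSr -mulrA ge_max; apply/andP; split.
    by apply: le_trans h2 _; rewrite ler_peMl // exprn_ege1.
  apply: le_trans (HF k) _; apply: ler_wpM2l h1.
  by rewrite exprn_ge0 // (le_trans ler01).
- move=> y B HB; rewrite evt; apply: le_trans (ncD _ _) _.
  rewrite ncM ncX' /= mulSn addnC natrD mulrDl lerD //.
    by apply: FB => Qd QI; apply: HB; rewrite inE QI orbT.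
  rewrite -(rmorph_nat (real_complex R)) nc_real ger0_norm ?ler0n //.
  by apply: ler_pM; rewrite ?exprn_ge0 ?nc_ge0 // ?ler_nat // HB // inE eqxx.
Qed.

End MovingPoints.

Section NullSets.
Variable R : realType.
Local Notation C := R[i].
Local Notation C2 := (C * C)%type.
Implicit Types (P Q V F : {poly {poly C}}) (K S : set C2) (x y : C2) (r M A : R).
Implicit Types (I : seq ({poly {poly C}} * nat)).

Lemma poly_many_roots (p : {poly C}) (N : nat) (f : 'I_N.+1 -> C) :
  injective f -> (size p <= N.+1)%N -> (forall i, p.[f i] = 0) -> p = 0.
Proof.
move=> fi sp H; apply/eqP; apply: contraTT sp => p0; rewrite -ltnNge.
have := @max_poly_roots _ p [seq f i | i <- enum 'I_N.+1] p0.
rewrite size_map size_enum_ord; apply.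
  by apply/allP => _ /mapP[i _ ->]; rewrite /root H eqxx.
by rewrite map_inj_uniq // enum_uniq.
Qed.

Lemma grid_unisolvent N P (f g : 'I_N.+1 -> C) : injective f -> injective g ->
  bideg N P -> (forall i j, ev P (f i) (g j) = 0) -> P = 0.
Proof.
move=> fi gi [s1 s2] H; apply/polyP => j; rewrite coef0.
apply: (poly_many_roots fi (s2 j)) => i.
have : wpoly P (f i) = 0.
  apply: (poly_many_roots gi); first exact: leq_trans (size_poly _ _) s1.
  by move=> l; rewrite wpolyE H.
by move=> /(congr1 (fun q : {poly C} => q`_j)); rewrite coef_map coef0.
Qed.

(** The neighbourhood contains a product grid of [N.+1] by [N.+1] points, on which no nonzero
    polynomial of bidegree [N] vanishes. *)
Lemma maxdet_gt0 N S M r : bounded2 (near2 S r) M -> S !=set0 -> 0 < r ->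
  0 < maxdet N (near2 S r).
Proof.
move=> bS [s Ss] r0.
pose rho (i : 'I_N.+1) : C := (r * (i%:R / N.+1%:R))%:C.
have rho_le i : nc (rho i) <= r.
  rewrite nc_real ger0_norm ?mulr_ge0 ?ler0n ?invr_ge0 ?(ltW r0) ?ler0n //.
  by rewrite ler_piMr ?(ltW r0) // ler_pdivrMr ?ltr0n // mul1r ler_nat ltnW.
have rho_inj : injective rho.
  move=> i j /complexI /(mulfI (lt0r_neq0 r0)) /mulIf; rewrite invr_eq0 pnatr_eq0.
  by move=> /(_ isT) /eqP; rewrite eqr_nat => /eqP /val_inj.
have [h hK hK'] := curry_mxvec_bij N.+1 N.+1.
pose x k : C2 := (s.1 + rho (h k).1, s.2 + rho (h k).2).
have Kx k : near2 S r (x k).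
  by exists s => //; split; rewrite /= addrAC subrr add0r.
apply: lt_le_trans (maxdet_ge bS Kx); rewrite nc_gt0; apply/negP => /eqP d0.
have : \det (vdm N x)^T == 0 by rewrite det_tr d0.
move=> /det0P[v v0 vx].
have xv : vdm N x *m v^T = 0 by rewrite -[vdm N x]trmxK -trmx_mul vx trmx0.
have ev0 : polyrow v^T = 0.
  apply: (@grid_unisolvent N _ (fun i => s.1 + rho i) (fun j => s.2 + rho j)).
  - by move=> i j /addrI /rho_inj.
  - by move=> i j /addrI /rho_inj.
  - exact: polyrow_bideg.
  move=> i j; have := congr1 (fun A : 'M[C]_(_, 1) => A (mxvec_index i j) 0) xv.
  rewrite [RHS]mxE => <-.
  have -> : ev (polyrow v^T) (s.1 + rho i) (s.2 + rho j) =
      evp (polyrow v^T) (x (mxvec_index i j)).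
    by rewrite /evp /x /= -[mxvec_index i j]/(uncurry (@mxvec_index _ _) (i, j)) hK.
  rewrite evp_polyrow !mxE; apply: eq_bigr => l _; by rewrite !mxE.
move/negP: v0; apply; apply/eqP/rowP => k; rewrite mxE.
case/mxvec_indexP: k => i j; have := polyrow_coef v^T i j.
by rewrite ev0 !coef0 mxE => <-.
Qed.

(** With the largest coefficient normalised to 1, this is a Bernstein-Walsh inequality for [S] with
    constant [A]. *)
Definition nonnull S A := forall d P, (0 < d)%N -> bideg d P ->
  (forall i j, nc (P`_j)`_i <= 1) -> (exists i j, nc (P`_j)`_i = 1) ->
  exists2 x, S x & expR (- (A * d%:R)) < nc (evp P x).

Definition null S := forall A, exists d P, [/\ (0 < d)%N, bideg d P,
  forall i j, nc (P`_j)`_i <= 1, exists i j, nc (P`_j)`_i = 1 &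
  forall x, S x -> nc (evp P x) <= expR (- (A * d%:R))].

Lemma not_null S : ~ null S -> exists A, nonnull S A.
Proof.
move=> /existsNP[A H]; exists A => d P d0 dP h1 h2; apply: contrapT => H'.
apply: H; exists d, P; split => // x Sx; rewrite leNgt; apply/negP => H2.
by apply: H'; exists x.
Qed.

Lemma exists_height d P : bideg d P -> P != 0 -> exists2 h : R, 0 < h &
  (forall i j, nc (P`_j)`_i <= h) /\ (exists i j, nc (P`_j)`_i = h).
Proof.
move=> [s1 s2] P0.
pose F (ij : 'I_d.+1 * 'I_d.+1) := nc (P`_ij.2)`_ij.1.
have [[i j] _ Hij] := arg_maxP F (erefl : predT (ord0 : 'I_d.+1, ord0 : 'I_d.+1)).
have le i' j' : nc (P`_j')`_i' <= F (i, j).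
  have [jd|jd] := ltnP j' d.+1; last first.
    by rewrite [P`_j']nth_default ?(leq_trans s1) // coef0 nc0 nc_ge0.
  have [id|id] := ltnP i' d.+1; last first.
    by rewrite [X in nc X]nth_default ?nc0 ?nc_ge0 // (leq_trans (s2 j')).
  exact: (Hij (Ordinal id, Ordinal jd)).
exists (F (i, j)); last by split => //; exists i, j.
rewrite lt_neqAle nc_ge0 andbT eq_sym; apply: contraNneq P0 => F0.
apply/eqP/polyP => j'; apply/polyP => i'; rewrite !coef0.
by apply/eqP; rewrite -nc_eq0 eq_le nc_ge0 andbT -F0 le.
Qed.

Lemma evp_height d P h M y : bideg d P -> (forall i j, nc (P`_j)`_i <= h) ->
  1 <= M -> nc y.1 <= M -> nc y.2 <= M ->
  nc (evp P y) <= (d.+1 * d.+1)%:R * M ^+ (d + d) * h.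
Proof.
move=> dP Ph M1 y1 y2; rewrite /evp (ev_sum _ _ dP).
have h0 : 0 <= h by apply: le_trans (Ph 0 0)%N; exact: nc_ge0.
apply: le_trans (nc_sum _ _ _) _.
apply: (@le_trans _ _ (\sum_(i < d.+1) \sum_(j < d.+1) (h * M ^+ (d + d)))).
  apply: ler_sum => i _; apply: le_trans (nc_sum _ _ _) _; apply: ler_sum => j _.
  have pw (t : R) (e : 'I_d.+1) : 0 <= t -> t <= M -> t ^+ e <= M ^+ d.
    move=> t0 tM; apply: (@le_trans _ _ (M ^+ e)).
      by rewrite lerXn2r ?nnegrE // (le_trans t0).
    by rewrite ler_weXn2l // -ltnS.
  rewrite !ncM !ncX exprD; apply: ler_pM; rewrite ?mulr_ge0 ?exprn_ge0 ?nc_ge0 //.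
  by apply: ler_pM; rewrite ?exprn_ge0 ?nc_ge0 ?pw ?nc_ge0.
rewrite !sumr_const !card_ord -mulrnA -[leLHS]mulr_natl.
by rewrite (mulrC h) mulrA.
Qed.

Lemma nonnull_transfer S A d P M y : nonnull S A -> S !=set0 -> (0 < d)%N ->
  bideg d P -> 1 <= M -> nc y.1 <= M -> nc y.2 <= M ->
  exists2 x, S x & nc (evp P y) <=
    (d.+1 * d.+1)%:R * M ^+ (d + d) * expR (A * d%:R) * nc (evp P x).
Proof.
move=> nS [s Ss] d0 dP M1 y1 y2.
have [P0|P0] := eqVneq P 0.
  by exists s => //; rewrite P0 /evp /ev !horner0 nc0 mulr0.
have [h h0 [h1 [i [j hij]]]] := exists_height dP P0.
have hC : nc (h%:C^-1) = h^-1 :> R by rewrite Normc.normcV nc_real gtr0_norm.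
pose Q := (h%:C^-1)%:P *: P.
have Qc i' j' : nc (Q`_j')`_i' = nc (P`_j')`_i' / h.
  by rewrite coefZ mul_polyC coefZ ncM hC mulrC.
have dQ : bideg d Q by apply: bidegZ => //; exact: size_polyC_leq1.
have [|| x Sx Hx] := nS d Q d0 dQ.
- by move=> i' j'; rewrite Qc ler_pdivrMr // mul1r.
- by exists i, j; rewrite Qc hij divff // gt_eqF.
exists x => //; apply: le_trans (evp_height dP h1 M1 y1 y2) _.
rewrite -[leRHS]mulrA ler_wpM2l //.
  by rewrite mulr_ge0 ?exprn_ge0 // (le_trans ler01).
move: Hx; rewrite expRN /evp /ev hornerZ hornerM hornerC ncM hC.
have e0 := expR_gt0 (A * d%:R).
set v := nc _; set e := expR _ in e0 * => Hx.
have -> : e * v = h * e * (h^-1 * v) by field; rewrite gt_eqF.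
have {1}-> : h = h * e * e^-1 by field; rewrite gt_eqF.
by rewrite ler_pM2l ?mulr_gt0 // ltW.
Qed.

(** The points of a configuration in [K] are replaced by points of [S] one by one, each at the cost
    given by [nonnull_transfer]. *)
Lemma maxdet_nonnull S A K M d : nonnull S A -> S !=set0 -> (0 < d)%N ->
  bounded2 K M -> bounded2 S M -> 1 <= M -> K !=set0 ->
  maxdet d K <= ((d.+1 * d.+1)%:R * M ^+ (d + d) * expR (A * d%:R)) ^+ (d.+1 * d.+1)
    * maxdet d S.
Proof.
move=> nS S0 d0 bK bS M1 K0; set k := (_ * expR _).
have k0 : 0 <= k by rewrite !mulr_ge0 ?exprn_ge0 ?expR_ge0 // (le_trans ler01).
apply: maxdet_le => // y Ky.
suff H (s : seq 'I_(d.+1 * d.+1)) : exists x : 'I_(d.+1 * d.+1) -> C2,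
    [/\ forall i, i \in s -> S (x i), forall i, K (x i) \/ S (x i) &
     nc (\det (vdm d y)) <= k ^+ size s * nc (\det (vdm d x))].
  have [x [Hx _ Hd]] := H (enum 'I_(d.+1 * d.+1)).
  move: Hd; rewrite size_enum_ord => Hd; apply: le_trans Hd _.
  rewrite ler_wpM2l ?exprn_ge0 //; apply: maxdet_ge bS _ => i.
  by apply: Hx; rewrite mem_enum.
elim: s => [|i s [x [Hs HK Hd]]].
  by exists y; split=> // [i|]; [left|rewrite expr0 mul1r].
have [a Ha] := det_vdm_poly x i.
have [x1 x2] : nc (x i).1 <= M /\ nc (x i).2 <= M.
  by case: (HK i) => [/bK|/bS].
have [u Su Hu] := nonnull_transfer nS S0 d0 (polyrow_bideg a) M1 x1 x2.
exists (replace x i u); split.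
- by move=> l; rewrite inE /replace; case: eqP => //= _; exact: Hs.
- by move=> l; rewrite /replace; case: eqP => // _; right.
- apply: le_trans Hd _; rewrite exprSr -mulrA ler_wpM2l ?exprn_ge0 //.
  by rewrite Ha -[x in leLHS](replace_id x i) Ha.
Qed.

Lemma bounded2_near S M r : bounded2 S M -> bounded2 (near2 S r) (M + r).
Proof.
move=> bS y [x /bS[x1 x2] [c1 c2]]; split.
  by rewrite -[y.1](subrK x.1) addrC; apply: le_trans (ncD _ _) _; rewrite lerD.
by rewrite -[y.2](subrK x.2) addrC; apply: le_trans (ncD _ _) _; rewrite lerD.
Qed.

(** As [I] is finite, one radius works for all its members; the gap between [b] and [b'] absorbs the
    Lipschitz error. *)
Lemma near_bound S M I (b b' : R) : bounded2 S M -> b < b' ->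
  (forall Pd, Pd \in I -> (0 < Pd.2)%N /\
     forall x, S x -> nc (evp Pd.1 x) <= expR (b * Pd.2%:R)) ->
  exists2 r, 0 < r & forall Pd, Pd \in I -> forall y, near2 S r y ->
    nc (evp Pd.1 y) <= expR (b' * Pd.2%:R).
Proof.
move=> bS bb; elim: I => [_|Pd I IH H]; first by exists 1.
have [|r r0 Hr] := IH; first by move=> Qd QI; apply: H; rewrite inE QI orbT.
have [d0 HP] : (0 < Pd.2)%N /\ forall x, S x -> nc (evp Pd.1 x) <= expR (b * Pd.2%:R).
  by apply: H; rewrite inE eqxx.
have [L L0 HL] := evp_lip Pd.1 (M + 1).
pose g := expR (b' * Pd.2%:R) - expR (b * Pd.2%:R).
have g0 : 0 < g by rewrite subr_gt0 ltr_expR ltr_pM2r // ltr0n.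
pose r' := Num.min (Num.min r 1) (g / (2 * L + 1)).
have L1 : 0 < 2 * L + 1 by lra.
have r'0 : 0 < r' by rewrite !lt_min r0 ltr01 divr_gt0.
have [r'r r'1 r'g] : [/\ r' <= r, r' <= 1 & r' <= g / (2 * L + 1)].
  by rewrite /r' !ge_min !lexx !orbT.
exists r' => // Qd; rewrite inE => /predU1P[->|QI] y [x Sx [c1 c2]]; last first.
  by apply: Hr QI _ _; exists x => //; split; [apply: le_trans r'r|apply: le_trans r'r].
have [x1 x2] := bS _ Sx.
have [y1 y2] : nc y.1 <= M + 1 /\ nc y.2 <= M + 1.
  apply: (@bounded2_near S M 1 bS); exists x => //.
  by split; [apply: le_trans r'1|apply: le_trans r'1].
have := HL y x y1 y2 (le_trans x1 _) (le_trans x2 _).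
rewrite !lerDl !ler01 => /(_ isT isT) H1.
rewrite -[evp Pd.1 y](subrK (evp Pd.1 x)); apply: le_trans (ncD _ _) _.
have h1 := HP _ Sx.
have h2 : L * (nc (y.1 - x.1) + nc (y.2 - x.2)) <= g.
  move: r'g; rewrite ler_pdivlMr // => h3.
  have : L * (nc (y.1 - x.1) + nc (y.2 - x.2)) <= L * (r' + r') by rewrite ler_wpM2l // lerD.
  by nra.
by rewrite /g in h2; lra.
Qed.

End NullSets.

(** * The criterion for null sets *)

Section NullCriterion.
Variable R : realType.
Local Notation C := R[i].
Local Notation C2 := (C * C)%type.
Implicit Types (P Q V F : {poly {poly C}}) (K S : set C2) (x y : C2) (r M A : R).
Implicit Types (I : seq ({poly {poly C}} * nat)).

Local Notation dimb N := (N.+1 * N.+1)%N.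

(** The price per point of one shrinking, with [b] the number of polynomials: 2 from [maxdet_near],
    [(4 (n + 1)) ^ b] and [b (n + 1)] from the two bounds of [select_poly], and [dimb (N + N)] from
    [det_row_exchange]. It is polynomial in [N], hence harmless against [exp (g N)]. *)
Definition loss b N : nat :=
  2 * ((4 * (dimb N).+1) ^ b * (dimb (N + N) * (b * (dimb N).+1))).

(** A nearly optimal configuration of degree [N] in the small neighbourhood moves into the large
    one, gaining [exp (b' N)] per point, and enters [maxdet_exchange], where [F] is of size
    [exp (b1 N)]. The factor [maxdet N (near2 S r')] occurs on both sides and cancels. *)
Lemma maxdet_step N S M r r' I (b1 b' : R) : bounded2 S M -> S !=set0 ->
  0 < r' -> r' <= r / 2 ->
  (forall Pd, Pd \in I -> [/\ bideg Pd.2 Pd.1, (Pd.2 %| N)%N &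
     forall y, near2 S r' y -> nc (evp Pd.1 y) <= expR (b1 * Pd.2%:R)]) ->
  (forall y, near2 S r' y -> exists2 Pd, Pd \in I & good Pd.1 Pd.2 (r / 2) y b') ->
  maxdet (N + N) (near2 S r') * expR ((b' - b1) * N%:R) ^+ dimb N <=
  (loss (size I) N)%:R ^+ dimb N * maxdet (N + N) (near2 S r).
Proof.
move=> bS S0 r'0 r'r HI Hg; set n := dimb N; set n' := dimb (N + N).
have r0 : 0 < r by lra.
have bK' := bounded2_near (r := r') bS; have bK := bounded2_near (r := r) bS.
have K'0 : near2 S r' !=set0.
  by have [s Ss] := S0; exists s; exists s => //; apply: within2_refl; lra.
have KK : near2 S r' `<=` near2 S r.
  by move=> y [x Sx [c1 c2]]; exists x => //; split; lra.
have D0 : 0 < maxdet N (near2 S r') by exact: maxdet_gt0 bK' S0 r'0.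
have [z Kz Hz] := maxdet_near bK' K'0 D0.
have [| |x xz Hx] := move_config (r := r / 2) (b := b') _ _ Hg Kz; first by lra.
  by move=> Pd /HI[].
have Kx k : near2 S r (x k).
  have [s Ss [c1 c2]] := Kz k; have [d1 d2] := xz k; exists s => //; split.
    by rewrite -(subrKA (z k).1) (le_trans (ncD _ _)) // (le_trans (lerD d1 c1)) //; clear -r'r; lra.
  by rewrite -(subrKA (z k).2) (le_trans (ncD _ _)) // (le_trans (lerD d2 c2)) //; clear -r'r; lra.
have [|F [dF HF FB]] := select_poly (N := N) (I := I) x.
  by move=> Pd /HI[].
set e1 := expR (b1 * N%:R); set e' := expR (b' * N%:R) in Hx.
set c4 := (4 * (dimb N).+1)%:R ^+ size I in HF.
pose B := (size I * (dimb N).+1)%:R * e1.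
have B0 : 0 <= B by rewrite mulr_ge0 ?expR_ge0 ?ler0n.
have FB' y : near2 S r' y -> nc (evp F y) <= B.
  move=> Ky; apply: FB => Pd PI; have [_ dN /(_ _ Ky) HP] := HI _ PI.
  apply: (@le_trans _ _ (expR (b1 * Pd.2%:R) ^+ (N %/ Pd.2))).
    by rewrite lerXn2r ?nnegrE ?nc_ge0 ?expR_ge0.
  by rewrite -expRM_natr -mulrA -natrM mulnC divnK.
have := maxdet_exchange bK K'0 KK dF B0 FB' Kx.
set D := maxdet N _ in D0 Hz *; set D2' := maxdet _ (near2 S r').
set D2 := maxdet _ (near2 S r); set g := nc _ * \prod_k _ => Hex.
have Hg2 : D * e' ^+ n <= 2 * (c4 ^+ n * g).
  apply: (@le_trans _ _ (2 * (nc (\det (vdm N z)) * e' ^+ n))).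
    by rewrite mulrA ler_wpM2r ?exprn_ge0 ?expR_ge0.
  rewrite ler_pM2l //; apply: le_trans Hx _.
  rewrite /g mulrCA ler_wpM2l ?nc_ge0 //.
  rewrite -[X in c4 ^+ X]card_ord -prodr_const -big_split /=.
  apply: ler_prod => k _; rewrite maxmod_ge0 /=; exact: HF.
have c40 : 0 <= c4 by rewrite exprn_ge0.
have H1 : D2' * (D * e' ^+ n) <= 2 * c4 ^+ n * (n'%:R ^+ n * (B ^+ n * D * D2)).
  apply: (@le_trans _ _ (D2' * (2 * (c4 ^+ n * g)))).
    by rewrite ler_wpM2l ?maxdet_ge0.
  have -> : D2' * (2 * (c4 ^+ n * g)) = 2 * c4 ^+ n * (D2' * g) by ring.
  by rewrite ler_wpM2l // mulr_ge0 ?exprn_ge0.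
have e10 : 0 < e1 ^+ n by rewrite exprn_gt0 // expR_gt0.
rewrite mulrBl expRB expr_div_n -/e1 -/e' mulrA ler_pdivrMr //.
rewrite -(ler_pM2l D0).
have -> : D * (D2' * e' ^+ n) = D2' * (D * e' ^+ n) by ring.
apply: le_trans H1 _; rewrite /loss /B.
have -> : (2 * ((4 * (dimb N).+1) ^ size I *
    (dimb (N + N) * (size I * (dimb N).+1))))%:R =
   2 * (c4 * (n'%:R * (size I * (dimb N).+1)%:R)) :> R.
  by rewrite (natrM _ 2) (natrM _ (_ ^ _)%N) natrX (natrM _ n').
rewrite !exprMn.
set q := (size I * _)%:R ^+ n; set w := n'%:R ^+ n; set u := c4 ^+ n; set v := e1 ^+ n.
have -> : 2 * u * (w * (q * v * D * D2)) = 2 * (u * w * q * v * D * D2) by ring.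
have -> : D * (2 ^+ n * (u * (w * q)) * D2 * v) = 2 ^+ n * (u * w * q * v * D * D2) by ring.
rewrite ler_wpM2r //.
  by rewrite !mulr_ge0 ?exprn_ge0 ?maxdet_ge0 ?expR_ge0.
by rewrite -[leLHS]expr1 ler_weXn2l // ?ler1n // /n muln_gt0.
Qed.

Lemma loss_mono b b' N : (b <= b')%N -> (loss b N <= loss b' N)%N.
Proof.
move=> bb; rewrite /loss leq_mul2l /= leq_mul //; first by rewrite leq_exp2l.
by rewrite leq_mul2l leq_mul2r bb orbT.
Qed.

(* On [S] the polynomials are of size [exp (b d)], but [exp (b' d)] is attained
   arbitrarily close to every point of [S]. *)
Definition criterion S (b b' : R) := forall r, 0 < r -> exists2 h, 0 < h &
  exists I, (forall Pd, Pd \in I -> [/\ (0 < Pd.2)%N, bideg Pd.2 Pd.1 &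
      forall x, S x -> nc (evp Pd.1 x) <= expR (b * Pd.2%:R)]) /\
    forall y, near2 S h y -> exists2 Pd, Pd \in I & good Pd.1 Pd.2 r y b'.

(** [J] applications of [maxdet_step]; [L] is a common multiple of all degrees met, so that the
    exponents [N %/ d] are exact. *)
Lemma maxdet_chain S M (b b' : R) J : bounded2 S M -> S !=set0 -> b < b' ->
  criterion S b b' ->
  exists r L k, [/\ 0 < r, (0 < L)%N & forall N, (L %| N)%N ->
    maxdet (N + N) (near2 S r) * expR ((b' - b) / 2 * N%:R) ^+ (dimb N * J) <=
    (loss k N)%:R ^+ (dimb N * J) * maxdet (N + N) (near2 S 1)].
Proof.
move=> bS S0 bb crit; elim: J => [|J [r [L [k [r0 L0 IH]]]]].
  by exists 1, 1%N, 0%N; split=> // N _; rewrite muln0 !expr0 mulr1 mul1r.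
have r20 : 0 < r / 2 by lra.
have [h h0 [I [HI Hg]]] := crit _ r20.
(* Half of the gap pays for passing from [S] to a neighbourhood; the other half is the gain of the
   step. *)
have bm : b < (b + b') / 2 by lra.
have [|r1 r10 Hr1] := near_bound bS bm (I := I).
  by move=> Pd /HI[].
pose r' := Num.min (Num.min (r / 2) h) r1.
have r'0 : 0 < r' by rewrite !lt_min r20 h0.
have [r'r r'h r'1] : [/\ r' <= r / 2, r' <= h & r' <= r1].
  by rewrite /r' !ge_min !lexx !orbT.
have [L1 L10 HL1] : exists2 L1, (0 < L1)%N & forall Pd, Pd \in I -> (Pd.2 %| L1)%N.
  have : forall Pd, Pd \in I -> (0 < Pd.2)%N by move=> Pd /HI[].
  elim: (I) => [_|Pd s IHs Hs]; first by exists 1%N.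
  have [|L1 L10 H1] := IHs; first by move=> Qd Qs; apply: Hs; rewrite inE Qs orbT.
  exists (Pd.2 * L1)%N; first by rewrite muln_gt0 L10 Hs // inE eqxx.
  by move=> Qd; rewrite inE => /predU1P[->|/H1]; [exact: dvdn_mulr|exact: dvdn_mull].
exists r', (L * L1)%N, (maxn k (size I)); split => // [|N LN].
  by rewrite muln_gt0 L0.
have NL : (L %| N)%N by apply: dvdn_trans LN; exact: dvdn_mulr.
have NL1 : (L1 %| N)%N by apply: dvdn_trans LN; exact: dvdn_mull.
have := @maxdet_step N S M r r' I ((b + b') / 2) b' bS S0 r'0 r'r.
have -> : b' - (b + b') / 2 = (b' - b) / 2 by field.
set e := expR _; set D' := maxdet _ (near2 S r'); set D := maxdet _ (near2 S r) => H.
have {H} Hstep : D' * e ^+ dimb N <= (loss (size I) N)%:R ^+ dimb N * D.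
  apply: H => [Pd PI|y Hy].
    have [_ dP _] := HI _ PI; split => //; first exact: dvdn_trans (HL1 _ PI) NL1.
    move=> y [x Sx [c1 c2]]; apply: Hr1 => //; exists x => //.
    by split; [apply: le_trans r'1|apply: le_trans r'1].
  apply: Hg; have [x Sx [c1 c2]] := Hy; exists x => //.
  by split; [apply: le_trans r'h|apply: le_trans r'h].
have := IH _ NL; rewrite -/e -/D; set D1 := maxdet _ (near2 S 1) => HIH.
set l := (loss (maxn _ _) N)%:R.
have l1 : (loss (size I) N)%:R <= l :> R by rewrite ler_nat loss_mono // leq_maxr.
have l2 : (loss k N)%:R <= l :> R by rewrite ler_nat loss_mono // leq_maxl.
have e0 : 0 <= e by exact: expR_ge0.
have l0 : 0 <= l by exact: ler0n.
have D10 : 0 <= D1 by exact: maxdet_ge0.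
have D00 : 0 <= D by exact: maxdet_ge0.
rewrite mulnS [e ^+ _]exprD [l ^+ _]exprD mulrA.
apply: (@le_trans _ _ (l ^+ dimb N * D * e ^+ (dimb N * J))).
  rewrite ler_wpM2r ?exprn_ge0 //; apply: le_trans Hstep _.
  by rewrite ler_wpM2r // lerXn2r ?nnegrE ?ler0n.
rewrite -!mulrA ler_wpM2l ?exprn_ge0 //; apply: le_trans HIH _.
by rewrite ler_wpM2r // lerXn2r ?nnegrE ?ler0n.
Qed.

Lemma expR_beats_power (K : R) m L : (0 < L)%N ->
  exists N, [/\ (0 < N)%N, (L %| N)%N & K * N%:R ^+ m < expR N%:R].
Proof.
move=> L0; pose c := Num.max K 1 * m.+1%:R ^+ m.+1.
have m1 : 0 < m.+1%:R ^+ m.+1 :> R by rewrite exprn_gt0 ?ltr0n.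
pose N := (L * (Num.truncn c).+1)%N.
have N0 : (0 < N)%N by rewrite muln_gt0 L0.
exists N; split => //; first exact: dvdn_mulr.
have Nc : c < N%:R.
  apply: lt_le_trans (truncnS_gt c) _; rewrite ler_nat /N.
  by rewrite leq_pmull.
have H : (N%:R / m.+1%:R) ^+ m.+1 <= expR N%:R :> R.
  have -> : expR N%:R = expR (N%:R / m.+1%:R) ^+ m.+1 :> R.
    by rewrite -expRM_natr divfK ?pnatr_eq0.
  rewrite lerXn2r ?nnegrE ?expR_ge0 ?divr_ge0 ?ler0n //.
  by apply: le_trans (expR_ge1Dx _); rewrite lerDr.
apply: lt_le_trans H; rewrite expr_div_n ltr_pdivlMr // [N%:R ^+ m.+1]exprS mulrAC.
rewrite ltr_pM2r ?exprn_gt0 ?ltr0n //; apply: le_lt_trans Nc.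
by rewrite /c ler_wpM2r ?(ltW m1) // le_max lexx.
Qed.

Lemma loss_le k N : (0 < N)%N ->
  (loss k N <= (90 * k * 20 ^ k) * N ^ (2 * k + 4))%N.
Proof.
move=> N0.
have h1 : ((dimb N).+1 <= 5 * N ^ 2)%N by nia.
have h2 : (dimb (N + N) <= 9 * N ^ 2)%N by nia.
have h3 : ((4 * (dimb N).+1) ^ k <= 20 ^ k * N ^ (2 * k))%N.
  rewrite [X in (_ <= _ * X)%N]expnM -expnMn; case: k => // k.
  by rewrite leq_exp2r //; nia.
rewrite /loss expnD.
apply: (@leq_trans (2 * (20 ^ k * N ^ (2 * k) * (9 * N ^ 2 * (k * (5 * N ^ 2))))))%N.
  by rewrite leq_mul2l /= leq_mul // leq_mul // leq_mul2l h1 orbT.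
apply: eq_leq; move: (20 ^ k)%N (N ^ (2 * k))%N => u v.
by rewrite (expnD N 2 2); move: (N ^ 2)%N => w; ring.
Qed.

Lemma nonnull_le S A A' : A <= A' -> nonnull S A -> nonnull S A'.
Proof.
move=> AA nS d P d0 dP h1 h2; have [x Sx Hx] := nS d P d0 dP h1 h2.
exists x => //; apply: le_lt_trans Hx.
by rewrite ler_expR lerN2 ler_wpM2r.
Qed.

Lemma nonnull_nonempty S A : nonnull S A -> S !=set0.
Proof.
move=> nS; have c1 i j : nc ((1 : {poly {poly C}})`_j)`_i = ((j == 0%N) && (i == 0%N))%:R :> R.
  by rewrite polyseq1; case: j => [|j]; rewrite /= ?nth_nil ?polyseq1 ?polyseq0;
    case: i => [|i]; rewrite ?andbF ?nth_nil /= ?nth_nil //;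
    solve [exact: nc1 | exact: nc0].
have [||||x Sx _] := nS 1%N 1 => //.
- split=> [|i]; first by rewrite size_poly1.
  by rewrite polyseq1; case: i => [|i]; [rewrite size_poly1 | rewrite /= nth_nil size_poly0].
- by move=> i j; rewrite c1 lern1 leq_b1.
- by exists 0%N, 0%N; rewrite c1.
by exists x.
Qed.

Theorem null_criterion S M (b b' : R) : bounded2 S M -> b < b' ->
  criterion S b b' -> null S.
Proof.
move=> bS0 bb crit; apply: contrapT => /not_null[A0 nS0].
have S0 := nonnull_nonempty nS0.
pose A := Num.max A0 0; have A_ge0 : 0 <= A by rewrite le_max lexx orbT.
have nS : nonnull S A by apply: nonnull_le nS0; rewrite le_max lexx.
pose M' := Num.max 1 (M + 1).
have M1 : 1 <= M' by rewrite le_max lexx.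
have MM : M + 1 <= M' by rewrite le_max lexx orbT.
have bK r : r <= 1 -> bounded2 (near2 S r) M'.
  by move=> r1 y /(bounded2_near bS0)[y1 y2]; split; lra.
have bS : bounded2 S M' by move=> y /bS0[y1 y2]; split; lra.
have g0 : 0 < (b' - b) / 2 by lra.
(* Since [n' <= 4 * n] and [NN = N + N], going down to [S] costs at most [kap ^+ 4] per point of
   degree [N], that is [exp ((8 A + 16 ln M') N)] up to a power of [N]. The [J] gains beat this with
   [exp N] to spare for the polynomial losses, and [J] is fixed before [N]. *)
pose J := (Num.truncn ((8 * A + 16 * ln M' + 1) / ((b' - b) / 2))).+1.
have HJ : 8 * A + 16 * ln M' + 1 <= (b' - b) / 2 * J%:R.
  by rewrite [leRHS]mulrC -ler_pdivrMr //; exact: ltW (truncnS_gt _).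
have [r [L [k [r0 L0 Hch]]]] := maxdet_chain J bS0 S0 bb crit.
pose c : nat := (90 * k * 20 ^ k)%N.
have [N [N0 LN HN]] := expR_beats_power ((c ^ J * 9 ^ 4)%N%:R) ((2 * k + 4) * J + 8) L0.
have [NN eNN] : exists NN, NN = (N + N)%N by exists (N + N)%N.
have := Hch _ LN; rewrite -eNN; set D1 := maxdet _ (near2 S 1); set Dr := maxdet _ (near2 S r) => H1.
have NN0 : (0 < NN)%N by rewrite eNN addn_gt0 N0.
have K1 : near2 S 1 !=set0.
  by have [s Ss] := S0; exists s; exists s => //; apply: within2_refl.
have Kr : near2 S r !=set0.
  by have [s Ss] := S0; exists s; exists s => //; exact/within2_refl/ltW.
have := maxdet_nonnull nS S0 NN0 (bK 1 (lexx _)) bS M1 K1.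
rewrite -/D1; set DS := maxdet _ S; set n' := dimb NN => H2.
have D10 : 0 < D1 by apply: maxdet_gt0 (bK 1 (lexx _)) S0 ltr01.
set kap := (_ * expR _) in H2.
have n'1 : 1 <= n'%:R :> R by rewrite ler1n /n' muln_gt0.
have e1 : 1 <= expR (A * NN%:R) by rewrite -expR0 ler_expR mulr_ge0.
have kap1 : 1 <= kap.
  by rewrite /kap mulr_ege1 // mulr_ege1 // exprn_ege1.
have DS0 : 0 < DS.
  rewrite -(pmulr_rgt0 _ (exprn_gt0 n' (lt_le_trans ltr01 kap1))).
  exact: lt_le_trans H2.
have H3 : DS <= Dr.
  rewrite /DS /Dr; apply: (maxdet_mono NN (bounded2_near (r := r) bS0) S0).
  by move=> s Ss; exists s => //; exact/within2_refl/ltW.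
set e := expR _ in H1; set l := (loss k N)%:R in H1; set n := dimb N in H1.
have e0 : 0 <= e by exact: expR_ge0.
have l0 : 0 <= l by exact: ler0n.
have kap0 : 0 <= kap by exact: le_trans kap1.
have H4 : e ^+ (n * J) <= l ^+ (n * J) * kap ^+ n'.
  rewrite -(ler_pM2l DS0); apply: (@le_trans _ _ (Dr * e ^+ (n * J))).
    by rewrite ler_wpM2r ?exprn_ge0.
  apply: le_trans H1 _; apply: le_trans (ler_wpM2l _ H2) _; first by rewrite exprn_ge0.
  by rewrite [kap ^+ _ * DS]mulrC mulrCA.
have n4 : (n' <= 4 * n)%N by rewrite /n' /n eNN; clear; nia.
have M0' : 0 <= M' by exact: le_trans M1.
have H5 : e ^+ J <= l ^+ J * kap ^+ 4.
  have n0 : (0 < n)%N by rewrite /n muln_gt0.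
  rewrite -(@ler_pXn2r _ n n0) ?nnegrE ?mulr_ge0 ?exprn_ge0 //.
  rewrite -exprM mulnC exprMn -!exprM [(J * n)%N]mulnC; apply: le_trans H4 _.
  by rewrite ler_wpM2l ?exprn_ge0 // ler_weXn2l.
have lM : 0 <= ln M' by apply: ln_ge0.
have H6 : expR N%:R <= l ^+ J * n'%:R ^+ 4.
  have M0 : 0 < M' by exact: lt_le_trans M1.
  have ek : kap ^+ 4 = n'%:R ^+ 4 * expR ((8 * A + 16 * ln M') * N%:R).
    rewrite /kap !exprMn -mulrA; congr (_ * _).
    rewrite -{1}(lnK (x := M')) ?posrE // -!expRM_natr -expRD; congr expR.
    by rewrite eNN !natrD; ring.
  move: H5; rewrite ek mulrA -expRM_natr => H5.
  have ex0 := expR_gt0 ((8 * A + 16 * ln M') * N%:R).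
  rewrite -(ler_pM2r ex0); apply: le_trans H5; rewrite -expRD ler_expR.
  have N0' : 0 <= N%:R :> R by exact: ler0n.
  by have := ler_wpM2r N0' HJ; clear; lra.
move: HN; rewrite ltNge => /negP; apply; apply: le_trans H6 _.
rewrite exprD [N%:R ^+ (_ * J)]exprM -!natrX -!natrM ler_nat.
have hn' : (n' <= 9 * N ^ 2)%N by rewrite /n' eNN; move: N0; clear; nia.
apply: (@leq_trans ((c * N ^ (2 * k + 4)) ^ J * (9 * N ^ 2) ^ 4)).
  by rewrite leq_mul ?leq_exp2r // loss_le.
rewrite (expnMn c) (expnMn 9 (N ^ 2)) -(expnM N 2 4).
by apply: eq_leq; rewrite mulnACA.
Qed.

End NullCriterion.

(** * Decreasing limits and plurisubharmonicity *)

Section DecreasingLimit.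
Variable R : realType.
Local Notation C := R[i].
Local Notation C2 := (C * C)%type.
Local Notation mu := (@lebesgue_measure R).
Implicit Types (f : C2 -> R) (a b x y : C2).

Definition lip2 f := forall M : R, exists2 L : R, 0 <= L & forall x y,
  nc x.1 <= M -> nc x.2 <= M -> nc y.1 <= M -> nc y.2 <= M ->
  `|f x - f y| <= L * (nc (x.1 - y.1) + nc (x.2 - y.2)).

Definition line a b (zeta : C) : C2 := (a.1 + zeta * b.1, a.2 + zeta * b.2).

(** This covers every circle in a complex line: its centre is [a], and its radius is absorbed in
    [b]. *)
Definition submean f := forall a b, f a <= cmean (fun t => f (line a b (E t))).

Lemma lip2_line f a b : lip2 f -> lipC (fun zeta => f (line a b zeta)).
Proof.
move=> lf M; have [L L0 HL] := lf (nc a.1 + nc a.2 + `|M| * (nc b.1 + nc b.2)).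
exists (L * (nc b.1 + nc b.2)); first by rewrite mulr_ge0 // addr_ge0 ?nc_ge0.
have bd (zeta : C) : nc zeta <= M ->
    nc (a.1 + zeta * b.1) <= nc a.1 + nc a.2 + `|M| * (nc b.1 + nc b.2) /\
    nc (a.2 + zeta * b.2) <= nc a.1 + nc a.2 + `|M| * (nc b.1 + nc b.2).
  move=> zM; have zM' : nc zeta <= `|M| by apply: le_trans zM (ler_norm _).
  have H (u v : C) (p q : R) : 0 <= p -> 0 <= q ->
      nc (u + zeta * v) <= nc u + p + `|M| * (nc v + q).
    move=> p0 q0; apply: le_trans (ncD _ _) _; rewrite ncM lerD ?lerDl //.
    by apply: le_trans (ler_wpM2r (nc_ge0 v) zM') _; rewrite ler_wpM2l // lerDl.
  split; first exact: H (nc_ge0 _) (nc_ge0 _).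
  by rewrite [nc a.1 + _]addrC [nc b.1 + _]addrC; exact: H (nc_ge0 _) (nc_ge0 _).
move=> x y /bd[x1 x2] /bd[y1 y2]; apply: le_trans (HL (line a b x) (line a b y) x1 x2 y1 y2) _ => /=.
have e (u v : C) : u + x * v - (u + y * v) = (x - y) * v by ring.
by rewrite !e !ncM -mulrDr mulrA mulrAC.
Qed.

Lemma lip2_circ f a b : lip2 f -> continuous (fun t => f (line a b (E t))).
Proof.
move=> /(lip2_line a b) /(@lipC_circ R _ 0 1).
by under eq_fun do rewrite add0r mul1r.
Qed.

Lemma lipC_small (f : C -> R) (z : C) (e : R) : lipC f -> 0 < e ->
  exists2 d : R, 0 < d & forall y : C, nc (z - y) < d -> `|f z - f y| < e.
Proof.
move=> lf e0; have [L L0 HL] := lf (nc z + 1).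
exists (Num.min 1 (e / (L + 1))); first by rewrite lt_min ltr01 divr_gt0 // ltr_wpDl.
move=> y; rewrite lt_min => /andP[y1 yd].
have zM : nc z <= nc z + 1 by rewrite lerDl.
have yM : nc y <= nc z + 1.
  by have := ncB z (z - y); rewrite subKr; lra.
apply: le_lt_trans (HL _ _ zM yM) _.
apply: (@le_lt_trans _ _ ((L + 1) * nc (z - y))); first by rewrite ler_wpM2r ?nc_ge0 // lerDl.
by rewrite mulrC -ltr_pdivlMr // ltr_wpDl.
Qed.

Lemma nbhs_nc (z : C) (d : R) : 0 < d -> nbhs z [set y | nc (z - y) < d].
Proof.
move=> d0; apply/nbhs_ballP; exists d%:C => /=; first by rewrite ltcR.
by move=> y; rewrite /ball /= nc_norm ltcR.
Qed.

Lemma usc_inf (X : topologicalType) (f : nat -> X -> R) :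
  (forall n (x : X) (e : R), 0 < e -> nbhs x [set y | `|f n x - f n y| < e]) ->
  upper_semicontinuous (fun x : X => ereal_inf (range (fun n => (f n x)%:E))).
Proof.
move=> cf x a; rewrite lteNr => /ereal_inf_lt[_ [n _ <-]]; rewrite lte_fin => fa.
have e0 : 0 < - a - f n x by lra.
exists [set y | `|f n x - f n y| < - a - f n x]; first exact: cf.
move=> y /=; rewrite ltr_norml => /andP[y1 y2]; rewrite lteNr.
apply: (@le_lt_trans _ _ (f n y)%:E); first by apply: ereal_inf_lbound; exists n.
by rewrite lte_fin; lra.
Qed.

Lemma lip2_near f (p : 'rV[C]_2) (e : R) : lip2 f -> 0 < e ->
  nbhs p [set q | `|f (p ord0 ord0, p ord0 ord_max) - f (q ord0 ord0, q ord0 ord_max)| < e].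
Proof.
move=> lf e0; pose M := nc (p ord0 ord0) + nc (p ord0 ord_max) + 1.
have [L L0 HL] := lf M; pose d := Num.min 1 (e / (2 * (L + 1))).
have d0 : 0 < d by rewrite lt_min ltr01 divr_gt0 // mulr_gt0 // ltr_wpDl.
have Hj j : nbhs p [set q : 'rV[C]_2 | nc (p ord0 j - q ord0 j) < d].
  exact: (@coord_continuous C 1 2 ord0 j p _ (nbhs_nc _ d0)).
apply: filterS (filterI (Hj ord0) (Hj ord_max)) => q [/= q1 q2].
have d1 : d <= 1 by rewrite ge_min lexx.
have bd (u v : C) : nc (u - v) < d -> nc v <= nc u + 1.
  by move=> uv; have := ncB u (u - v); rewrite subKr; lra.
have p1 := nc_ge0 (p ord0 ord0); have p2 := nc_ge0 (p ord0 ord_max).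
have b1 := bd _ _ q1; have b2 := bd _ _ q2.
apply: le_lt_trans (HL _ _ _ _ _ _) _ => /=; rewrite /M; try lra.
apply: (@le_lt_trans _ _ ((L + 1) *
  (nc (p ord0 ord0 - q ord0 ord0) + nc (p ord0 ord_max - q ord0 ord_max)))).
  by rewrite ler_wpM2r ?addr_ge0 ?nc_ge0 // lerDl.
rewrite mulrC -ltr_pdivlMr ?ltr_wpDl //.
have : d <= e / (2 * (L + 1)) by rewrite ge_min lexx orbT.
by rewrite invfM mulrCA => ?; lra.
Qed.

(** Monotone convergence for [K - g n], which is nonnegative and increases with [n] once [K] bounds
    [g 0] on the interval. *)
Lemma inf_circle_mean (g : nat -> R -> R) (U : \bar R) :
  (forall n, continuous (g n)) -> (forall n t, g n.+1 t <= g n t) ->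
  (forall n, (U <= (cmean (g n))%:E)%E) ->
  (U <= ((2 * pi)^-1)%:E * \int[mu]_(t in `[0%R, (2 * pi)%R]) ereal_inf (range (fun n => (g n t)%:E)))%E.
Proof.
move=> cg dg HU; set u := fun t : R => ereal_inf _.
case: U HU => [U HU|/(_ 0%N)|_]; [|by rewrite leye_eq|by rewrite leNye].
have g_le n m t : (n <= m)%N -> g m t <= g n t.
  move=> nm; rewrite -(subnK nm); elim: (m - n)%N => [//|k IH]; exact: le_trans (dg _ _) IH.
pose D := `[0%R, 2 * pi]%classic : set R.
have mD : measurable D by exact: measurable_itv.
have [K HK] : exists K, forall t, D t -> g 0%N t <= K.
  have c0 : {within `[0, 2 * pi], continuous (g 0%N)} by exact: continuous_subspaceT.
  have tp : 0 <= 2 * pi :> R by exact/ltW/twopi_gt0.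
  by have [c _ Hc] := EVT_max tp c0; exists (g 0%N c) => t Dt; exact: Hc.
pose h (n : nat) : R -> \bar R := fun t => (K - g n t)%:E.
pose H : R -> \bar R := fun t => (K%:E - u t)%E.
have ch n : continuous (fun t => K - g n t).
  by move=> t; apply: cvgB; [exact: cvg_cst | exact: cg].
have mh n : measurable_fun D (h n).
  apply/measurable_EFinP; apply: measurable_funTS; exact: continuous_measurable_fun.
have h0 n t : D t -> (0 <= h n t)%E.
  by move=> Dt; rewrite lee_fin subr_ge0; apply: le_trans (g_le 0%N n t _) (HK _ Dt).
have hm t : D t -> nondecreasing_seq (h^~ t).
  by move=> _ n m nm; rewrite lee_fin lerB // g_le.
have Hlim t : D t -> limn (h^~ t) = H t.
  move=> Dt; have /ereal_nondecreasing_cvgn /cvg_lim -> // := hm t Dt.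
  rewrite /H /u; apply/eqP; rewrite eq_le; apply/andP; split.
    apply: ge_ereal_sup => _ [n _ <-]; rewrite /h EFinB leeB //.
    by apply: ereal_inf_lbound; exists n.
  have : ((K%:E - ereal_sup (range (h^~ t))) <= u t)%E.
    apply: le_ereal_inf_tmp => _ [n _ <-].
    have -> : (g n t)%:E = (K%:E - h n t)%E by rewrite /h -EFinB subKr.
    by apply: leeB => //; apply: ereal_sup_ubound; exists n.
  rewrite /u; case: (ereal_inf _) => [v||]; case: (ereal_sup _) => [w||];
    rewrite -?EFinB ?lee_fin ?leey ?leNye //; lra.
have mono := cvg_monotone_convergence (mu := mu) mD mh h0 hm.
have IntH : (\int[mu]_(t in D) (limn (h^~ t)) = \int[mu]_(t in D) H t)%E.
  by apply: eq_integral => t /set_mem; exact: Hlim.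
have tp := twopi_gt0 R.
have Ih n : (\int[mu]_(t in D) h n t = (2 * pi * (K - cmean (g n)))%:E)%E.
  have -> : K - cmean (g n) = cmean (fun t => K - g n t).
    rewrite (_ : (fun t => K - g n t) = fun t => K + -1 * g n t); last first.
      by apply/funext => t; rewrite mulN1r.
    have cK : continuous (fun _ : R => K) by move=> t; exact: cvg_cst.
    have cN : continuous (fun t => -1 * g n t).
      by move=> t; apply: cvgM; [exact: cvg_cst | exact: cg].
    by rewrite cmeanD // cmeanZ // cmean_cst mulN1r.
  rewrite /cmean mulVKf ?gt_eqF // /Rintegral fineK //.
  exact/integrable_fin_num/continuous_itv_integrable.
have HHle : (\int[mu]_(t in D) H t <= (2 * pi * (K - U))%:E)%E.
  rewrite -IntH -(cvg_lim _ mono) //; apply: lime_le; first exact: cvgP mono.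
  apply: nearW => n /=.
  by rewrite Ih lee_fin ler_pM2l // lerB // -lee_fin.
have H0 t : D t -> (0 <= H t)%E.
  move=> Dt; rewrite -Hlim //; apply: lime_ge.
    exact: ereal_nondecreasing_is_cvgn (hm _ Dt).
  by apply: nearW => n; exact: h0.
have mH : measurable_fun D H.
  apply: (emeasurable_fun_cvg h H mh) => t Dt; rewrite -(Hlim t Dt).
  exact: ereal_nondecreasing_is_cvgn (hm t Dt).
(* The finite lower bound [U] makes [H] integrable, so it can be subtracted from [K] under the
   integral. *)
have iH : mu.-integrable D H.
  apply/integrableP; split => //; under eq_integral => t /set_mem Dt do rewrite gee0_abs ?H0 //.
  by apply: le_lt_trans HHle _; rewrite ltry.
have iK : mu.-integrable D (fun=> K%:E).
  by apply: (@continuous_itv_integrable R (fun=> K)) => t; exact: cvg_cst.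
have -> : (\int[mu]_(t in D) u t = \int[mu]_(t in D) (K%:E - H t))%E.
  apply: eq_integral => t _; rewrite /H; case: (u t) => [v||] //=.
  by rewrite -!EFinB subKr.
rewrite integralB // integral_cst //.
rewrite [X in (_ * (_ * X - _))%E](_ : _ = (2 * pi)%:E); last first.
  by rewrite /D [LHS]lebesgue_measure_itv /= lte_fin tp oppr0 addr0.
set J := (X in (_ * (_ - X))%E); have HJ : (J <= (2 * pi * (K - U))%:E)%E := HHle.
have : J \is a fin_num by exact: integrable_fin_num.
case: J HJ => [v||] //; rewrite lee_fin => Hv _.
rewrite -[(K%:E * _)%E]EFinM -EFinB -EFinM lee_fin mulrC ler_pdivlMr //.
by move: Hv; rewrite mulrBr [K * _]mulrC [U * _]mulrC; lra.
Qed.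

(** The pointwise infimum is the required function: it is upper semicontinuous as an infimum of
    continuous functions, the mean inequality survives decreasing limits, and [x0] shows that it is
    not identically [-oo]. *)
Theorem pluripolar_decreasing (f : nat -> C2 -> R) x0 (B0 : R) :
  (forall n, lip2 (f n)) -> (forall n, submean (f n)) ->
  (forall n x, f n.+1 x <= f n x) -> (forall n, B0 <= f n x0) ->
  pluripolar [set p : 'rV[C]_2 | forall B, exists n, f n (p ord0 ord0, p ord0 ord_max) <= B].
Proof.
move=> lf sf df HB; pose F n (p : 'rV[C]_2) := f n (p ord0 ord0, p ord0 ord_max).
pose u (p : 'rV[C]_2) := ereal_inf (range (fun n => (F n p)%:E)).
have ult p : (u p < +oo)%E.
  by apply: (@le_lt_trans _ _ (F 0%N p)%:E); [apply: ereal_inf_lbound; exists 0%N | rewrite ltry].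
exists u; split; last 2 first.
- exists (\row_j if j == ord0 then x0.1 else x0.2).
  rewrite gt_eqF //; apply: (@lt_le_trans _ _ B0%:E); first by rewrite ltNyr.
  apply: le_ereal_inf_tmp => _ [n _ <-]; rewrite lee_fin /F !mxE /=.
  by case: (x0) HB.
- move=> p Hp /=; case up: (u p) (ult p) => [v||] // _.
  have [n Hn] := Hp (v - 1); have : (u p <= (F n p)%:E)%E by apply: ereal_inf_lbound; exists n.
  rewrite up lee_fin => /le_trans/(_ Hn).
  by rewrite leNgt ltrBlDr ltrDl ltr01.
split => //.
- by apply: usc_inf => n p e e0; exact: lip2_near.
move=> a b; split => [z||c r r0]; first exact: ult.
- rewrite /u; apply: (@usc_inf C (fun n zeta => F n (a + zeta *: b))) => n z e e0.
  have L := lip2_line (a ord0 ord0, a ord0 ord_max) (b ord0 ord0, b ord0 ord_max) (lf n).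
  have [d d0 Hd] := lipC_small z L e0.
  apply: filterS (nbhs_nc z d0) => y /= /Hd.
  by rewrite /F /line !mxE.
pose a' := line (a ord0 ord0, a ord0 ord_max) (b ord0 ord0, b ord0 ord_max) c.
pose b' : C2 := (r%:C * b ord0 ord0, r%:C * b ord0 ord_max).
have Fa n : F n (a + c *: b) = f n a' by rewrite /F /a' /line !mxE.
have Fc n t : F n (a + (c + r%:C * (cos t +i* sin t)) *: b) = f n (line a' b' (E t)).
  rewrite /F /a' /b' /line !mxE /= -/(E t); congr (f n (_, _)); ring.
have -> : circle_mean (fun zeta => u (a + zeta *: b)) c r =
   (((2 * pi)^-1)%:E * \int[mu]_(t in `[0%R, (2 * pi)%R])
      ereal_inf (range (fun n => (f n (line a' b' (E t)))%:E)))%E.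
  congr (_ * _)%E; apply: eq_integral => t _; rewrite /u.
  by congr ereal_inf; apply: eq_imagel => n _; rewrite Fc.
apply: (@inf_circle_mean (fun n t => f n (line a' b' (E t)))) => [n|n t|n].
- exact: lip2_circ.
- exact: df.
- apply: (@le_trans _ _ (f n a')%:E); last by rewrite lee_fin; exact: sf.
  by apply: ereal_inf_lbound; exists n => //; rewrite Fa.
Qed.

End DecreasingLimit.

(** * Operations on Lipschitz functions with the sub-mean property *)

Section TameFunctions.
Variable R : realType.
Local Notation C := R[i].
Local Notation C2 := (C * C)%type.
Implicit Types (f g : C2 -> R) (a b x y : C2).

(** For each [n] some point [T n] satisfies [B <= g n (T n)]. A cluster point works for all [n] at
    once, because the sequence decreases and each [g n] is continuous. *)
Lemma circle_point (g : nat -> R -> R) (B : R) :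
  (forall n, continuous (g n)) -> (forall n t, g n.+1 t <= g n t) ->
  (forall n, B <= cmean (g n)) -> exists t, forall n, B <= g n t.
Proof.
move=> cg dg HB.
have g_le n m t : (n <= m)%N -> g m t <= g n t.
  move=> nm; rewrite -(subnK nm); elim: (m - n)%N => [//|k IH]; exact: le_trans (dg _ _) IH.
have H n : exists t : R, t \in `[0, 2 * pi] /\ cmean (g n) <= g n t.
  by have [t t1 t2] := cmean_attained (cg n); exists t.
have [T HT] := choice H.
have [|t [_ ct]] := @segment_compact R 0 (2 * pi) (T @ \oo) _.
  by exists 0%N => // n _ /=; have [] := HT n.
exists t => n; rewrite leNgt; apply/negP => gB.
have e0 : 0 < B - g n t by rewrite subr_gt0.
have /cvgrPdist_lt /(_ _ e0) Hn := cg n t.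
have [|u [[m /= nm <-]]] := ct [set T m | m in [set m | (n <= m)%N]] _ _ Hn.
  by exists n => // m nm; exists m.
rewrite /= ltr_norml => /andP[Hm _].
have [_ Hm'] := HT m; have := g_le _ _ (T m) nm; have := HB m; lra.
Qed.

Definition tame f := lip2 f /\ submean f.

Lemma tameD f g : tame f -> tame g -> tame (fun x => f x + g x).
Proof.
move=> [lf sf] [lg sg]; split=> [M|a b].
  have [L L0 HL] := lf M; have [L' L'0 HL'] := lg M.
  exists (L + L') => [|x y x1 x2 y1 y2]; first exact: addr_ge0.
  rewrite opprD addrACA mulrDl; apply: le_trans (ler_normD _ _) _.
  by rewrite lerD ?HL ?HL'.
rewrite cmeanD; [exact: lerD|exact: lip2_circ|exact: lip2_circ].
Qed.

Lemma tameZ (k : R) f : 0 <= k -> tame f -> tame (fun x => k * f x).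
Proof.
move=> k0 [lf sf]; split=> [M|a b].
  have [L L0 HL] := lf M; exists (k * L) => [|x y x1 x2 y1 y2]; first exact: mulr_ge0.
  by rewrite -mulrBr normrM ger0_norm // -mulrA ler_wpM2l // HL.
by rewrite cmeanZ ?ler_wpM2l //; exact: lip2_circ.
Qed.

Lemma tame_cst (k : R) : tame (fun=> k).
Proof.
split=> [M|a b]; last by rewrite cmean_cst.
by exists 0 => // x y *; rewrite subrr normr0 mul0r.
Qed.

Lemma tame_sum (F : nat -> C2 -> R) n : (forall i, tame (F i)) ->
  tame (fun x => \sum_(i < n) F i x).
Proof.
move=> tF; elim: n => [|n IH].
  rewrite (_ : (fun x => _) = fun=> 0); first exact: tame_cst.
  by apply/funext => x; rewrite big_ord0.
rewrite (_ : (fun x => _) = fun x => \sum_(i < n) F i x + F n x); first exact: tameD.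
by apply/funext => x; rewrite big_ord_recr.
Qed.

Lemma line_poly (P : {poly {poly C}}) a b :
  exists p : {poly C}, forall zeta, evp P (line a b zeta) = p.[zeta].
Proof.
elim/poly_ind: P => [|P q [p Hp]].
  by exists 0 => zeta; rewrite /evp /ev !horner0.
exists (p * (a.2%:P + b.2 *: 'X) + (q \Po (a.1%:P + b.1 *: 'X))) => zeta.
rewrite hornerD hornerM -Hp horner_comp !hornerE /evp /ev hornerMXaddC !hornerE /=.
by rewrite [zeta * b.2]mulrC [zeta * b.1]mulrC.
Qed.

(** On a complex line [P] is a polynomial in one variable, so this is [jensen]; if the value at the
    centre is truncated, [ln e] is a lower bound everywhere. *)
Lemma tame_lnmax (P : {poly {poly C}}) (e : R) : 0 < e ->
  tame (fun x => ln (Num.max e (nc (evp P x)))).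
Proof.
move=> e0; split=> [M|a b].
  have [L L0 HL] := evp_lip P M.
  exists (e^-1 * L) => [|x y x1 x2 y1 y2]; first by rewrite mulr_ge0 ?invr_ge0 ?(ltW e0).
  apply: le_trans (ln_max_lip _ _ e0) _; rewrite -mulrA ler_wpM2l ?invr_ge0 ?(ltW e0) //.
  exact: le_trans (nc_dist _ _) (HL _ _ x1 x2 y1 y2).
have [p Hp] := line_poly P a b.
have -> : evp P a = p.[0] by rewrite -Hp /line !mul0r !addr0; case: (a).
have -> : (fun t => ln (Num.max e (nc (evp P (line a b (E t)))))) =
    fun t => ln (Num.max e (nc p.[0 + 1%:C * E t])).
  by apply/funext => t; rewrite Hp add0r mul1r.
have cp := @lnmax_poly_continuous R p 0 1 e e0.
have [pe|ep] := leP (nc p.[0]) e.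
  rewrite -[leLHS]cmean_cst; apply: cmean_le => //; first by move=> t; exact: cvg_cst.
  by move=> t; rewrite ler_ln ?posrE ?e0 // ?lt_max ?e0 // le_max lexx.
apply: jensen => //; rewrite -nc_gt0; exact: lt_trans ep.
Qed.

End TameFunctions.

(** * Countable unions of null sets *)

Section CountableUnion.
Variable R : realType.
Local Notation C := R[i].
Local Notation C2 := (C * C)%type.
Implicit Types (x : C2) (p : {poly C}).

Lemma ln2_le1 : ln 2 <= 1 :> R.
Proof. by have := @le_ln1Dx R 1; rewrite (_ : 1 + 1 = 2) //; apply; lra. Qed.

Lemma ln_succ_le (d : nat) : ln d.+1%:R <= d%:R :> R.
Proof.
by rewrite -add1n natrD; apply: le_ln1Dx; apply: lt_le_trans (ler0n _ _); lra.
Qed.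

Lemma sum_half_powers n : \sum_(i < n) (2 ^+ i.+1)^-1 = 1 - (2 ^+ n)^-1 :> R.
Proof.
elim: n => [|n IH]; first by rewrite big_ord0 expr0 invr1 subrr.
by rewrite big_ord_recr /= IH exprS invfM; lra.
Qed.

Lemma coef_mah p d b : (size p <= d.+1)%N -> p != 0 ->
  nc p`_b <= 2 ^+ d * mah 1 p 0.
Proof.
move=> sp p0; have m0 : 0 < mah 1 p 0 by exact: mah_gt0.
apply: (@le_trans _ _ (coefsum p)).
  have [bs|bs] := ltnP b (size p); last by rewrite nth_default // nc0 sumr_ge0 // => i _; exact: nc_ge0.
  rewrite /coefsum (bigD1 (Ordinal bs)) //= lerDl sumr_ge0 // => i _; exact: nc_ge0.
apply: le_trans (coefsum_mah p0) _; rewrite ler_wpM2r ?(ltW m0) //.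
by rewrite ler_weXn2l ?ler1n //; move: sp; case: (size p).
Qed.

(** A coefficient is at most [2 ^+ d] times the Mahler measure. After division by [d], one
    coefficient of modulus 1 thus bounds the mean below by [- ln 2], whatever the degree. *)
Lemma cmean_lnmax_coef p d b (e : R) : 0 < e -> (size p <= d.+1)%N ->
  ln (Num.max e (nc p`_b)) - d%:R * ln 2 <=
  cmean (fun t => ln (Num.max e (nc p.[E t]))).
Proof.
move=> e0 sp.
have cp : continuous (fun t => ln (Num.max e (nc p.[E t]))).
  have := @lnmax_poly_continuous R p 0 1 e e0.
  by under eq_fun do rewrite add0r mul1r.
have l2 : 0 <= ln 2 :> R by rewrite ln_ge0 // ler1n.
have dl : 0 <= d%:R * ln 2 :> R by rewrite mulr_ge0.
have [pe|ep] := leP (nc p`_b) e.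
  apply: (@le_trans _ _ (ln e)); first by rewrite lerBlDr lerDl.
  rewrite -[leLHS]cmean_cst; apply: cmean_le => //; first by move=> t; exact: cvg_cst.
  by move=> t; rewrite ler_ln ?posrE ?e0 // ?lt_max ?e0 // le_max lexx.
have p0 : p != 0 by apply: contraTneq ep => ->; rewrite coef0 nc0 -leNgt (ltW e0).
have := @mah_jensen R 1 p 0 e ltr01 e0 p0.
under [fun t => _]eq_fun do rewrite add0r mul1r.
move=> H; apply: le_trans H; have m0 : 0 < mah 1 p 0 by exact: mah_gt0.
rewrite lerBlDl -{1}[d%:R]/(d%:R) mulr_natl -lnXn // -lnM ?posrE ?exprn_gt0 //.
rewrite ler_ln ?posrE; [exact: coef_mah | exact: lt_trans ep | by rewrite mulr_gt0 ?exprn_gt0].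
Qed.

Lemma horner_circle_le p d t : (size p <= d.+1)%N -> (forall i, nc p`_i <= 1) ->
  nc p.[E t] <= d.+1%:R.
Proof.
move=> sp hp; rewrite (horner_coef_wide _ sp); apply: le_trans (nc_sum _ _ _) _.
apply: (@le_trans _ _ (\sum_(i < d.+1) 1)); last by rewrite sumr_const card_ord.
by apply: ler_sum => i _; rewrite ncM ncX nc_E expr1n mulr1.
Qed.

(* [logn 2 i.+1] enumerates the naturals with infinite repetition. *)
Lemma logn_recurrent j N : exists2 i, (N <= i)%N & logn 2 i.+1 = j.
Proof.
have q0 : (0 < 2 ^ j * (2 * N).+1)%N by rewrite muln_gt0 expn_gt0.
exists (2 ^ j * (2 * N).+1).-1; last first.
  by rewrite prednK // lognM ?expn_gt0 // pfactorK // logn_coprime ?addn0 // coprime2n /= oddM.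
by rewrite -ltnS prednK //; apply: (@leq_trans (1 * (2 * N).+1)); [lia|rewrite leq_mul // expn_gt0].
Qed.

(** A tame majorant of [(log |P|) / d] when the coefficients have modulus at most 1; the constant 2
    absorbs [ln (d.+1 * d.+1) / d], which comes from the number of monomials. *)
Definition growth x : R :=
  2 + 2 * (ln (Num.max 1 (nc (evp ('X%:P) x))) + ln (Num.max 1 (nc (evp 'X x)))).

Lemma evp_fst x : evp ('X%:P) x = x.1.
Proof. by rewrite /evp /ev hornerC hornerX. Qed.

Lemma evp_snd x : evp 'X x = x.2.
Proof. by rewrite /evp /ev hornerX hornerC. Qed.

Lemma growth_tame : tame growth.
Proof.
apply: tameD; first exact: tame_cst.
by apply: tameZ => //; apply: tameD; exact: tame_lnmax.
Qed.

Lemma growth_ge2 x : 2 <= growth x.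
Proof.
have H (t : R) : 0 <= ln (Num.max 1 t) by rewrite ln_ge0 // le_max lexx.
by rewrite lerDl mulr_ge0 // addr_ge0.
Qed.

Lemma normalized_le_growth P d (e : R) x : (0 < d)%N -> 0 < e <= 1 -> bideg d P ->
  (forall i j, nc (P`_j)`_i <= 1) ->
  d%:R^-1 * ln (Num.max e (nc (evp P x))) <= growth x.
Proof.
move=> d0 /andP[e0 e1] dP hP.
set M1 := Num.max 1 (nc x.1); set M2 := Num.max 1 (nc x.2).
have M11 : 1 <= M1 by rewrite le_max lexx.
have M21 : 1 <= M2 by rewrite le_max lexx.
have M1p : 0 < M1 by exact: lt_le_trans M11.
have M2p : 0 < M2 by exact: lt_le_trans M21.
have M1M : M1 <= M1 * M2 by rewrite ler_pMr.
have M2M : M2 <= M1 * M2 by rewrite ler_pMl.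
have M1' : 1 <= M1 * M2 by apply: le_trans M1M.
have Hx1 : nc x.1 <= M1 * M2 by apply: le_trans M1M; rewrite le_max lexx orbT.
have Hx2 : nc x.2 <= M1 * M2 by apply: le_trans M2M; rewrite le_max lexx orbT.
have := evp_height dP hP M1' Hx1 Hx2; rewrite mulr1 => HP.
have Mp : 0 < M1 * M2 by rewrite mulr_gt0.
set B := (d.+1 * d.+1)%:R * (M1 * M2) ^+ (d + d) in HP.
have B1 : 1 <= B by rewrite /B mulr_ege1 ?exprn_ege1 // ler1n.
have lnB : ln B <= d%:R * growth x.
  rewrite /B natrM !lnM ?posrE ?mulr_gt0 ?exprn_gt0 ?ltr0n // lnXn // lnM ?posrE //.
  rewrite /growth evp_fst evp_snd -/M1 -/M2 -[_ *+ (d + d)]mulr_natl natrD.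
  by have := @ln_succ_le d; lra.
rewrite mulrC ler_pdivrMr ?ltr0n // mulrC; apply: le_trans lnB.
by rewrite ler_ln ?posrE ?lt_max ?e0 // ?(lt_le_trans ltr01 B1) // ge_max HP (le_trans e1).
Qed.

(* The truncation of [(log |P|) / d] at [- 2 ^ i.+1] makes each term of the final sum,
   weighted by [2 ^- i.+1], equal to [-1] on the null set it is attached to. *)
Definition weight (i d : nat) : R := expR (- (2 ^+ i.+1 * d%:R)).

Lemma weight_bounds i d : 0 < weight i d <= 1.
Proof. by rewrite expR_gt0 -expR0 ler_expR oppr_le0 mulr_ge0 ?exprn_ge0. Qed.

Lemma cmean_normalized p d b (e k : R) : (0 < d)%N -> 0 < e -> 0 <= k -> (size p <= d.+1)%N ->
  continuous (fun t => k * (d%:R^-1 * ln (Num.max e (nc p.[E t])))) /\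
  k * (d%:R^-1 * ln (Num.max e (nc p`_b))) - k * ln 2 <=
  cmean (fun t => k * (d%:R^-1 * ln (Num.max e (nc p.[E t])))).
Proof.
move=> d0 e0 k0 sp.
have cp : continuous (fun t => ln (Num.max e (nc p.[E t]))).
  have := @lnmax_poly_continuous R p 0 1 e e0.
  by under eq_fun do rewrite add0r mul1r.
have cZ (c : R) (g : R -> R) : continuous g -> continuous (fun t => c * g t).
  by move=> cg t; apply: cvgM; [exact: cvg_cst | exact: cg].
split; first exact/cZ/cZ.
rewrite cmeanZ ?cmeanZ //; last exact: cZ.
rewrite -mulrBr ler_wpM2l // -[ln 2](mulKf (_ : d%:R != 0)) ?pnatr_eq0 -?lt0n //.
by rewrite -mulrBr ler_wpM2l ?invr_ge0 // cmean_lnmax_coef.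
Qed.

Lemma sum_half_powers_ln2 n : \sum_(i < n) (2 ^+ i.+1)^-1 * ln 2 <= 1 :> R.
Proof.
rewrite -mulr_suml sum_half_powers; have l2 : 0 <= ln 2 :> R by rewrite ln_ge0 // ler1n.
have i0 : 0 <= (2 ^+ n)^-1 :> R by rewrite invr_ge0 exprn_ge0.
have i1 : (2 ^+ n)^-1 <= 1 :> R by rewrite invf_le1 ?exprn_gt0 // exprn_ege1 // ler1n.
rewrite -[leRHS]mulr1 ler_pM ?subr_ge0 ?ln2_le1 //; lra.
Qed.

Theorem pluripolar_union (W : nat -> C -> R) (S : nat -> set C2) :
  (forall n, tame (fun x => W n x.1)) -> (forall n z, W n.+1 z <= W n z) ->
  (forall n, 0 <= cmean (fun t => W n (E t))) -> (forall j, null (S j)) ->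
  pluripolar [set p : 'rV[C]_2 | (forall B, exists n, W n (p ord0 ord0) <= B) \/
                  exists j, S j (p ord0 ord0, p ord0 ord_max)].
Proof.
move=> tW dW mW nS.
have H i : exists dPb : nat * {poly {poly C}} * nat, [/\ (0 < dPb.1.1)%N, bideg dPb.1.1 dPb.1.2,
    forall k l, nc (dPb.1.2`_l)`_k <= 1, exists k, nc (dPb.1.2`_dPb.2)`_k = 1 &
    forall x, S (logn 2 i.+1) x -> nc (evp dPb.1.2 x) <= weight i dPb.1.1].
  have [d [P [d0 dP hP [k [l Hkl]] HS]]] := nS (logn 2 i.+1) (2 ^+ i.+1).
  by exists (d, P, l); split => //; exists k.
have [D HD] := choice H; pose d i := (D i).1.1; pose P i := (D i).1.2; pose b i := (D i).2.
have d0 i : (0 < d i)%N by have [] := HD i.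
have dP i : bideg (d i) (P i) by have [] := HD i.
have hP i k l : nc ((P i)`_l)`_k <= 1 by have [_ _ ] := HD i.
have bP i : exists k, nc ((P i)`_(b i))`_k = 1 by have [_ _ _] := HD i.
have sP i x : S (logn 2 i.+1) x -> nc (evp (P i) x) <= weight i (d i).
  by have [_ _ _ _] := HD i; apply.
move: (d) (P) (b) d0 dP hP bP sP => {}d {}P {}b d0 dP hP bP sP {D HD H}.
have w0 i : 0 < weight i (d i) by have /andP[] := weight_bounds i (d i).
have w1 i : weight i (d i) <= 1 by have /andP[] := weight_bounds i (d i).
pose v i x := (2 ^+ i.+1)^-1 * ((d i)%:R^-1 * ln (Num.max (weight i (d i)) (nc (evp (P i) x)))).
have tv i : tame (v i).
  apply: tameZ; first by rewrite invr_ge0 exprn_ge0.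
  by apply: tameZ; [rewrite invr_ge0|exact: tame_lnmax].
have vg i x : v i x <= (2 ^+ i.+1)^-1 * growth x.
  by rewrite ler_wpM2l ?invr_ge0 ?exprn_ge0 // normalized_le_growth // w0 w1.
(* The last term makes the sequence decrease: a new summand [v n] is at most [2 ^- n.+1] times
   [growth], exactly what that term gives up. *)
pose f n x := W n x.1 + \sum_(i < n) v i x + (2 ^+ n)^-1 * growth x.
have tf n : tame (f n).
  apply: tameD; first by apply: tameD => //; exact: tame_sum.
  by apply: tameZ growth_tame; rewrite invr_ge0 exprn_ge0.
have df n x : f n.+1 x <= f n x.
  rewrite /f big_ord_recr /= exprS invfM.
  by have := dW n x.1; have := vg n x; rewrite exprS invfM; lra.
(* [circle_point] is applied twice: first to [z], through the coefficients [a i] of [w ^+ b i],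
   which contain a coefficient of modulus 1; then to [w] at this [z]. Each circle loses at most 1 in
   total by [sum_half_powers_ln2], and dropping [2 ^- n] in between loses at most 1 more; hence -1,
   -2, -3. *)
have [x0 Hx0] : exists x0, forall n, -3 <= f n x0.
  have i0 n : 0 <= (2 ^+ n)^-1 :> R by rewrite invr_ge0 exprn_ge0.
  have i1 n : (2 ^+ n)^-1 <= 1 :> R by rewrite invf_le1 ?exprn_gt0 // exprn_ege1 // ler1n.
  have cW n : continuous (fun t => W n (E t)).
    have := @lip2_circ R _ (0, 0) (1, 0) (tW n).1.
    by rewrite /line /=; under eq_fun do rewrite add0r mulr1.
  pose a i := (P i)`_(b i); have sa i : (size (a i) <= (d i).+1)%N by have [_] := dP i; apply.
  pose al i z := (2 ^+ i.+1)^-1 * ((d i)%:R^-1 * ln (Num.max (weight i (d i)) (nc (a i).[z]))).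
  pose g1 n t := W n (E t) + \sum_(i < n) al i (E t) + (2 ^+ n)^-1.
  have sum1 n : continuous (fun t => \sum_(i < n) al i (E t)) /\
      cmean (fun t => \sum_(i < n) al i (E t)) = \sum_(i < n) cmean (fun t => al i (E t)).
    by apply: cmean_sum => i _; have [] := cmean_normalized 0 (d0 i) (w0 i) (i0 i.+1) (sa i).
  have cst_c (c : R) : continuous (fun _ : R => c) by move=> t; exact: cvg_cst.
  have cD (g h : R -> R) : continuous g -> continuous h -> continuous (fun t => g t + h t).
    by move=> cg ch t; apply: cvgD; [exact: cg | exact: ch].
  have al_mean i : - ((2 ^+ i.+1)^-1 * ln 2) <= cmean (fun t => al i (E t)).
    have [k Hk] := bP i; have [_] := cmean_normalized k (d0 i) (w0 i) (i0 i.+1) (sa i).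
    apply: le_trans; rewrite Hk.
    have -> : Num.max (weight i (d i)) 1 = 1 by apply/eqP; rewrite eq_maxr.
    by rewrite ln1 !mulr0 sub0r.
  have [t1 Ht1] : exists t, forall n, -1 <= g1 n t.
    apply: circle_point => [n|n t|n].
    - by apply: (cD) => //; apply: (cD) => //; have [] := sum1 n.
    - rewrite /g1 big_ord_recr /=.
      have Hal : al n (E t) <= (2 ^+ n.+1)^-1.
        rewrite -[leRHS]mulr1 ler_wpM2l // mulrC ler_pdivrMr ?ltr0n // mul1r.
        apply: le_trans (ln_succ_le _).
        rewrite ler_ln ?posrE ?lt_max ?w0 // ge_max (le_trans (w1 n)) ?ler1n //=.
        by apply: horner_circle_le => // k; exact: hP.
      by move: Hal (dW n (E t)); rewrite exprS invfM; lra.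
    have [c1 e1] := sum1 n.
    rewrite /g1 cmeanD ?cmeanD ?cmean_cst ?e1 //; last exact: cD.
    have : - \sum_(i < n) (2 ^+ i.+1)^-1 * ln 2 <= \sum_(i < n) cmean (fun t => al i (E t)).
      by rewrite -sumrN; apply: ler_sum => i _; exact: al_mean.
    by have := sum_half_powers_ln2 n; have := mW n; have := i0 n; lra.
  pose z := E t1; have Wal n : -2 <= W n z + \sum_(i < n) al i z.
    by have := Ht1 n; have := i1 n; rewrite /g1 -/z; lra.
  have evz i s : evp (P i) (z, E s) = (wpoly (P i) z).[E s] by rewrite wpolyE.
  have sw i : (size (wpoly (P i) z) <= (d i).+1)%N.
    by apply: leq_trans (size_poly _ _) _; have [] := dP i.
  have wb i : (wpoly (P i) z)`_(b i) = (a i).[z] by rewrite /wpoly coef_map.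
  have vz i := cmean_normalized (b i) (d0 i) (w0 i) (i0 i.+1) (sw i).
  have [s Hs] : exists s, forall n, -3 <= f n (z, E s).
    have cl (F : C2 -> R) : lip2 F -> continuous (fun s => F (z, E s)).
      move=> /(@lip2_circ R _ (z, 0) (0, 1)); rewrite /line /=.
      by under eq_fun do rewrite mulr0 addr0 mulr1 add0r.
    apply: circle_point => [n|n s|n]; [exact: cl (tf n).1|exact: df|].
    have [c2 e2] : continuous (fun s => \sum_(i < n) v i (z, E s)) /\
      cmean (fun s => \sum_(i < n) v i (z, E s)) = \sum_(i < n) cmean (fun s => v i (z, E s)).
      by apply: cmean_sum => i _; exact: cl (tv i).1.
    apply: (@le_trans _ _ (cmean (fun s => W n z + \sum_(i < n) v i (z, E s)))); last first.
      apply: cmean_le => [||s]; [exact: cD|exact: cl (tf n).1|].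
      by rewrite /f /= lerDl mulr_ge0 // (le_trans _ (growth_ge2 _)).
    rewrite cmeanD // cmean_cst e2.
    have : \sum_(i < n) al i z - \sum_(i < n) (2 ^+ i.+1)^-1 * ln 2 <=
        \sum_(i < n) cmean (fun s => v i (z, E s)).
      rewrite -sumrB; apply: ler_sum => i _; have [_] := vz i; rewrite wb.
      by under eq_fun do rewrite -evz.
    by have := sum_half_powers_ln2 n; have := Wal n; lra.
  by exists (z, E s).
have sub : pluripolar _ := pluripolar_decreasing (fun n => (tf n).1) (fun n => (tf n).2) df Hx0.
have [u [u1 u2 u3]] := sub; exists u; split => //; apply: subset_trans u3 => p.
set x := (p ord0 ord0, p ord0 ord_max) => Hp B.
have sumv n : \sum_(i < n) (2 ^+ i.+1)^-1 * growth x <= growth x.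
  rewrite -mulr_suml sum_half_powers mulrBl mul1r lerBlDr lerDl mulr_ge0 ?invr_ge0 ?exprn_ge0 //.
  exact: le_trans (growth_ge2 x).
have tail n : (2 ^+ n)^-1 * growth x <= growth x.
  rewrite -[leRHS]mul1r ler_wpM2r //; first exact: le_trans (growth_ge2 x).
  by rewrite invf_le1 ?exprn_gt0 // exprn_ege1 // ler1n.
(* All terms are nonnegative, and at a point of [S j] each of the infinitely many [i] with
   [logn 2 i.+1 = j] contributes at least 1. *)
pose s n := \sum_(i < n) ((2 ^+ i.+1)^-1 * growth x - v i x).
have fs n : f n x <= W n x.1 + 2 * growth x - s n.
  by rewrite /f /s sumrB; have := sumv n; have := tail n; lra.
have s_ge n k : (n <= k)%N -> s n <= s k.
  move=> nk; rewrite -(subnK nk); elim: (k - n)%N => [//|l IH].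
  by apply: le_trans IH _; rewrite /s addSn big_ord_recr /= lerDl subr_ge0.
case: Hp => [HW|[j Sj]].
  have [n Hn] := HW (B - 2 * growth x); exists n; apply: le_trans (fs n) _.
  have := s_ge 0%N n isT; rewrite {1}/s big_ord0.
  by move: Hn; rewrite /=; lra.
have large K : exists n, K%:R <= s n.
  elim: K => [|K [n Hn]]; first by exists 0%N; rewrite /s big_ord0.
  have [i ni ij] := logn_recurrent j n; exists i.+1.
  rewrite -addn1 natrD /s big_ord_recr /= -/(s i) lerD //; first exact: le_trans (s_ge _ _ ni).
  have -> : v i x = -1.
    rewrite /v (_ : Num.max _ _ = weight i (d i)); last first.
      by apply/eqP; rewrite eq_maxl; apply: sP; rewrite ij.
    rewrite expRK !mulrN mulrA -invfM mulVf // mulf_neq0 ?expf_neq0 ?pnatr_eq0 //.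
    by rewrite -lt0n.
  by rewrite opprK lerDr mulr_ge0 ?invr_ge0 ?exprn_ge0 // (le_trans _ (growth_ge2 x)).
have W_le n : W n x.1 <= W 0%N x.1.
  by elim: n => [//|n IH]; apply: le_trans (dW _ _) IH.
have [n Hn] := large (Num.truncn (W 0%N x.1 + 2 * growth x - B)).+1.
exists n; apply: le_trans (fs n) _.
have := truncnS_gt (W 0%N x.1 + 2 * growth x - B); have := W_le n; lra.
Qed.

End CountableUnion.

(** * Covering the graph by null sets *)

Section RegularizedLogarithm.
Variable R : realType.
Local Notation C := R[i].
Local Notation C2 := (C * C)%type.
Implicit Types (x : C2) (p : {poly C}).

Lemma tame_ln_mah p (r : R) : 0 < r -> p != 0 -> tame (fun x => ln (mah r p x.1)).
Proof.
move=> r0 p0; have l0 : 0 < nc (lead_coef p) by rewrite nc_gt0 lead_coef_eq0.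
have m0 (z a : C) : 0 < Num.max r (nc (z - a)) by rewrite lt_max r0.
rewrite (_ : (fun x => _) = fun x => ln (nc (lead_coef p)) +
    \sum_(a <- roots_of p) ln (Num.max r (nc (x.1 - a)))); last first.
  apply/funext => x; rewrite /mah lnM ?posrE ?prodr_gt0 // ?ln_prod // => a.
apply: tameD; first exact: tame_cst.
elim: (roots_of p) => [|a s IH].
  by rewrite (_ : (fun x => _) = fun=> 0); [exact: tame_cst|apply/funext => x; rewrite big_nil].
rewrite (_ : (fun x => _) = fun x => ln (Num.max r (nc (evp ('X - a%:P)%:P x))) +
    \sum_(a <- s) ln (Num.max r (nc (x.1 - a)))).
  by apply: tameD => //; exact: tame_lnmax.
by apply/funext => x; rewrite big_cons /evp /ev hornerC hornerXsubC.
Qed.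

Variables (q : nat -> {poly C}) (D : nat -> nat).
Hypothesis D_gt0 : forall m, (0 < D m)%N.
Hypothesis size_q : forall m, (size (q m) <= (D m).+1)%N.
Hypothesis q_neq0 : forall m, q m != 0.
Hypothesis mah_q : forall m, mah 1 (q m) 0 = 1.

(** [mah] at [z] is the exponential of the mean of [log |q m|] over the circle of radius [n.+1^-1],
    so this regularises [(log |q m|) / D m]. *)
Definition reglog (n m : nat) (z : C) : R :=
  (D m)%:R^-1 * ln (mah (n.+1%:R^-1) (q m) z).

(* Lipschitz in [z], with constant [n.+1], thanks to the radius [n.+1^-1] in [reglog]. *)
Definition suplog (n : nat) (z : C) : R :=
  sup [set reglog n m z | m in [set m | (n <= m)%N]].

Let rn n : 0 < (n.+1%:R^-1 : R) <= 1.
Proof. by rewrite invr_gt0 ltr0n /= invf_le1 ?ltr0n // ler1n. Qed.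

Let rn0 n : 0 < n.+1%:R^-1 :> R. Proof. by have /andP[] := rn n. Qed.

Let sq m : ((size (q m)).-1 <= D m)%N.
Proof. by have := size_q m; case: (size (q m)). Qed.

Let D0 m : 0 < (D m)%:R :> R. Proof. by rewrite ltr0n. Qed.

Lemma reglog_le n m z : reglog n m z <= ln (1 + nc z).
Proof.
have z1 : 1 <= 1 + nc z by rewrite lerDl nc_ge0.
rewrite /reglog mulrC ler_pdivrMr // mulr_natr -lnXn ?(lt_le_trans ltr01 z1) //.
have m0 := mah_gt0 z (rn0 n) (q_neq0 m).
rewrite ler_ln ?posrE ?exprn_gt0 ?(lt_le_trans ltr01 z1) //.
apply: le_trans (mah_upper z (rn n) (q_neq0 m)) _.
by rewrite mah_q mul1r ler_weXn2l.
Qed.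

Let has_sup_reglog n z : has_sup [set reglog n m z | m in [set m | (n <= m)%N]].
Proof.
split; first by exists (reglog n n z), n => //=.
by exists (ln (1 + nc z)) => _ [m _ <-]; exact: reglog_le.
Qed.

Lemma reglog_le_suplog n m z : (n <= m)%N -> reglog n m z <= suplog n z.
Proof. by move=> nm; apply: sup_upper_bound => //; exists m. Qed.

Lemma suplog_le n z B : (forall m, (n <= m)%N -> reglog n m z <= B) -> suplog n z <= B.
Proof.
move=> H; apply: ge_sup; first by exists (reglog n n z), n => //=.
by move=> _ [m nm <-]; exact: H.
Qed.

Lemma suplog_near n z B : B < suplog n z -> exists2 m, (n <= m)%N & B < reglog n m z.
Proof.
move=> H; have [|_ [m nm <-] Hm] := @sup_gt _ [set reglog n m z | m in [set m | (n <= m)%N]] B _ H.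
  by exists (reglog n n z), n => //=.
by exists m.
Qed.

(** Both changes decrease the supremum: fewer indices [m], and a smaller radius. *)
Lemma suplog_succ n z : suplog n.+1 z <= suplog n z.
Proof.
apply: suplog_le => m nm; apply: le_trans (reglog_le_suplog z (ltnW nm)).
rewrite ler_wpM2l ?invr_ge0 ?ler_ln ?posrE ?mah_gt0 //.
by apply: mah_mono => //; rewrite lef_pV2 ?posrE ?ltr0n // ler_nat.
Qed.

Lemma reglog_lip n m z z' : reglog n m z <= reglog n m z' + n.+1%:R * nc (z - z').
Proof.
have h0 : 0 <= nc (z - z') * n.+1%:R by rewrite mulr_ge0 ?nc_ge0.
have := mah_lip (rn0 n) (q_neq0 m) (lexx (nc (z - z'))); rewrite invrK => H.
have h1 : 0 < 1 + nc (z - z') * n.+1%:R by rewrite ltr_pwDl.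
have m1 := mah_gt0 z (rn0 n) (q_neq0 m); have m2 := mah_gt0 z' (rn0 n) (q_neq0 m).
rewrite /reglog -(ler_pM2l (D0 m)) mulrDr !mulVKf ?gt_eqF //.
have {H} : ln (mah n.+1%:R^-1 (q m) z) <=
    ln (mah n.+1%:R^-1 (q m) z' * (1 + nc (z - z') * n.+1%:R) ^+ (size (q m)).-1).
  by rewrite ler_ln // posrE; apply: mulr_gt0 => //; exact: exprn_gt0.
rewrite lnM ?posrE ?exprn_gt0 // lnXn // => H; apply: le_trans H _.
rewrite lerD2l -[ln _ *+ _]mulr_natl; apply: ler_pM => //; first by rewrite ln_ge0 // lerDl.
  by rewrite ler_nat.
rewrite [leRHS]mulrC; apply: le_ln1Dx; apply: (lt_le_trans _ h0).
by rewrite oppr_lt0.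
Qed.

Lemma suplog_lip n z z' : suplog n z <= suplog n z' + n.+1%:R * nc (z - z').
Proof.
apply: suplog_le => m nm; apply: le_trans (reglog_lip n m z z') _.
by rewrite lerD2r reglog_le_suplog.
Qed.

Lemma tame_reglog n m : tame (fun x => reglog n m x.1).
Proof. by apply: tameZ; [rewrite invr_ge0|exact: tame_ln_mah]. Qed.

Lemma tame_suplog n : tame (fun x => suplog n x.1).
Proof.
have lW : lip2 (fun x => suplog n x.1).
  move=> M; exists n.+1%:R => // x y _ _ _ _.
  have Y0 := nc_ge0 (x.2 - y.2); have N0 : 0 <= n.+1%:R :> R by [].
  rewrite mulrDr; have := mulr_ge0 N0 Y0 => H.
  have := suplog_lip n x.1 y.1; have := suplog_lip n y.1 x.1; rewrite [nc (y.1 - _)]nc_distC.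
  by rewrite ler_norml; move=> *; apply/andP; split; lra.
split => // a b; apply: suplog_le => m nm; have [l s] := tame_reglog n m.
apply: le_trans (s a b) _; apply: cmean_le => [||t]; first exact: lip2_circ l.
  exact: lip2_circ lW.
exact: reglog_le_suplog.
Qed.

(** The single term [m = n] is enough: its mean on the unit circle is at least the logarithm of a
    Mahler measure equal to 1. *)
Lemma cmean_suplog_ge0 n : 0 <= cmean (fun t => suplog n (E t)).
Proof.
(* [e] is the lower bound of [mah_lower], valid at every point, so [|q n|] truncated at [e] stays
   below [mah r (q n)]. *)
pose r : R := n.+1%:R^-1; pose e := nc (lead_coef (q n)) * r ^+ (size (q n)).-1.
have e0 : 0 < e by rewrite mulr_gt0 ?exprn_gt0 ?rn0 // nc_gt0 lead_coef_eq0.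
have cE (W : C -> R) : lip2 (fun x : C2 => W x.1) -> continuous (fun t => W (E t)).
  move=> /(@lip2_circ R _ (0, 0) (1, 0)); rewrite /line /=.
  by under eq_fun do rewrite add0r mulr1.
have H1 : 0 <= cmean (fun t => ln (mah r (q n) (E t))).
  have := @mah_jensen R 1 (q n) 0 e ltr01 e0 (q_neq0 n); rewrite mah_q ln1.
  under [fun t => _]eq_fun do rewrite add0r mul1r.
  move=> H; apply: le_trans H _; apply: cmean_le => [||t].
  - have := @lnmax_poly_continuous R (q n) 0 1 e e0.
    by under eq_fun do rewrite add0r mul1r.
  - exact: (cE (fun z => ln (mah r (q n) z))) (tame_ln_mah (rn0 n) (q_neq0 n)).1.
  - by rewrite ler_ln ?posrE ?lt_max ?e0 ?mah_gt0 ?rn0 // ge_max mah_ge mah_lower ?rn0.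
apply: (@le_trans _ _ (cmean (fun t => reglog n n (E t)))).
  rewrite cmeanZ; first by apply: mulr_ge0; rewrite ?invr_ge0.
  exact: (cE (fun z => ln (mah r (q n) z))) (tame_ln_mah (rn0 n) (q_neq0 n)).1.
apply: cmean_le => [||t]; last exact: reglog_le_suplog.
  exact: (cE (reglog n n)) (tame_reglog n n).1.
exact: cE (tame_suplog n).1.
Qed.

End RegularizedLogarithm.

(** * From local estimates to the criterion *)

Section LocalCriterion.
Variable R : realType.
Local Notation C := R[i].
Local Notation C2 := (C * C)%type.
Implicit Types (x y : C2) (S A : set C2) (r M : R).

Lemma truncn_close (delta u v : R) : 0 < delta -> 0 <= u -> 0 <= v ->
  Num.truncn (u / delta) = Num.truncn (v / delta) -> `|u - v| <= delta.
Proof.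
move=> d0 u0 v0 uv.
have := truncn_itv (divr_ge0 u0 (ltW d0)); have := truncn_itv (divr_ge0 v0 (ltW d0)).
rewrite uv; set n := Num.truncn _ => /andP[v1 v2] /andP[u1 u2].
move: v1 v2 u1 u2; rewrite !ler_pdivlMr // !ltr_pdivrMr // -addn1 natrD mulrDl mul1r.
by move=> *; rewrite ler_norml; apply/andP; split; lra.
Qed.

(** The square containing the first coordinates is cut into cells of side [delta / 2], and a point
    of [A] is chosen in each occupied cell. Only [z] is discretised, since the estimates in
    [criterion_of_local] are uniform in [w]. *)
Lemma finite_net A M (delta : R) : bounded2 A M -> 0 < delta ->
  exists s : seq C2, (forall x, x \in s -> A x) /\
    forall x, A x -> exists2 x0, x0 \in s & nc (x.1 - x0.1) <= delta.
Proof.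
move=> bA d0; pose d := delta / 2; have dp : 0 < d by rewrite divr_gt0.
pose n := (Num.truncn ((M + M) / d)).+1.
pose cell (z : C) : 'I_n * 'I_n := (inord (Num.truncn ((complex.Re z + M) / d)),
                                   inord (Num.truncn ((complex.Im z + M) / d))).
have pick c : exists x : C2, (exists2 y : C2, A y & cell y.1 = c) -> A x /\ cell x.1 = c.
  by have [[y Ay cy]|h] := pselect (exists2 y : C2, A y & cell y.1 = c); [exists y|exists (0, 0)].
have [rep Hrep] := choice pick.
exists [seq rep c | c <- enum {: 'I_n * 'I_n} & `[< exists2 y : C2, A y & cell y.1 = c >]].
split=> [x /mapP[c]|x Ax].
  by rewrite mem_filter => /andP[/asboolP H _] ->; have [] := Hrep c H.
have H : exists2 y : C2, A y & cell y.1 = cell x.1 by exists x.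
exists (rep (cell x.1)).
  by apply: map_f; rewrite mem_filter mem_enum andbT; exact/asboolP.
have [Ar [/(congr1 val) e1 /(congr1 val) e2]] := Hrep _ H.
have [x1 _] := bA _ Ax; have [r1 _] := bA _ Ar.
have rng (u : R) : `|u| <= M -> 0 <= u + M /\ (Num.truncn ((u + M) / d) < n)%N.
  rewrite ler_norml => /andP[u1 u2]; have u0 : 0 <= u + M by lra.
  by split => //; rewrite /n ltnS; apply: le_truncn; rewrite ler_pM2r ?invr_gt0 //; lra.
have [a1 a2] := rng _ (le_trans (nc_Re x.1) x1); have [a3 a4] := rng _ (le_trans (nc_Im x.1) x1).
have [b1 b2] := rng _ (le_trans (nc_Re (rep (cell x.1)).1) r1).
have [b3 b4] := rng _ (le_trans (nc_Im (rep (cell x.1)).1) r1).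
move: e1 e2; rewrite /= !inordK // => e1 e2.
have h1 := truncn_close dp a1 b1 (esym e1); have h2 := truncn_close dp a3 b3 (esym e2).
apply: le_trans (nc_le _) _; rewrite !raddfB /= -[delta](_ : d + d = _); last by rewrite /d; lra.
have e (u w : R) : u + M - (w + M) = u - w by ring.
by move: h1 h2; rewrite !e; exact: lerD.
Qed.

(** As [h] is the same for all [x0], a finite net in [z] supplies the finite family [I]; halving [h]
    leaves room for the distance to the net. *)
Lemma criterion_of_local S M (b b' : R) : bounded2 S M ->
  (forall r, 0 < r -> exists2 h, 0 < h & forall x0, S x0 -> exists P d,
    [/\ (0 < d)%N, bideg d P, forall x, S x -> nc (evp P x) <= expR (b * d%:R) &
        forall y, nc (y.1 - x0.1) <= h -> good P d r y b']) ->
  criterion S b b'.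
Proof.
move=> bS H r /H[h h0 {}H]; exists (h / 2); first by rewrite divr_gt0.
have [s [sS Hs]] := finite_net bS (divr_gt0 h0 (ltr0n R 2)).
have pick x0 : exists Pd : {poly {poly C}} * nat, S x0 ->
    [/\ (0 < Pd.2)%N, bideg Pd.2 Pd.1, forall x, S x -> nc (evp Pd.1 x) <= expR (b * Pd.2%:R) &
        forall y, nc (y.1 - x0.1) <= h -> good Pd.1 Pd.2 r y b'].
  by have [/H[P [d ?]]|h'] := pselect (S x0); [exists (P, d)|exists (0, 0%N)].
have [F HF] := choice pick; exists [seq F x | x <- s]; split=> [Pd /mapP[x xs ->]|y [x Sx [yx _]]].
  by have [] := HF x (sS x xs).
have [x0 xs x0x] := Hs x Sx; exists (F x0); first exact: map_f.
have [_ _ _] := HF x0 (sS _ xs); apply.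
by rewrite -(subrKA x.1) (le_trans (ncD _ _)) // (le_trans (lerD yx x0x)) // -splitr.
Qed.

Lemma expR_le_power r (eps : R) k : 0 < r -> 0 < eps ->
  exists N, forall n, (N <= n)%N -> expR (- (eps * n%:R)) <= r ^+ k.
Proof.
move=> r0 e0; exists (Num.truncn (r ^- k / eps)).+1 => n Nn.
have rk : 0 < r ^+ k by exact: exprn_gt0.
rewrite expRN -[leRHS]invrK lef_pV2 ?posrE ?invr_gt0 ?expR_gt0 //.
apply: le_trans (_ : eps * n%:R <= _); last by apply: le_trans (expR_ge1Dx _); rewrite lerDr.
rewrite mulrC -ler_pdivrMr //; apply: le_trans (ltW (truncnS_gt _)) _.
by rewrite ler_nat.
Qed.

End LocalCriterion.

(** * The null layers and the covering *)

Section Covering.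
Variable R : realType.
Local Notation C := R[i].
Local Notation C2 := (C * C)%type.
Implicit Types (x y : C2) (S G : set C2) (r M : R) (P : {poly {poly C}}) (q : {poly C}).

Lemma pow1D_le (eta : R) d : 0 <= eta -> (1 + eta) ^+ d <= expR (eta * d%:R).
Proof.
move=> e0; rewrite expRM_natr lerXn2r ?nnegrE ?expR_ge0 ?addr_ge0 //.
by rewrite expR_ge1Dx.
Qed.

(** One [eta] pays for the factor [r ^+ deg] of the move in [w], the other for the distance from
    [y.1] to [x0.1]. *)
Lemma good_lead P d r y x0 (t eta : R) : 0 < r -> 0 <= eta -> bideg d P ->
  expR (t * d%:R) <= nc (lead_coef P).[x0.1] ->
  expR (- (eta * d%:R)) <= r ^+ (size P).-1 ->
  nc (y.1 - x0.1) <= r * eta -> good P d r y (t - eta - eta).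
Proof.
move=> r0 e0 dP Hq Hr yx V a.
have q0 : (lead_coef P).[x0.1] != 0 by rewrite -nc_gt0; apply: lt_le_trans Hq; exact: expR_gt0.
have [x1 [x2 [h1 h2 H]]] := two_step_move V a y.2 r0 dP q0 yx.
exists (x1, x2) => //; apply: le_trans H; rewrite ler_wpM2l ?nc_ge0 //.
rewrite expRM_natr lerXn2r ?nnegrE ?expR_ge0 //.
  by rewrite divr_ge0 ?mulr_ge0 ?nc_ge0 ?exprn_ge0 // ?(ltW r0) // addr_ge0 // mulrC mulKf ?gt_eqF.
have -> : r * eta / r = eta by rewrite mulrC mulKf ?gt_eqF.
rewrite ler_pdivlMr ?exprn_gt0 ?ltr_pwDl //.
have -> : expR ((t - eta - eta) * d%:R) =
    expR (t * d%:R) * expR (- (eta * d%:R)) * expR (- (eta * d%:R)).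
  by rewrite -!expRD; congr expR; ring.
rewrite -!mulrA; apply: ler_pM; rewrite ?expR_ge0 ?mulr_ge0 ?expR_ge0 ?exprn_ge0 ?addr_ge0 //.
apply: le_trans Hr; rewrite ler_piMr ?expR_ge0 // expRN mulrC ler_pdivrMr ?expR_gt0 // mul1r.
exact: pow1D_le.
Qed.

(** Since [q] does not involve [w], a single move in [z] is made, and the distance from [y.1] to
    [x0.1] is the only loss. *)
Lemma good_mah q d r y x0 (t eta : R) : 0 < r -> 0 <= eta -> (size q <= d.+1)%N -> q != 0 ->
  expR (t * d%:R) <= mah r q x0.1 -> nc (y.1 - x0.1) <= r * eta ->
  good q%:P d r y (t - eta).
Proof.
move=> r0 e0 sq q0 Hq yx V a.
have [z zr Hz] := circle_move y.1 V.[y.2%:P] a r0 q0.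
exists (z, y.2); first by split; rewrite /= ?zr // subrr nc0 (ltW r0).
rewrite {1 2}/evp /ev /= in Hz *; rewrite [evp q%:P _]/evp /ev hornerC /=.
apply: le_trans Hz; rewrite ler_wpM2l ?nc_ge0 //.
have m0 := mah_gt0 y.1 r0 q0.
rewrite expRM_natr lerXn2r ?nnegrE ?expR_ge0 ?(ltW m0) //.
rewrite nc_distC in yx; have := mah_lip r0 q0 yx.
have -> : r * eta / r = eta by rewrite mulrC mulKf ?gt_eqF.
move=> H; rewrite mulrBl expRB ler_pdivrMr ?expR_gt0 //.
apply: le_trans Hq (le_trans H _); rewrite ler_wpM2l ?(ltW m0) //.
apply: le_trans (pow1D_le d e0); rewrite ler_weXn2l ?lerDl //.
by move: sq; case: (size q).
Qed.

Variables (G : set C2) (M : R) (k : nat) (P : nat -> {poly {poly C}}) (gamma : R).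
Hypothesis bG : bounded2 G M.
Hypothesis k_gt0 : (0 < k)%N.
Hypothesis gamma_gt0 : 0 < gamma.

Let D m := (k * m.+1)%N.
Let q m := lead_coef (P m).

Hypothesis bidegP : forall m, bideg (D m) (P m).
Hypothesis sizeP : forall m, size (P m) = k.+1.
Hypothesis mahP : forall m, mah 1 (q m) 0 = 1.

Let D_gt0 m : (0 < D m)%N. Proof. by rewrite muln_gt0 k_gt0. Qed.

Let le_D m : (m <= D m)%N.
Proof. by apply: (@leq_trans m.+1) => //; rewrite -[m.+1]mul1n leq_mul. Qed.

Let q_neq0 m : q m != 0.
Proof. by rewrite lead_coef_eq0 -size_poly_gt0 sizeP. Qed.

Let size_q m : (size (q m) <= (D m).+1)%N.
Proof. by have [_] := bidegP m; apply. Qed.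

Let bounded_sub S : S `<=` G -> bounded2 S M.
Proof. by move=> SG x /SG; exact: bG. Qed.

(* The two kinds of null pieces of the graph: infinitely many [q m] are not too small
   compared with the bound on [P m], or all [q m] are small at the point although
   their regularised limsup is not. *)
Definition lead_layer (j : nat) (t : R) : set C2 := [set x | [/\ G x,
  forall m, (j <= m)%N -> nc (evp (P m) x) <= expR ((t - 3) * gamma * (D m)%:R) &
  forall N, exists2 m, (N <= m)%N & expR (t * gamma * (D m)%:R) <= nc (q m).[x.1]]].

(** The degree in [w] stays [k] while [D m] grows, so [gamma / 2] swallows the factor [r ^+ k]. The
    rate attained is [(t - 1) * gamma], against the bound [(t - 3) * gamma]. *)
Lemma null_lead_layer j t : null (lead_layer j t).
Proof.
have bS : bounded2 (lead_layer j t) M by apply: bounded_sub => x [].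
apply: (@null_criterion R _ M ((t - 3) * gamma) (t * gamma - gamma / 2 - gamma / 2)) => //.
  by have := gamma_gt0; lra.
apply: (criterion_of_local bS) => r r0; have g2 : 0 < gamma / 2 by rewrite divr_gt0.
exists (r * (gamma / 2)); first by rewrite mulr_gt0.
have [N HN] := expR_le_power k r0 g2.
move=> x0 [_ _ /(_ (maxn j N))[m]]; rewrite geq_max => /andP[jm Nm] Hm.
exists (P m), (D m); split => // [x [_ H _]|y yx]; first exact: H.
apply: (@good_lead _ _ _ _ x0) => //; first exact: ltW.
by rewrite sizeP /=; apply: HN; exact: leq_trans (le_D m).
Qed.

Definition degenerate_layer (j l : nat) : set C2 := [set x | [/\ G x,
  forall m, (j <= m)%N -> nc (q m).[x.1] <= expR (- (l.+1%:R * (D m)%:R)) &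
  forall n, - l%:R <= suplog q D n x.1]].

(** The bound has rate [- (l + 1)], and [- l - 1/2] is attained: [mah] grows with the radius, so a
    value of [suplog] with [n.+1^-1 <= r] serves at radius [r]. *)
Lemma null_degenerate_layer j l : null (degenerate_layer j l).
Proof.
have bS : bounded2 (degenerate_layer j l) M by apply: bounded_sub => x [].
apply: (@null_criterion R _ M (- l.+1%:R) (- l%:R - 4^-1 - 4^-1)) => //.
  by rewrite -addn1 natrD; lra.
apply: (criterion_of_local bS) => r r0.
exists (r * 4^-1); first by rewrite mulr_gt0.
move=> x0 [_ _ HW]; pose n := maxn j (Num.truncn r^-1).
have nr : n.+1%:R^-1 <= r.
  rewrite -[leRHS]invrK lef_pV2 ?posrE ?ltr0n ?invr_gt0 //.
  by apply: le_trans (ltW (truncnS_gt _)) _; rewrite ler_nat ltnS leq_maxr.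
have [|m nm Hm] := @suplog_near _ q D n x0.1 (- l%:R - 4^-1).
  by apply: lt_le_trans (HW n); lra.
exists (q m)%:P, (D m); split => // [|x [_ H _]|y yx].
- split=> [|i]; first by rewrite (leq_trans (size_polyC_leq1 _)).
  by rewrite coefC; case: ifP; rewrite ?size_poly0.
- rewrite /evp /ev hornerC mulNr; apply: H.
  by apply: leq_trans nm; rewrite leq_maxl.
apply: (@good_mah _ _ _ _ x0) => //.
apply: le_trans (mah_mono _ _ _ nr); last by rewrite invr_gt0 ltr0n.
have m0 : 0 < mah (n.+1%:R^-1) (q m) x0.1 by apply: mah_gt0; rewrite ?invr_gt0 ?ltr0n.
rewrite -[leRHS]lnK ?posrE // ler_expR -ler_pdivlMr ?ltr0n // [leRHS]mulrC.
exact: ltW Hm.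
Qed.

Variables (m0 : nat).
Hypothesis smallP : forall m x, (m0 <= m)%N -> G x ->
  nc (evp (P m) x) <= nc (q m).[x.1] * expR (- (4 * gamma * (D m)%:R)).

(** Measure [|q m|] at the point on the scale [exp (t * gamma * D m)]. By [mah_upper] the level [T]
    is never reached. Either some [T - s] is the highest level below it reached infinitely often, or
    [|q m|] eventually falls below every level. *)
Lemma covering x : G x ->
  [\/ forall B, exists n, suplog q D n x.1 <= B,
      exists j T s, lead_layer j (T%:R - s%:R) x |
      exists j l, degenerate_layer j l x].
Proof.
move=> Gx; have [H|/existsNP[B /forallNP HB]] := pselect (forall B, exists n, suplog q D n x.1 <= B).
  by constructor 1.
have {}HB n : B < suplog q D n x.1 by rewrite ltNge; apply/negP.
pose io (t : R) := forall N, exists2 m, (N <= m)%N & expR (t * gamma * (D m)%:R) <= nc (q m).[x.1].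
pose T := (Num.truncn (ln (1 + nc x.1) / gamma)).+1.
have nT : ~ io T%:R.
  move=> /(_ 0%N)[m _]; apply/negP; rewrite -ltNge.
  have x1 : 1 <= 1 + nc x.1 by rewrite lerDl nc_ge0.
  apply: (@le_lt_trans _ _ ((1 + nc x.1) ^+ D m)).
    apply: le_trans (mah_ge 1 _ _) _.
    have := @mah_upper _ 1 (q m) x.1; rewrite mahP mul1r ltr01 lexx => /(_ isT (q_neq0 m)).
    move=> /le_trans; apply; rewrite ler_weXn2l //.
    by have := size_q m; case: (size (q m)).
  rewrite expRM_natr ltrXn2r ?nnegrE ?expR_ge0 ?gtn_eqF ?(le_trans ler01 x1) //.
  rewrite -[ltLHS]lnK ?posrE ?(lt_le_trans ltr01 x1) // ltr_expR -ltr_pdivrMr //.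
  exact: truncnS_gt.
have [[s Hs]|Hs] := pselect (exists s : nat, io (T%:R - s%:R)).
  constructor 2; have Hex : exists s : nat, `[< io (T%:R - s%:R) >] by exists s; apply/asboolP.
  have [[|s'] /asboolP Hs' smin] := ex_minnP Hex; first by move: Hs'; rewrite subr0.
  have : ~ io (T%:R - s'%:R) by move=> /asboolP/smin; rewrite ltnn.
  move=> /existsNP[N /forall2NP HN].
  (* The level [T - s'] is eventually not reached, so [smallP] bounds [P m] with exponent
     [(T - s' - 4) * gamma]; this is [(t - 3) * gamma] for [t = T - s'.+1]. *)
  exists (maxn m0 N), T, s'.+1; split => // m; rewrite geq_max => /andP[mm Nm].
  apply: le_trans (smallP mm Gx) _.
  have [//|/negP] := HN m; rewrite -ltNge => Hq.
  apply: (@le_trans _ _ (expR ((T%:R - s'%:R) * gamma * (D m)%:R) * expR (- (4 * gamma * (D m)%:R)))).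
    by rewrite ler_wpM2r ?expR_ge0 // ltW.
  by rewrite -expRD ler_expR -(natr1 s') le_eqVlt; apply/orP; left; apply/eqP; ring.
constructor 3; pose l := (Num.truncn (`|B|)).+1.
pose s := (Num.truncn ((l.+1%:R + T%:R * gamma) / gamma)).+1.
have : ~ io (T%:R - s%:R) by move=> H; apply: Hs; exists s.
move=> /existsNP[N /forall2NP HN]; exists N, l; split => // [m Nm|n].
  have [//|/negP] := HN m; rewrite -ltNge => /ltW /le_trans; apply.
  rewrite ler_expR -mulNr ler_wpM2r //.
  have : (l.+1%:R + T%:R * gamma) / gamma < s%:R by exact: truncnS_gt.
  by rewrite ltr_pdivrMr // mulrBl; lra.
apply: le_trans (ltW (HB n)); rewrite lerNl; apply: le_trans (ler_norm _) _.
by rewrite normrN; exact: ltW (truncnS_gt _).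
Qed.

Theorem pluripolar_of_small_polynomials :
  pluripolar [set p : 'rV[C]_2 | G (p ord0 ord0, p ord0 ord_max)].
Proof.
pose S i := match unpickle i : option (nat * nat * nat + nat * nat) with
  | Some (inl (j, T, s)) => lead_layer j (T%:R - s%:R)
  | Some (inr (j, l)) => degenerate_layer j l
  | None => degenerate_layer 0 0
  end.
have nS i : null (S i).
  rewrite /S; case: unpickle => [[[[j T] s]|[j l]]|]; first exact: null_lead_layer.
    exact: null_degenerate_layer.
  exact: null_degenerate_layer.
have [u [u1 u2 u3]] := pluripolar_union (tame_suplog D_gt0 size_q q_neq0 mahP)
  (suplog_succ D_gt0 size_q q_neq0 mahP) (cmean_suplog_ge0 D_gt0 size_q q_neq0 mahP) nS.
exists u; split => //; apply: subset_trans u3 => p /covering[H|[j [T [s H]]]|[j [l H]]].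
- by left.
- by right; exists (pickle (inl (j, T, s) : nat * nat * nat + nat * nat)); rewrite /S pickleK.
- by right; exists (pickle (inr (j, l) : nat * nat * nat + nat * nat)); rewrite /S pickleK.
Qed.

End Covering.

(** * Rational approximation on a segment *)

Section RationalSegment.
Variable R : realType.
Local Notation C := R[i].
Local Notation C2 := (C * C)%type.
Implicit Types (x : C2) (p q : {poly C}) (f : C -> C) (K : set C).

(** [roots_of] is a choice, so the two lists of roots agree only up to permutation. *)
Lemma mahZ (s : C) (r : R) p c : s != 0 -> p != 0 -> mah r (s *: p) c = nc s * mah r p c.
Proof.
move=> s0 p0; have sp0 : s *: p != 0 by rewrite scaler_eq0 negb_or s0.
rewrite /mah lead_coefZ ncM -mulrA; congr (_ * (_ * _)); apply: perm_big.
apply: prod_XsubC_eq; apply/esym.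
have := roots_ofE (s *: p); rewrite {1}(roots_ofE p) lead_coefZ scalerA.
by move=> /scalerI -> //; rewrite mulf_neq0 // lead_coef_eq0.
Qed.

Lemma sup_norm_ge K f (B : \bar R) : (sup_norm K f < B)%E ->
  forall z, K z -> ((nc (f z))%:E < B)%E.
Proof. by move=> H z Kz; apply: le_lt_trans H; apply: ereal_sup_ubound; exists z. Qed.

Lemma R0_approximation K f : K !=set0 -> R0 K f ->
  exists2 theta : R, 0 < theta < 1 & exists m0, forall m, (m0 <= m)%N ->
    exists p q, [/\ (size p <= m.+1)%N, (size q <= m.+1)%N, forall z, K z -> q.[z] != 0 &
      forall z, K z -> nc (f z - p.[z] / q.[z]) <= theta ^+ m].
Proof.
move=> [k0 Kk0] [_]; rewrite /limn_esup /limf_esup => /ereal_inf_lt[_ [V [n0 _ HV] <-]].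
set s := ereal_sup _ => s1.
have [theta /andP[t0 t1] st] : exists2 theta : R, 0 < theta < 1 & (s < theta%:E)%E.
  case: s s1 => [v||] //; last by move=> _; exists 2^-1; rewrite ?ltNyr //; lra.
  rewrite lte_fin => v1; exists (Num.max (2^-1) ((v + 1) / 2)); last first.
    by rewrite lte_fin lt_max; apply/orP; right; lra.
  by rewrite lt_max gt_max; apply/andP; split; [apply/orP; left|apply/andP; split]; lra.
exists theta; first by rewrite t0.
(* Starting at [n0.+1] excludes [m = 0], where the exponent [m%:R^-1] would be 0. *)
exists n0.+1 => m nm; have m0 : (0 < m)%N by exact: leq_trans nm.
have Hm : (rho K f m `^ (m%:R^-1) < theta%:E)%E.
  by apply: le_lt_trans st; apply: ereal_sup_ubound; exists m => //; apply: HV; exact: ltnW.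
have rho0 : (0 <= rho K f m)%E.
  apply: le_ereal_inf_tmp => _ [r _ <-].
  apply: (@le_trans _ _ (nc (f k0 - r k0))%:E); first by rewrite lee_fin nc_ge0.
  by apply: ereal_sup_ubound; exists k0.
have Hrho : (rho K f m < (theta ^+ m)%:E)%E.
  case: (rho K f m) rho0 Hm => [v||] //.
  - rewrite lee_fin poweR_EFin !lte_fin => v0 Hv.
    have -> : v = (v `^ (m%:R^-1)) ^+ m.
      by rewrite -powR_mulrn ?powR_ge0 // -powRrM mulVf ?powRr1 // pnatr_eq0 -lt0n.
    by rewrite ltrXn2r ?nnegrE ?powR_ge0 ?(ltW t0) // -lt0n.
  - by rewrite poweRyr // invr_eq0 pnatr_eq0 -lt0n.
have [_ [r [p [q [sp sq q0 ->]]] <-] Hr] := ereal_inf_lt Hrho.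
exists p, q; split => // z Kz; rewrite -lee_fin ltW //; exact: sup_norm_ge Hr z Kz.
Qed.

Lemma segment_away (a b : R) (alpha : C) : ~ real_segment a b alpha ->
  exists2 e : R, 0 < e & forall z, real_segment a b z -> e <= nc (z - alpha).
Proof.
move=> H; have [im0|im0] := eqVneq (complex.Im alpha) 0; last first.
  exists `|complex.Im alpha|; first by rewrite normr_gt0.
  by move=> _ [t _ <-]; apply: le_trans (nc_Im _); rewrite raddfB /= sub0r normrN.
have ea : alpha = (complex.Re alpha)%:C by case: (alpha) im0 => u v /= ->.
set u := complex.Re alpha in ea *.
have : ~ (a <= u <= b) by move=> h; apply: H; rewrite ea; exists u => //=; rewrite in_itv.
move=> /negP; rewrite negb_and -!ltNge => /orP[ua|bu].
  exists (a - u); first by rewrite subr_gt0.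
  move=> _ [t /= ht <-]; rewrite in_itv /= in ht; move/andP: ht => [t1 t2].
  apply: le_trans (nc_Re _); rewrite raddfB /= -/u; apply: le_trans (ler_norm _).
  by rewrite lerD2r.
exists (u - b); first by rewrite subr_gt0.
move=> _ [t /= ht <-]; rewrite in_itv /= in ht; move/andP: ht => [t1 t2].
apply: le_trans (nc_Re _); rewrite raddfB /= -/u distrC; apply: le_trans (ler_norm _).
by rewrite lerB.
Qed.

(* Compactness is not needed: each root keeps a positive distance from the segment. *)
Lemma poly_segment_lower (a b : R) q : q != 0 -> (forall z, real_segment a b z -> q.[z] != 0) ->
  exists2 e : R, 0 < e & forall z, real_segment a b z -> e <= nc q.[z].
Proof.
move=> q0 Hq; have rq alpha : alpha \in roots_of q -> ~ real_segment a b alpha.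
  move=> ar /Hq; rewrite (roots_ofE q) hornerZ horner_prod (big_rem alpha) //=.
  by rewrite hornerXsubC subrr mul0r mulr0 eqxx.
have l0 : 0 < nc (lead_coef q) by rewrite nc_gt0 lead_coef_eq0.
suff [e e0 He] : exists2 e : R, 0 < e &
    forall z, real_segment a b z -> e <= \prod_(alpha <- roots_of q) nc (z - alpha).
  exists (nc (lead_coef q) * e); first exact: mulr_gt0.
  by move=> z Kz; rewrite nc_horner ler_pM2l // He.
elim: (roots_of q) rq => [_|alpha s IH rq].
  by exists 1 => // z _; rewrite big_nil.
have [|e e0 He] := IH; first by move=> beta bs; apply: rq; rewrite inE bs orbT.
have [e' e'0 He'] := segment_away (rq alpha (mem_head _ _)).
exists (e' * e); first exact: mulr_gt0.
by move=> z Kz; rewrite big_cons ler_pM ?He ?He' // ltW.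
Qed.

Lemma segment_bound (a b : R) z : real_segment a b z -> nc z <= `|a| + `|b|.
Proof.
move=> [t /= ht <-]; rewrite in_itv /= in ht; move/andP: ht => [t1 t2].
rewrite nc_real ler_norml; have := ler_norm a; have := ler_norm b.
by have := ler_norm (- a); have := ler_norm (- b); rewrite !normrN => *; apply/andP; split; lra.
Qed.

(** One approximant at finite distance is enough: it is bounded because its denominator stays away
    from 0 on the segment. *)
Lemma R0_bounded (a b : R) f : a <= b -> R0 (real_segment a b) f ->
  exists B : R, forall z, real_segment a b z -> nc (f z) <= B.
Proof.
move=> ab hf; have K0 : real_segment a b !=set0.
  by exists a%:C, a => //=; rewrite in_itv /= lexx.
have [theta _ [m0 /(_ m0 (leqnn _))[p [q [_ _ q0 H]]]]] := R0_approximation K0 hf.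
have qn : q != 0 by have [z /q0] := K0; apply: contra_neq => ->; rewrite horner0.
have [e e0 He] := poly_segment_lower qn q0.
have [L L0 HL] := poly_bounded p (`|a| + `|b|).
exists (theta ^+ m0 + L / e) => z Kz.
have := ncD (f z - p.[z] / q.[z]) (p.[z] / q.[z]); rewrite subrK => /le_trans; apply.
rewrite lerD ?H // ler_pdivlMr //.
apply: le_trans (HL z (segment_bound Kz)).
apply: (@le_trans _ _ (nc (p.[z] / q.[z]) * nc q.[z])); last by rewrite -ncM divfK ?q0.
by rewrite ler_wpM2l ?nc_ge0 // He.
Qed.

End RationalSegment.

(** * Clearing denominators *)

Section ClearDenominators.
Variable R : realType.
Local Notation C := R[i].
Local Notation C2 := (C * C)%type.

Lemma size_prod_le k n (F : nat -> {poly C}) : (forall l, (size (F l) <= n.+1)%N) ->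
  (size (\prod_(l < k) F l)%R <= (k * n).+1)%N.
Proof.
move=> HF; elim: k => [|k IH]; first by rewrite big_ord0 size_poly1.
rewrite big_ord_recr /=; apply: leq_trans (size_polyMleq _ _) _.
rewrite mulSn; have := leq_add IH (HF k); move: (_ + _)%N (k * n)%N => s t; lia.
Qed.

(** The numerator of [w^k + \sum_j (p j / q j) w^j] over the common denominator [\prod_l q l],
    written without division. *)
Definition clear_denom k (p q : nat -> {poly C}) : {poly {poly C}} :=
  \poly_(j < k.+1) if j == k then \prod_(l < k) q l
                   else \prod_(l < k) if l == j :> nat then p l else q l.

Lemma bideg_clear_denom k n (p q : nat -> {poly C}) : (0 < n)%N ->
  (forall l, (size (p l) <= n.+1)%N) -> (forall l, (size (q l) <= n.+1)%N) ->
  bideg (k * n) (clear_denom k p q).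
Proof.
move=> n0 sp sq; split=> [|j].
  by apply: leq_trans (size_poly _ _) _; rewrite ltnS leq_pmulr.
rewrite coef_poly; case: ifP => _; last by rewrite size_poly0.
case: ifP => _; first exact: size_prod_le.
by apply: (@size_prod_le k n (fun l => if l == j then p l else q l)) => l; case: ifP.
Qed.

Section Size.
Variables (k : nat) (p q : nat -> {poly C}).
Hypothesis q_neq0 : forall l, q l != 0.

Let prod_neq0 : \prod_(l < k) q l != 0.
Proof. by apply/prodf_neq0 => l _. Qed.

Lemma size_clear_denom : size (clear_denom k p q) = k.+1.
Proof. by apply: size_poly_eq; rewrite eqxx. Qed.

Lemma lead_clear_denom : lead_coef (clear_denom k p q) = \prod_(l < k) q l.
Proof. by rewrite lead_coef_poly ?eqxx. Qed.

End Size.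

Lemma ev_clear_denom k (p q : nat -> {poly C}) z w : (forall l, (l < k)%N -> (q l).[z] != 0) ->
  ev (clear_denom k p q) z w =
  (\prod_(l < k) q l).[z] * (w ^+ k + \sum_(j < k) (p j).[z] / (q j).[z] * w ^+ j).
Proof.
move=> q0; rewrite /ev horner_poly big_ord_recr /= eqxx hornerD horner_sum.
rewrite hornerM -polyC_exp hornerC addrC mulrDr; congr (_ + _).
rewrite big_distrr; apply: eq_bigr => j _ /=.
rewrite ltn_eqF // -polyC_exp hornerM hornerC mulrA; congr (_ * _).
rewrite !horner_prod (bigD1 j) //= eqxx [in RHS](bigD1 j) //=.
rewrite mulrAC mulrCA [(q j).[z] * _]mulrC -mulrA; congr (_ * _).
rewrite mulVf ?q0 // mul1r; apply: eq_bigr => l.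
by rewrite -val_eqE /= => /negbTE ->.
Qed.

Lemma sum_rev (V : nmodType) k (F : nat -> V) :
  \sum_(1 <= i < k.+1) F i = \sum_(j < k) F (k - j)%N.
Proof.
rewrite big_add1 /= big_nat_rev /= big_mkord; apply: eq_bigr => j _.
by rewrite add0n subnSK.
Qed.

Lemma common_approximation K k (f : nat -> C -> C) : K !=set0 ->
  (forall j, (j < k)%N -> R0 K (f j)) ->
  exists2 theta : R, 0 < theta < 1 & exists m0, forall j m, (j < k)%N -> (m0 <= m)%N ->
    exists p q : {poly C}, [/\ (size p <= m.+1)%N, (size q <= m.+1)%N, forall z, K z -> q.[z] != 0 &
      forall z, K z -> nc (f j z - p.[z] / q.[z]) <= theta ^+ m].
Proof.
move=> K0; elim: k => [_|k IH hf]; first by exists 2^-1; [lra|exists 0%N].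
have [|t /andP[t0 t1] [m0 H]] := IH; first by move=> j jk; apply: hf; exact: ltnW.
have [t' /andP[t'0 t'1] [m1 H']] := R0_approximation K0 (hf k (ltnSn k)).
exists (Num.max t t'); first by rewrite lt_max gt_max t0 t1 t'1.
exists (maxn m0 m1) => j m; rewrite ltnS leq_eqVlt geq_max => jk /andP[mm0 mm1].
have tm : t ^+ m <= Num.max t t' ^+ m.
  by rewrite lerXn2r ?nnegrE ?le_max ?lexx ?(ltW t0).
have tm' : t' ^+ m <= Num.max t t' ^+ m.
  by rewrite lerXn2r ?nnegrE ?le_max ?lexx ?(ltW t0) ?(ltW t'0) ?orbT.
case/orP: jk => [/eqP ->|jk].
  have [p [q [h1 h2 h3 h4]]] := H' m mm1; exists p, q; split => // z Kz.
  exact: le_trans (h4 z Kz) tm'.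
have [p [q [h1 h2 h3 h4]]] := H j m jk mm0; exists p, q; split => // z Kz.
exact: le_trans (h4 z Kz) tm.
Qed.

Lemma common_bound (a b : R) k (f : nat -> C -> C) : a <= b ->
  (forall j, (j < k)%N -> R0 (real_segment a b) (f j)) ->
  exists B : R, forall j z, (j < k)%N -> real_segment a b z -> nc (f j z) <= B.
Proof.
move=> ab; elim: k => [_|k IH hf]; first by exists 0.
have [|B HB] := IH; first by move=> j jk; apply: hf; exact: ltnW.
have [B' HB'] := R0_bounded ab (hf k (ltnSn k)).
exists (Num.max B B') => j z; rewrite ltnS leq_eqVlt => /orP[/eqP ->|jk] Kz.
  by rewrite le_max HB' ?orbT.
by rewrite le_max HB.
Qed.

(** Cauchy's bound: if [nc w > 1], all lower powers are at most [nc w ^+ k.-1]. *)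
Lemma root_bound k (u : nat -> C) w (B : R) : (0 < k)%N -> 0 <= B ->
  (forall j, (j < k)%N -> nc (u j) <= B) ->
  w ^+ k + \sum_(j < k) u j * w ^+ j = 0 -> nc w <= Num.max 1 (k%:R * B).
Proof.
move=> k0 B0 hu /eqP; rewrite addr_eq0 => /eqP hw.
have [w1|w1] := leP (nc w) 1; first by rewrite le_max w1.
rewrite le_max; apply/orP; right.
have : nc w ^+ k <= k%:R * B * nc w ^+ k.-1.
  rewrite -ncX hw ncN; apply: le_trans (nc_sum _ _ _) _.
  apply: (@le_trans _ _ (\sum_(j < k) B * nc w ^+ k.-1)); last first.
    by rewrite sumr_const card_ord -mulrA mulr_natl.
  apply: ler_sum => j _; rewrite ncM ncX ler_pM ?nc_ge0 ?exprn_ge0 ?nc_ge0 ?hu //.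
  by rewrite ler_weXn2l ?(ltW w1) // -ltnS prednK.
by case: (k) k0 => // k' _; rewrite /= exprS ler_pM2r // exprn_gt0 // (lt_trans ltr01).
Qed.

End ClearDenominators.

(** * Polynomials that are small on the algebroid graph *)

Theorem theorem0p1 (R : realType) (a b : R) (hab : a <= b)
    (k : nat) (hk : (1 <= k)%N) (c : nat -> R[i] -> R[i])
    (hc : forall i, (1 <= i <= k)%N -> R0 (real_segment a b) (c i)) :
  pluripolar (algebroid_graph (real_segment a b) k c).
Proof.
pose f j := c (k - j)%N.
have hf j : (j < k)%N -> R0 (real_segment a b) (f j).
  by move=> jk; apply: hc; rewrite subn_gt0 jk leq_subr.
have K0 : real_segment a b !=set0 by exists a%:C, a => //=; rewrite in_itv /= lexx.
have [theta /andP[t0 t1] [m0 Happ]] := common_approximation K0 hf.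
have [B HB] := common_bound hab hf.
pose G := [set x : R[i] * R[i] | real_segment a b x.1 /\
  x.2 ^+ k + \sum_(j < k) f j x.1 * x.2 ^+ j = 0].
have -> : algebroid_graph (real_segment a b) k c =
    [set p | G (p ord0 ord0, p ord0 ord_max)].
  apply/funext => p; rewrite /algebroid_graph /G /= sum_rev.
  congr (_ /\ (_ + _ = 0)); apply: eq_bigr => j _.
  by rewrite subKn // ltnW.
pose B' := Num.max B 0; pose M := Num.max 1 (k%:R * B').
have HB' j z : (j < k)%N -> real_segment a b z -> nc (f j z) <= B'.
  by move=> jk Kz; rewrite le_max HB.
have M1 : 1 <= M by rewrite le_max lexx.
have wM x : G x -> nc x.2 <= M.
  move=> [Kx Hx]; apply: (@root_bound R k (f^~ x.1) _ B' hk _ _ Hx) => [|j jk].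
    by rewrite le_max lexx orbT.
  exact: HB'.
have bG : bounded2 G (`|a| + `|b| + M).
  move=> x Gx; have := wM x Gx; have [/segment_bound Kx _] := Gx.
  have := normr_ge0 a; have := normr_ge0 b; by split; lra.
(* The default [(0, 1)] preserves the degree bounds and [q != 0] at indices without an approximant,
   as [P m] must be defined for every [m]. *)
have pick jm : exists pq : {poly R[i]} * {poly R[i]}, [/\ (size pq.1 <= jm.2.+1)%N,
    (size pq.2 <= jm.2.+1)%N, pq.2 != 0 & (jm.1 < k)%N -> (m0 <= jm.2)%N ->
    forall z, real_segment a b z ->
      pq.2.[z] != 0 /\ nc (f jm.1 z - pq.1.[z] / pq.2.[z]) <= theta ^+ jm.2].
  case: jm => j m /=.
  have [/andP[jk mm]|H] := boolP ((j < k) && (m0 <= m))%N; last first.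
    exists (0, 1); split; [by rewrite size_poly0|by rewrite size_poly1|exact: oner_neq0|].
    by move=> jk mm; rewrite jk mm in H.
  have [p [q [h1 h2 h3 h4]]] := Happ j m jk mm; exists (p, q); split => //=.
    have [z /h3] := K0; by apply: contra_neq => ->; rewrite horner0.
  by move=> _ _ z Kz; split; [exact: h3|exact: h4].
have [F HF] := choice pick.
(* Index [m] uses approximants of degree [m.+1], so the degree [k * m.+1] of [P m] is never 0. *)
pose p m j := (F (j, m.+1)).1; pose q m j := (F (j, m.+1)).2.
have sp m j : (size (p m j) <= m.+2)%N by have [] := HF (j, m.+1).
have sq m j : (size (q m j) <= m.+2)%N by have [] := HF (j, m.+1).
have q0 m j : q m j != 0 by have [] := HF (j, m.+1).
have app m j z : (j < k)%N -> (m0 <= m.+1)%N -> real_segment a b z ->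
    (q m j).[z] != 0 /\ nc (f j z - (p m j).[z] / (q m j).[z]) <= theta ^+ m.+1.
  by move=> jk mm; have [_ _ _] := HF (j, m.+1); apply.
pose Q m := \prod_(l < k) q m l.
have Q0 m : Q m != 0 by apply/prodf_neq0 => l _.
pose s m : R[i] := (mah 1 (Q m) 0)^-1%:C.
have mQ m : 0 < mah 1 (Q m) 0 := mah_gt0 0 ltr01 (Q0 m).
have s0 m : s m != 0 by rewrite -nc_gt0 nc_real normr_gt0 invr_eq0 gt_eqF.
pose P m := (s m)%:P *: clear_denom k (p m) (q m).
have lP m : lead_coef (P m) = s m *: Q m.
  by rewrite lead_coefZ lead_clear_denom // mul_polyC.
(* [theta ^+ n = exp (- 2 eps n)]: one half of the decay absorbs the constant [k M^k], the other
   half remains. *)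
pose eps := - ln theta / 2.
have e0 : 0 < eps by rewrite divr_gt0 // oppr_gt0 ln_lt0 // t0.
have k0 : 0 < k%:R :> R by rewrite ltr0n.
have kM : 0 < (k%:R * M ^+ k)^-1.
  by rewrite invr_gt0 mulr_gt0 // exprn_gt0 // (lt_le_trans ltr01).
have [N HN] := expR_le_power 1 kM e0.
(* With degree [k (m + 1)], the choice [gamma = eps / (4 k)] makes the required exponent
   [4 gamma k (m + 1)] equal to [eps (m + 1)]. *)
apply: (@pluripolar_of_small_polynomials R G _ k P (eps / (4 * k%:R)) bG hk _ _ _ _ (maxn m0 N)).
- by rewrite divr_gt0 // mulr_gt0.
- move=> m; apply: bidegZ; first exact: size_polyC_leq1.
  exact: bideg_clear_denom.
- by move=> m; rewrite size_scale ?polyC_eq0 // size_clear_denom.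
- by move=> m; rewrite lP (mahZ _ _ (s0 m) (Q0 m)) /s nc_real ger0_norm
    ?invr_ge0 ?(ltW (mQ m)) // mulVf ?gt_eqF.
move=> m x; rewrite geq_max => /andP[mm Nm] Gx; have [Kx Hx] := Gx.
have mm' : (m0 <= m.+1)%N by exact: leqW.
have Nm' : (N <= m.+1)%N by exact: leqW.
have qz l : (l < k)%N -> (q m l).[x.1] != 0 by move=> lk; have [] := app m l _ lk mm' Kx.
have -> : evp (P m) x = (lead_coef (P m)).[x.1] *
    (x.2 ^+ k + \sum_(j < k) (p m j).[x.1] / (q m j).[x.1] * x.2 ^+ j).
  rewrite lP hornerZ -mulrA -ev_clear_denom // /evp /P /ev hornerZ hornerM hornerC.
  by [].
rewrite ncM ler_wpM2l ?nc_ge0 //; set n := m.+1 in mm' Nm' *.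
(* Subtracting the equation of the graph leaves only the approximation errors. *)
have -> : x.2 ^+ k + \sum_(j < k) (p m j).[x.1] / (q m j).[x.1] * x.2 ^+ j =
    \sum_(j < k) ((p m j).[x.1] / (q m j).[x.1] - f j x.1) * x.2 ^+ j.
  move/eqP: Hx; rewrite addr_eq0 => /eqP ->.
  by under [RHS]eq_bigr do rewrite mulrBl; rewrite sumrB addrC.
apply: (@le_trans _ _ (k%:R * M ^+ k * theta ^+ n)).
  apply: le_trans (nc_sum _ _ _) _.
  apply: (@le_trans _ _ (\sum_(j < k) M ^+ k * theta ^+ n)); last first.
    by rewrite sumr_const card_ord -mulrA mulr_natl.
  apply: ler_sum => j _; rewrite ncM mulrC ncX ler_pM ?exprn_ge0 ?nc_ge0 //.
    apply: (@le_trans _ _ (M ^+ j)); last by rewrite ler_weXn2l // ltnW.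
    by rewrite lerXn2r ?nnegrE ?nc_ge0 ?(le_trans ler01) ?wM.
  by rewrite nc_distC; have [] := app m j _ (ltn_ord j) mm' Kx.
have -> : 4 * (eps / (4 * k%:R)) * (k * n)%:R = eps * n%:R.
  by rewrite natrM; field; rewrite gt_eqF.
have -> : theta ^+ n = expR (- (eps * n%:R)) * expR (- (eps * n%:R)).
  rewrite -expRD -[theta in LHS]lnK ?posrE // -expRM_natr; congr expR.
  by rewrite /eps; field.
have := HN n Nm'; rewrite expr1; set e := expR _; set L := _ * M ^+ k => He.
have L0 : 0 < L by rewrite -invr_gt0.
rewrite mulrA ler_piMl ?expR_ge0 //.
by rewrite -(divff (lt0r_neq0 L0)) ler_wpM2l ?(ltW L0).
Qed.
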